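(* For each $n\ge1$ let $\boldsymbol d=(d_1,\dots,d_n)$ (depending on $n$) be positive integers with $\ell_n=\sum_{i\in[n]}d_i$ even, $\max_id_i=o(\ell_n)$ and $\ell_n=\omega(\log n)$. Let $\rho_n=\frac1{\sqrt{\ell_n}}\sum_{i\in[n]}\delta_{d_i/\sqrt{\ell_n}}$ and $b_n=\int_0^\infty(x\wedge1)\rho_n(dx)$. As $n\to\infty$, $\mathrm{CM}_n(\boldsymbol d)$ is sampling convergent a.s. $\mathbb P_{\mathrm{CM}}$ to a multigraphex of the form $(0,0,I_{\mathrm{CM}})$ if and only if $b_n\to b$ for some $b$ and $\rho_n\to\rho$ vaguely with $\rho=0$; here $I_{\mathrm{CM}}=a^2/2$ with $a=b-\int(x\wedge1)\rho(dx)$.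
   Context: $\rho_n,\rho$ are measures on $(0,\infty)$ and vague convergence is on $(0,\infty)$. $\mathrm{CM}_n(\boldsymbol d)$ is the configuration model: vertex $j$ gets $d_j$ half-edges, a uniform perfect matching of the $\ell_n$ half-edges is taken and each matched pair becomes an edge (loops and multiple edges allowed). $\mathbb P_{\mathrm{CM}}$ is the product over $n$ of the laws of $\mathrm{CM}_n(\boldsymbol d)$. Sampling: $e(G)$ is the number of non-loop edges (with multiplicity). $\mathrm{Smpl}(G,p)$ is the unlabeled random multigraph obtained by keeping each vertex of $G$ independently with probability $p$, taking induced edges and deleting isolated vertices. $(G_n)$ is sampling convergent to $\mathcal W$ if for all $t>0$, $\mathrm{Smpl}(G_n,t/\sqrt{2e(G_n)})$ converges in distribution (in the countable discrete space of finite unlabeled multigraphs) to $\mathrm{GP}_t(\mathcal W)$; for random graphs, ''a.s.'' means for almost every realization of the graph sequence, the law of the sample being conditional on the graphs. The multigraphex $(0,0,I)$ with constant $I\ge0$ has no graphon part (no edges), no star part, and isolated edge constant $I$: $\mathrm{GP}_t((0,0,I))$ is the unlabeled graph consisting of a $\mathrm{Poisson}(t^2I)$ number of vertex-disjoint single edges. *)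

(* Defs.v *)
From HB Require Import structures.
From mathcomp Require Import all_boot all_order all_algebra.
From mathcomp Require Import all_classical all_reals all_analysis.
Import Order.TTheory GRing.Theory Num.Theory.
Import numFieldNormedType.Exports.

Set Implicit Arguments.
Unset Strict Implicit.
Unset Printing Implicit Defensive.

Local Open Scope classical_set_scope.
Local Open Scope ring_scope.

(* Multigraphs on 'I_n, by their symmetric adjacency matrix: for i != j,
   [mult G i j] is the number of edges between i and j; [mult G i i] is the
   number of loops at i (each loop counted once). *)
Record mgraph n := MGraph { mult :> 'M[nat]_n ; mult_sym : mult^T == mult }.

HB.instance Definition _ n := [isSub for @mult n].
HB.instance Definition _ n := [Countable of mgraph n by <:].

Lemma mgraphC n (G : mgraph n) i j : G i j = G j i.
Proof. by have /eqP/matrixP/(_ j i) := mult_sym G; rewrite mxE. Qed.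

Lemma mk_mgraph_subproof n (m : 'I_n -> 'I_n -> nat) :
  (forall i j, m i j = m j i) ->
  (\matrix_(i, j) m i j)^T == \matrix_(i, j) m i j :> 'M[nat]_n.
Proof. by move=> msym; apply/eqP/matrixP => i j; rewrite !mxE. Qed.

Definition mk_mgraph n (m : 'I_n -> 'I_n -> nat)
  (msym : forall i j, m i j = m j i) : mgraph n :=
  MGraph (mk_mgraph_subproof msym).

Definition mgraph0 n : mgraph n := @mk_mgraph n (fun _ _ => 0%N) (fun _ _ => erefl).

HB.instance Definition _ n := isPointed.Build (mgraph n) (mgraph0 n).

(* Number of non-loop edges, with multiplicity. *)
Definition nb_edges n (G : mgraph n) : nat :=
  \sum_(i < n) \sum_(j < n | (i < j)%N) G i j.

(* Finite unlabeled multigraphs: isomorphism classes. *)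
Definition fmgraph : Type := {n : nat & mgraph n}.
HB.instance Definition _ := Countable.on fmgraph.

Definition mgraph_iso (G H : fmgraph) : bool :=
  `[< exists2 f : 'I_(tag G) -> 'I_(tag H), bijective f &
        forall i j, tagged H (f i) (f j) = tagged G i j >].

Lemma mgraph_iso_refl : reflexive mgraph_iso.
Proof. by move=> G; apply/asboolP; exists id => //; exists id. Qed.

Lemma mgraph_iso_imp G H : mgraph_iso G H -> mgraph_iso H G.
Proof.
move=> /asboolP[f [g fK gK] fP]; apply/asboolP; exists g; first by exists f.
by move=> i j; rewrite -fP !gK.
Qed.

Lemma mgraph_iso_sym : symmetric mgraph_iso.
Proof. by move=> G H; apply/idP/idP; exact: mgraph_iso_imp. Qed.

Lemma mgraph_iso_trans : transitive mgraph_iso.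
Proof.
move=> H G K /asboolP[f fB fP] /asboolP[g gB gP]; apply/asboolP.
by exists (g \o f); [exact: bij_comp | move=> i j /=; rewrite gP fP].
Qed.

Canonical mgraph_iso_equiv :=
  EquivRel mgraph_iso mgraph_iso_refl mgraph_iso_sym mgraph_iso_trans.

Definition umgraph : Type := {eq_quot mgraph_iso_equiv}%qT.

Definition unlabel n (G : mgraph n) : umgraph :=
  (\pi_umgraph (Tagged mgraph G : fmgraph))%qT.

(* Subgraph of G induced by A, relabeled by 'I_#|A|. *)
Definition induced n (G : mgraph n) (A : {set 'I_n}) : mgraph #|A| :=
  @mk_mgraph #|A| (fun i j => G (enum_val i) (enum_val j))
    (fun i j => mgraphC G _ _).

(* A vertex carrying a loop is not isolated. *)
Definition non_isolated n (G : mgraph n) (S : {set 'I_n}) : {set 'I_n} :=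
  [set v in S | [exists w in S, (0 < G v w)%N]]%SET.

Definition sampled n (G : mgraph n) (S : {set 'I_n}) : umgraph :=
  unlabel (induced G (non_isolated G S)).

Lemma disjoint_edges_subproof k (i j : 'I_k.*2) :
  (i != j) && (i./2 == j./2) = (j != i) && (j./2 == i./2) :> nat.
Proof. by rewrite eq_sym [_./2 == _]eq_sym. Qed.

(* k vertex-disjoint single edges {0,1}, {2,3}, ..., {2k-2,2k-1}. *)
Definition disjoint_edges k : umgraph :=
  unlabel (mk_mgraph (@disjoint_edges_subproof k)).

Section sampling.
Context {R : realType}.

(* The law of a random unlabeled multigraph X is given by its expectation
   functional f |-> E[f(X)]. *)
Definition ulaw := (umgraph -> R) -> R.

Definition Smpl n (G : mgraph n) (p : R) : ulaw := fun f =>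
  \sum_(S : {set 'I_n}) p ^+ #|S| * (1 - p) ^+ #|(~: S)%SET| * f (sampled G S).

(* The law GP_t((0,0,I)). The second argument of [poisson_prob] is unused by
   the library definition, which is the Dirac mass at 0 when the rate is 0. *)
Definition GP_isolated (I t : R) : ulaw := fun f =>
  \int[poisson_prob (t ^+ 2 * I) 0]_k f (disjoint_edges k).

(* On a discrete space every function is continuous. *)
Definition cvg_in_distribution (L_ : nat -> ulaw) (L : ulaw) :=
  forall f : umgraph -> R, (exists M, forall H, `|f H| <= M) ->
    L_ n f @[n --> \oo] --> L f.

(* The truncation at 1 makes the retention probability meaningful for the
   (finitely many, when e(G_n) -> oo) n with 2 e(G_n) < t^2. *)
Definition sampling_cvg (G : forall n, mgraph n) (GP : R -> ulaw) :=
  forall t : R, 0 < t ->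
    cvg_in_distribution
      (fun n => Smpl (G n)
                  (Num.min 1 (t / Num.sqrt (2 * (nb_edges (G n))%:R))))
      (GP t).

End sampling.

Section configuration_model.
Variables (n : nat) (d : nat -> nat).

Definition half_edge : finType := {i : 'I_n & 'I_(d i)}.

Definition perfect_matchings : {set {set {set half_edge}}} :=
  [set M | finset.partition M [set: half_edge] && [forall B in M, #|B| == 2]]%SET.

Definition cm_mult (M : {set {set half_edge}}) (i j : 'I_n) : nat :=
  #|[set B in M | [set tag h | h in B] == [set i; j]]%SET|.

Lemma cm_mult_sym M i j : cm_mult M i j = cm_mult M j i.
Proof. by rewrite /cm_mult finset.setUC. Qed.

Definition cm_graph M : mgraph n := mk_mgraph (cm_mult_sym M).

Definition CM_law {R : realType} (A : set (mgraph n)) : R :=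
  #|[set M in perfect_matchings | `[< A (cm_graph M) >]]%SET|%:R
    / #|perfect_matchings|%:R.

End configuration_model.

(* The product of the discrete spaces of multigraphs on 'I_n, n : nat, with
   its product sigma-algebra. *)
Definition coordinate_events : set (set (forall n, mgraph n)) :=
  [set E | exists n (A : set (mgraph n)), E = [set G | A (G n)]].

Definition mgraph_seq := g_sigma_algebraType coordinate_events.

(* P is the product over n of the laws of CM_n(d_n); the factor n = 0 is
   trivial. *)
Definition is_P_CM {R : realType} (d : nat -> nat -> nat)
    (P : probability mgraph_seq R) :=
  forall (N : nat) (A : forall n, set (mgraph n)),
    P [set G : mgraph_seq | forall n, (n < N)%N -> A n (G n)] =
    (\prod_(n < N) CM_law (d n) (A n))%:E.

Section degree_measure.
Context {R : realType}.

Definition ell n (d : nat -> nat) : nat := \sum_(i < n) d i.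

Definition rho_ n (d : nat -> nat) : {measure set R -> \bar R} :=
  mscale (Num.sqrt (ell n d)%:R)^-1%:nng
    (msum (fun i => \d_((d i)%:R / Num.sqrt (ell n d)%:R : R)) n).

(* Integrals are over (0, +oo): only the restriction of a measure on R to
   (0, +oo) matters. *)
Definition int_min1 (mu : {measure set R -> \bar R}) : R :=
  \int[mu]_(x in `]0, +oo[) Num.min x 1.

Definition vague_cvg (mu_ : nat -> {measure set R -> \bar R})
    (mu : {measure set R -> \bar R}) :=
  forall f : R -> R, continuous f ->
    (exists K : set R, [/\ compact K, K `<=` `]0, +oo[ &
       forall x, ~ K x -> f x = 0]) ->
    (\int[mu_ n]_(x in `]0%R, +oo[) (f x)%:E @[n --> \oo] -->
     \int[mu]_(x in `]0%R, +oo[) (f x)%:E)%E.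

End degree_measure.

(* Main.v *)
Require Import Defs.
From mathcomp Require Import all_boot all_order all_algebra.
From mathcomp Require Import perm ring lra zify.
From mathcomp Require Import reals sequences exp.
Import Order.TTheory GRing.Theory Num.Theory.
Set Implicit Arguments.
Unset Strict Implicit.
Unset Printing Implicit Defensive.

(** Let N = [ell n (d n)] be the number of half-edges, and call a vertex large
    when its degree exceeds eps * sqrt N. As degrees are positive, N >= n: an
    event of probability O(N^-2) occurs for finitely many [n] only, almost
    surely ([borel_cantelli_CM]).

    In terms of the degrees, [rho_ n] tends vaguely to 0 if and only if, for
    every eps, there are o(sqrt N) large vertices ([vague_cvg0_large_density],
    [large_density_vague_cvg0]). In that case b_n is, up to o(1), the fraction
    of the half-edges that sit at small vertices ([int_min1_small]).

    From degrees to samples. As no degree is of order N, few edges are loops,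
    2 e(G) is close to N, and the sampling probability p is close to
    t / sqrt N. A sample therefore misses the o(sqrt N) large vertices. Among
    the small ones there are o(sqrt N) loops, about b_n^2 N / 2 pairs of
    adjacent vertices, o(N) of which are joined by more than one edge, and
    o(N^(3/2)) pairs of edges with a common vertex, because the sum of d_v^2
    over the small vertices is at most eps * sqrt N * N. So the sample is, with
    high probability, a set of disjoint edges; their number is a sum of weakly
    dependent indicators with mean close to t^2 b_n^2 / 2, and the Stein-Chen
    method makes it Poisson. This argument is deterministic
    ([Smpl_poisson_bound], [typical_sampling]) and concerns every graph with
    the counts just listed, which are collected in [typical]. That a random
    graph fails to be typical with probability O(N^-2) only
    ([CM_law_atypical]) follows from the Azuma-Hoeffding inequality for
    uniform matchings ([pmatch_azuma]) for the counts of order N, and from a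
    high factorial moment ([pair_count_tail]) for the loops at small vertices.

    From samples to degrees. The sample contains a loop with probability
    1 - (1 - p)^k, where k is the number of vertices with a loop, and the limit
    contains none. Were the number of large vertices not o(sqrt N), then, for
    infinitely many [n], a positive fraction of them would carry a loop with
    probability bounded below ([many_loops_law]); this would happen infinitely
    often with positive probability ([not_eventually_CM]), and then k would be
    of order sqrt N. Hence the large vertices are o(sqrt N) in number
    ([ae_sampling_sparse]), and the first part applies with b_n in place of its
    limit: the sample is empty with probability exp(- t^2 b_n^2 / 2) + o(1),
    which must tend to exp(- t^2 I), so that b_n tends to sqrt(2 I)
    ([ae_sampling_limit]). The probability of the empty sample also shows that
    the limit determines I ([sampling_limit_unique]). *)

Local Open Scope nat_scope.

(** * Uniform perfect matchings *)

Section matchings.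
Context (T : finType).
Implicit Types (M U : {set {set T}}) (B : {set T}).

Definition pmatch : {set {set {set T}}} :=
  [set M | partition M [set: T] && [forall B in M, #|B| == 2]].

(** The matchings still possible once the pairs in [U] have been revealed. *)
Definition pmext U := [set M in pmatch | U \subset M].

Lemma pmatchP M : reflect
  [/\ cover M = setT, trivIset M & {in M, forall B, #|B| = 2}] (M \in pmatch).
Proof.
rewrite inE; apply: (iffP andP) => [[/and3P[/eqP cM tM _] /forall_inP M2]|].
  by split=> // B /M2/eqP.
move=> [cM tM M2]; split; last by apply/forall_inP => B /M2/eqP.
apply/and3P; split=> //; first exact/eqP.
by apply/negP => /M2; rewrite cards0.
Qed.

Lemma setU1_subset B U M : (B |: U \subset M) = (B \in M) && (U \subset M).
Proof. by rewrite subUset (@sub1set _ M B). Qed.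

Lemma pmext0 : pmext set0 = pmatch.
Proof. by apply/setP => M; rewrite inE sub0set andbT. Qed.

(** This involution carries the matchings containing {h, x} to those containing
    {h, y}, so all partners of [h] are equally likely; and it moves at most two
    pairs, so functions of few pairs change little. *)
Definition swapm (x y : T) M : {set {set T}} :=
  [set [set tperm x y z | z in B : {set T}] | B in M : {set {set T}}].

Lemma swapmK x y : involutive (swapm x y).
Proof.
move=> M; rewrite /swapm -imset_comp -[RHS]imset_id; apply: eq_imset => B /=.
rewrite -imset_comp -[RHS]imset_id; apply: eq_imset => z /=; exact: tpermK.
Qed.

Lemma swapm_pmatch x y M : (swapm x y M \in pmatch) = (M \in pmatch).
Proof.
suff h M' : M' \in pmatch -> swapm x y M' \in pmatch.
  by apply/idP/idP => /h //; rewrite swapmK.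
rewrite !inE => /andP[pM /forall_inP M2]; apply/andP; split.
  have <- : [set tperm x y z | z in [set: T]] = [set: T].
    by apply/setP => z; rewrite inE -[z](tpermK x y) imset_f // inE.
  by rewrite imset_partition //; exact: perm_inj.
apply/forall_inP => _ /imsetP[B BM ->]; rewrite card_imset ?M2 //.
exact: perm_inj.
Qed.

Lemma tperm_fix x y B : x \notin B -> y \notin B ->
  [set tperm x y z | z in B] = B.
Proof.
move=> xB yB; rewrite -[RHS]imset_id; apply: eq_in_imset => z zB /=.
by rewrite tpermD //; [apply: contraNneq xB|apply: contraNneq yB] => ->.
Qed.

Lemma swapm_sub x y U M : x \notin cover U -> y \notin cover U ->
  U \subset M -> U \subset swapm x y M.
Proof.
move=> xU yU /subsetP UM; apply/subsetP => B BU; apply/imsetP; exists B.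
  exact: UM.
by rewrite tperm_fix //; [apply: contraNN xU|apply: contraNN yU] => ?;
  apply/bigcupP; exists B.
Qed.

Lemma swapm_pair (h x y : T) : h != x -> h != y ->
  [set tperm x y z | z in [set h; x]] = [set h; y] :> {set T}.
Proof.
move=> hx hy; rewrite imsetU !imset_set1 tpermL tpermD //; by rewrite eq_sym.
Qed.

Lemma swapm_pmext h x y U M :
  x \notin cover U -> y \notin cover U -> h != x -> h != y ->
  (swapm x y M \in pmext ([set h; y] |: U)) = (M \in pmext ([set h; x] |: U)).
Proof.
suff imp x' y' M' : x' \notin cover U -> y' \notin cover U ->
    h != x' -> h != y' ->
    M' \in pmext ([set h; x'] |: U) -> swapm x' y' M' \in pmext ([set h; y'] |: U).
  move=> xU yU hx hy; apply/idP/idP; last exact: imp.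
  have swC A : swapm x y A = swapm y x A by rewrite /swapm tpermC.
  by rewrite -{2}[M](swapmK y x) swC; exact: imp.
move=> xU yU hx hy; rewrite inE setU1_subset => /andP[Mpm /andP[hM UM]].
rewrite inE swapm_pmatch Mpm setU1_subset swapm_sub // andbT.
by rewrite -(swapm_pair hx hy) imset_f.
Qed.

Lemma sum_pmext_swap (V : nmodType) (F : {set {set T}} -> V) h x y U :
  x \notin cover U -> y \notin cover U -> h != x -> h != y ->
  (\sum_(M in pmext ([set h; y] |: U)) F M)%R =
  (\sum_(M in pmext ([set h; x] |: U)) F (swapm x y M))%R.
Proof.
move=> xU yU hx hy; rewrite (reindex_inj (can_inj (swapmK x y))).
by apply: eq_bigl => M; rewrite swapm_pmext.
Qed.

(** [h'] is the partner of [h] in [M]; the equivalence makes a sum over the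
    possible partners collapse to one term. *)
Lemma pmext_partner U h M : M \in pmext U -> h \notin cover U ->
  exists h', forall x,
   ((x \notin cover U) && (h != x)) && (M \in pmext ([set h; x] |: U)) = (x == h').
Proof.
rewrite inE => /andP[Mpm UM] hU; have [cM tM M2] := pmatchP _ Mpm.
have hc : h \in cover M by rewrite cM inE.
have BM := pblock_mem hc; have hB : h \in pblock M h by rewrite mem_pblock.
have /eqP := M2 _ BM; rewrite (cardsD1 h) hB add1n eqSS => /cards1P[h' Bh'].
have Beq : pblock M h = [set h; h'] by rewrite -(setD1K hB) Bh'.
have hh' : h != h'.
  have : h' \in pblock M h :\ h by rewrite Bh' set11.
  by rewrite !inE eq_sym => /andP[].
exists h' => x; apply/idP/eqP => [|->].
  rewrite inE setU1_subset => /andP[/andP[xU hx] /and3P[_ xM _]].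
  have := def_pblock tM xM (set21 _ _); rewrite Beq => /setP/(_ x).
  by rewrite !inE eqxx orbT orbC eq_sym (eq_sym x h) (negPf hx) orbF => /eqP.
rewrite hh' andbT inE Mpm setU1_subset UM -Beq BM !andbT.
apply: contraNN hU => /bigcupP[C CU h'C].
have h'B : h' \in pblock M h by rewrite Beq set22.
have CM := subsetP UM _ CU.
apply/bigcupP; exists C => //.
by rewrite -(def_pblock tM CM h'C) (def_pblock tM BM h'B).
Qed.

(** One step of the exploration of a matching, which reveals the partner of
    [h]. *)
Lemma sum_pmext (V : nmodType) (F : {set {set T}} -> V) h U :
  h \notin cover U ->
  (\sum_(M in pmext U) F M)%R =
  (\sum_(x | (x \notin cover U) && (h != x))
     \sum_(M in pmext ([set h; x] |: U)) F M)%R.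
Proof.
move=> hU; rewrite (exchange_big_dep (mem (pmext U))) /=; last first.
  move=> x M _; rewrite !inE => /andP[->]; rewrite setU1_subset => /andP[_ ->] //.
apply: eq_bigr => M MU; have [h' h'P] := pmext_partner MU hU.
by rewrite (eq_bigl _ _ h'P) big_pred1_eq.
Qed.

Lemma card_free U h : h \notin cover U ->
  #|[pred x | (x \notin cover U) && (h != x)]| = (#|T| - #|cover U| - 1)%N.
Proof.
move=> hU; have <- : #|~: cover U :\ h| = (#|T| - #|cover U| - 1)%N.
  have := cardsC (cover U); have := cardsD1 h (~: cover U).
  by rewrite inE hU /=; lia.
by apply: eq_card => x; rewrite !inE andbC eq_sym.
Qed.

Lemma card_pmext_pair U h x : h \notin cover U -> x \notin cover U -> h != x ->
  (#|pmext ([set h; x] |: U)| * (#|T| - #|cover U| - 1) = #|pmext U|)%N.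
Proof.
move=> hU xU hx.
have cardE A : #|pmext A| = \sum_(M in pmext A) 1 by rewrite sum1_card.
rewrite [RHS]cardE (sum_pmext _ hU) -(card_free hU) mulnC -sum_nat_const.
apply: eq_bigr => y /andP[yU hy].
by rewrite cardE (@sum_pmext_swap _ _ h y x) // sum1_card.
Qed.

Lemma cover_setU1 B U : cover (B |: U) = B :|: cover U.
Proof.
by rewrite /cover bigcup_setU big_set1.
Qed.

(** Prescribing [k] pairs multiplies the number of perfect matchings by
    1/((N-1)(N-3)...(N-2k+1)), N = #|T|, when the pairs are disjoint. *)
Lemma card_pmext_disjoint U : {in U, forall B, #|B| = 2} -> trivIset U ->
  (#|pmext U| * \prod_(i < #|U|) (#|T| - 1 - i.*2) = #|pmatch|)%N.
Proof.
have [k] := ubnP #|U|; elim: k U => // k IH U; rewrite ltnS => Uk U2 tU.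
have [->|[B BU]] := set_0Vmem U.
  by rewrite cards0 big_ord0 muln1 pmext0.
set U' := U :\ B; have UE : U = B |: U' by rewrite setD1K.
have cU' : #|U| = #|U'|.+1 by rewrite (cardsD1 B) BU.
have tU' : trivIset U' by apply: trivIsetS tU; exact: subsetDl.
have U'2 : {in U', forall C : {set T}, #|C| = 2} by move=> C /setD1P[_ /U2].
have dB : [disjoint B & cover U'].
  rewrite -setI_eq0; apply/eqP/setP => x; rewrite !inE; apply/negP.
  move=> /andP[xB /bigcupP[C /setD1P[CB CU] xC]].
  by move/eqP: CB; apply; rewrite -(def_pblock tU CU xC) (def_pblock tU BU xB).
have := U2 _ BU; move/eqP/cards2P => [h [x [hx BE]]].
have hU' : h \notin cover U' by move: dB => /disjointFr ->; rewrite // BE set21.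
have xU' : x \notin cover U' by move: dB => /disjointFr ->; rewrite // BE set22.
have coverU' : #|cover U'| = #|U'|.*2.
  rewrite -(eqP tU') -muln2 -sum_nat_const; apply: eq_bigr => C; exact: U'2.
have := IH U'; rewrite -cU' => /(_ Uk U'2 tU') <-.
rewrite -(card_pmext_pair hU' xU' hx) -BE -UE cU' big_ord_recr /= coverU'.
by rewrite [(#|T| - _.*2 - 1)%N]subnAC -mulnA; congr (_ * _)%N; rewrite mulnC.
Qed.

Lemma pmext_eq0 U : ~~ (trivIset U && [forall B in U, #|B| == 2]) ->
  #|pmext U| = 0%N.
Proof.
apply: contraNeq; rewrite -lt0n => /card_gt0P[M]; rewrite inE => /andP[Mpm UM].
have [_ tM M2] := pmatchP _ Mpm; rewrite (trivIsetS UM tM).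
by apply/forall_inP => B /(subsetP UM)/M2/eqP.
Qed.

(** The exact count for disjoint pairs remains an upper bound for any [U], since
    overlapping or improper pairs have no extension. *)
Lemma card_pmext_le U :
  (#|pmext U| * \prod_(i < #|U|) (#|T| - 1 - i.*2) <= #|pmatch|)%N.
Proof.
have [/andP[tU /forall_inP U2]|] := boolP (trivIset U && [forall B in U, #|B| == 2]).
  by rewrite card_pmext_disjoint // => B /U2/eqP.
by move=> /pmext_eq0 ->.
Qed.

Lemma card_setD_swapm x y M : M \in pmatch -> (#|M :\: swapm x y M| <= 2)%N.
Proof.
move=> /pmatchP[cM tM M2].
apply: (@leq_trans #|[set pblock M x; pblock M y]|); last first.
  by rewrite cards2; case: eqP.
apply/subset_leq_card/subsetP => B; rewrite !inE => /andP[BN BM].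
apply: contraNT BN; rewrite negb_or => /andP[Bx By].
apply/imsetP; exists B => //; rewrite tperm_fix //.
  by apply: contraNN Bx => ?; rewrite (def_pblock tM BM).
by apply: contraNN By => ?; rewrite (def_pblock tM BM).
Qed.

Lemma card_pmatch M : M \in pmatch -> #|T| = (#|M| * 2)%N.
Proof.
move=> /pmatchP[cM tM M2]; rewrite -cardsT -cM -(eqP tM) -sum_nat_const.
exact: eq_bigr.
Qed.

End matchings.

(** * Moments of pair counts *)

Section moments.
Context (T : finType).
Implicit Types (M U A : {set {set T}}) (Q : {set {set {set T}}}).

Lemma sum_count_sub Q :
  \sum_(M in pmatch T) #|[set U in Q | U \subset M]| = \sum_(U in Q) #|pmext U|.
Proof.
under eq_bigr do rewrite -sum1_card.
rewrite (exchange_big_dep (mem Q)) /=; last first.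
  by move=> M U _; rewrite inE => /andP[].
apply: eq_bigr => U UQ; rewrite -sum1_card; apply: eq_bigl => M.
by rewrite !inE UQ.
Qed.

Lemma mean_pairs A : {in A, forall B : {set T}, #|B| = 2} ->
  (\sum_(M in pmatch T) #|M :&: A|) * (#|T| - 1) = #|A| * #|pmatch T|.
Proof.
move=> A2; have -> : \sum_(M in pmatch T) #|M :&: A| =
    \sum_(M in pmatch T) #|[set U in [set [set B] | B in A] | U \subset M]|.
  apply: eq_bigr => M _; rewrite -(card_imset _ (@set1_inj _)).
  apply: eq_card => U; rewrite !inE; apply/imsetP/andP.
    move=> [B /setIP[BM BA] ->]; rewrite imset_f // (@sub1set _ M B) BM //.
  move=> [/imsetP[B BA ->]]; rewrite (@sub1set _ M B) => BM.
  by exists B => //; rewrite inE BM.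
rewrite sum_count_sub big_imset /=; last by move=> B C _ _; exact: set1_inj.
rewrite big_distrl -sum_nat_const /=; apply: eq_bigr => B BA.
have tB : trivIset [set B].
  by apply/trivIsetP => C D /set1P -> /set1P ->; rewrite eqxx.
rewrite -(card_pmext_disjoint _ tB); last by move=> C /set1P ->; exact: A2.
by rewrite cards1 big_ord1 double0 subn0.
Qed.

(** Every factor is at least half of [#|T|]. *)
Lemma prod_free_ge (k : nat) : 4 * k <= #|T| ->
  #|T| ^ k <= 2 ^ k * \prod_(i < k) (#|T| - 1 - i.*2).
Proof.
move=> kT; elim: {-2}k (leqnn k) => [|j IH] jk; first by rewrite big_ord0.
rewrite big_ord_recr /= [X in _ <= _ * X]mulnC !expnS mulnACA.
rewrite leq_mul ?IH //; last exact: ltnW.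
by rewrite -muln2; move: kT jk; move: (#|_|) => N; lia.
Qed.

Lemma sum_bin_pairs A k : \sum_(M in pmatch T) 'C(#|M :&: A|, k) =
  \sum_(U in [set U : {set {set T}} | U \subset A & #|U| == k]) #|pmext U|.
Proof.
rewrite -sum_count_sub; apply: eq_bigr => M _; rewrite -cards_draws.
by apply: eq_card => U; rewrite !inE subsetI -andbA andbC.
Qed.

(** Markov's inequality for the [k]-th factorial moment. It gives an exponential
    bound for counts far below [#|T|], at which the concentration inequality
    [pmatch_azuma] is silent. *)
Lemma pair_count_tail A (m k : nat) :
  0 < k -> k <= m -> 0 < #|T| -> 4 * k <= #|T| ->
  4 * #|A| <= #|T| * (m.+1 - k) ->
  #|[set M in pmatch T | m <= #|M :&: A|]| * 2 ^ k <= #|pmatch T|.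
Proof.
move=> k0 km T0 kT Am; set N := #|T|; set q := #|[set M in _ | _]|.
pose Q := [set U : {set {set T}} | U \subset A & #|U| == k].
have qQ : q * 'C(m, k) <= \sum_(U in Q) #|pmext U|.
  rewrite -sum_bin_pairs.
  rewrite (bigID (fun M => m <= #|M :&: A|)) /= (leq_trans _ (leq_addr _ _)) //.
  have -> : q * 'C(m, k) =
      \sum_(M in pmatch T | m <= #|M :&: A|) 'C(m, k).
    by rewrite -sum_nat_const; apply: eq_bigl => M; rewrite inE.
  by apply: leq_sum => M /andP[_ mM]; exact: leq_bin2l.
have cQ : #|Q| = 'C(#|A|, k) by rewrite -cards_draws; apply: eq_card => U; rewrite !inE.
have extN U : U \in Q -> #|pmext U| * N ^ k <= 2 ^ k * #|pmatch T|.
  rewrite inE => /andP[_ /eqP Uk]; have := card_pmext_le U; rewrite Uk => h.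
  apply: leq_trans (leq_mul (leqnn _) (prod_free_ge kT)) _.
  by rewrite mulnCA leq_mul.
have h1 : q * 'C(m, k) * N ^ k <= 'C(#|A|, k) * (2 ^ k * #|pmatch T|).
  apply: (leq_trans (leq_mul qQ (leqnn _))).
  by rewrite -cQ -sum_nat_const big_distrl /=; apply: leq_sum => U; exact: extN.
have h2 : q * m ^_ k * N ^ k <= #|A| ^_ k * (2 ^ k * #|pmatch T|).
  rewrite -!bin_ffact mulnA mulnAC [X in _ <= X]mulnAC leq_mul //.
have ff_ge j : j <= k -> (m.+1 - k) ^ j <= m ^_ j.
  elim: j => [//|j IH] jk; rewrite ffactnSr expnSr leq_mul ?IH //; first exact: ltnW.
  by lia.
have ff_le j : #|A| ^_ j <= #|A| ^ j.
  by elim: j => [//|j IH]; rewrite ffactnSr expnSr leq_mul // leq_subr.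
have h3 : q * (N * (m.+1 - k)) ^ k <= (2 * #|A|) ^ k * #|pmatch T|.
  apply: (@leq_trans (q * m ^_ k * N ^ k)).
    by rewrite expnMn mulnCA mulnC leq_mul // leq_mul // ff_ge.
  apply: (leq_trans h2); rewrite mulnA leq_mul // mulnC expnMn leq_mul //.
have [A0|A0] := posnP #|A|.
  move: h3; rewrite A0 muln0 exp0n // mul0n leqn0 muln_eq0 => /orP[/eqP ->|].
    by rewrite mul0n.
  by rewrite expn_eq0 muln_eq0 => /andP[/orP[] /eqP]; move: T0 km; rewrite /N; lia.
have Ak : 0 < (2 * #|A|) ^ k by rewrite expn_gt0 muln_gt0 A0.
rewrite -(leq_pmul2l Ak); apply: leq_trans h3.
rewrite mulnCA leq_mul // -expnMn leq_exp2r //.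
by rewrite mulnAC.
Qed.

Lemma sum_pmext2_le Q : 3 < #|T| -> {in Q, forall U : {set {set T}}, #|U| = 2} ->
  (\sum_(U in Q) #|pmext U|) * ((#|T| - 1) * (#|T| - 3)) <= #|Q| * #|pmatch T|.
Proof.
move=> T3 Q2; rewrite big_distrl -sum_nat_const /=; apply: leq_sum => U UQ.
have := card_pmext_le U; rewrite (Q2 U UQ) big_ord_recl big_ord1 /=.
by rewrite subn0 (_ : _ - 1 - _ = #|T| - 3) //; rewrite /bump /=; lia.
Qed.

(** Removing from [A] one element of each pair with equal labels leaves
    elements with distinct labels. *)
Lemma card_imset_defect (S L : finType) (lab : S -> L) (A : {set S}) :
  #|A| <= #|[set lab x | x in A]| +
    #|[set U : {set S} | (U \subset A) && [exists x, exists y,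
        [&& x != y, lab x == lab y & U == [set x; y]]]]|.
Proof.
have [k] := ubnP #|A|; elim: k A => // k IH A; rewrite ltnS => Ak.
have [->|[x xA]] := set_0Vmem A; first by rewrite cards0.
pose bad (B : {set S}) := [set U : {set S} | (U \subset B) && [exists x, exists y,
        [&& x != y, lab x == lab y & U == [set x; y]]]].
rewrite -/(bad A); set B := A :\ x; have cA : #|A| = #|B|.+1 by rewrite (cardsD1 x) xA.
have := IH B; rewrite -cA => /(_ Ak); rewrite -/(bad B) -ltnS -cA => /leq_trans; apply.
have AE : A = x |: B by rewrite setD1K.
have badBA : bad B \subset bad A.
  apply/subsetP => U; rewrite !inE => /andP[UB ->]; rewrite andbT.
  by apply: subset_trans UB _; exact: subsetDl.
rewrite AE imsetU1 -AE; have [|nx] := boolP (lab x \in [set lab y | y in B]).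
  move=> lx; have /imsetP[y yB xy] := lx.
  rewrite (setUidPr _) ?sub1set // -addnS leq_add2l; apply: proper_card.
  rewrite properE badBA; apply/subsetPn; exists [set x; y]; rewrite inE.
    rewrite subUset !sub1set xA (subsetP (subsetDl _ _) _ yB) /=.
    apply/existsP; exists x; apply/existsP; exists y.
    by rewrite -xy !eqxx ?andbT; move: yB; rewrite in_setD1 eq_sym => /andP[].
  by rewrite subUset sub1set !inE eqxx.
by rewrite cardsU1 nx /= add1n addSn ltnS leq_add2l subset_leq_card.
Qed.

End moments.

Local Open Scope ring_scope.

(** * Concentration under random matchings *)

(** Bounds the moment generating function of a small step; when the step has
    mean zero the linear term disappears. *)
Lemma expR_le_quadratic (R : realType) (x : R) : x <= 2^-1 ->
  expR x <= 1 + x + 2 * x ^+ 2.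
Proof.
move=> x2; have x1 : 0 < 1 - x by lra.
apply: (@le_trans _ _ (1 - x)^-1).
  rewrite -[x]opprK expRN opprK lef_pV2 ?posrE ?expR_gt0 //.
  by rewrite expR_ge1Dx.
rewrite -[leLHS]mul1r ler_pdivrMr //; nra.
Qed.

Lemma sum_constR (R : pzRingType) (I : finType) (A : {pred I}) (c : R) :
  \sum_(i in A) c = #|A|%:R * c.
Proof. by rewrite sumr_const mulr_natl. Qed.

Section concentration.
Context (R : realType) (T : finType).
Implicit Types (M U A : {set {set T}}) (F : {set {set T}} -> R).

(** The conditional expectation of [F] given the revealed pairs [U]. *)
Definition pmean F U : R := (\sum_(M in pmext U) F M) / #|pmext U|%:R.

Lemma sum_pmext_card0 F U : #|pmext U| = 0%N -> \sum_(M in pmext U) F M = 0.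
Proof. by move/eqP; rewrite cards_eq0 => /eqP ->; rewrite big_set0. Qed.

Lemma pmean_mul F U : #|pmext U|%:R * pmean F U = \sum_(M in pmext U) F M.
Proof.
have [U0|U0] := eqVneq #|pmext U| 0%N.
  by rewrite U0 mul0r sum_pmext_card0.
by rewrite /pmean mulrC divfK // pnatr_eq0.
Qed.

(** Induction on the number of points outside the revealed pairs. Reveal the
    partner of such a point [h]: by [swapm], the conditional means [m x], given
    the partner [x], differ from one another by at most [c], and since the
    partners are equally likely these means average to the mean before the step.
    By [expR_le_quadratic], the step multiplies the moment generating function by
    at most 1 + 2 (s c)^2. *)
Lemma mgf_pmext F (c s : R) : 0 <= c -> 0 <= s -> s * c <= 2^-1 ->
  (forall M x y, M \in pmatch T -> F M - F (swapm x y M) <= c) ->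
  forall k U, (#|~: cover U| <= k)%N ->
  \sum_(M in pmext U) expR (s * (F M - pmean F U)) <=
  #|pmext U|%:R * expR (2 * (s * c) ^+ 2 * k%:R).
Proof.
move=> c0 s0 sc Fc; have sc0 : 0 <= s * c by exact: mulr_ge0.
have exp_ge1 k : 1 <= expR (2 * (s * c) ^+ 2 * k%:R).
  by rewrite leNgt expR_lt1 -leNgt mulr_ge0 // mulr_ge0 // sqr_ge0.
elim=> [|k IH] U Uk; have [U0|Upos] := posnP #|pmext U|.
- by rewrite U0 mul0r sum_pmext_card0.
- have cU : cover U = setT.
    by apply: setC_inj; apply/eqP; rewrite setCT -cards_eq0 -leqn0.
  have UM M : M \in pmext U -> M = U.
    rewrite inE => /andP[/pmatchP[cM tM M2] UM]; apply/eqP.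
    rewrite eqEsubset UM andbT; apply/subsetP => B BM.
    have /card_gt0P[h hB] : (0 < #|B|)%N by rewrite M2.
    have : h \in cover U by rewrite cU inE.
    move=> /bigcupP[C CU hC].
    by rewrite -(def_pblock tM BM hB) (def_pblock tM (subsetP UM _ CU) hC).
  have mU : pmean F U = F U.
    rewrite /pmean (eq_bigr (fun=> F U)); last by move=> M /UM ->.
    by rewrite sum_constR mulrAC mulfV ?mul1r // pnatr_eq0 -lt0n.
  rewrite (eq_bigr (fun=> 1)); last first.
    by move=> M /UM ->; rewrite mU subrr mulr0 expR0.
  by rewrite sum_constR ler_wpM2l.
- by rewrite U0 mul0r sum_pmext_card0.
have [h hU|cU] := pickP [pred h | h \notin cover U]; last first.
  have cU0 : #|~: cover U| = 0%N by apply: eq_card0 => h; rewrite inE; exact: cU.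
  apply: le_trans (IH U _) _; first by rewrite cU0.
  rewrite ler_wpM2l // ler_expR ler_wpM2l ?ler_nat //.
  by rewrite mulr_ge0 // sqr_ge0.
set X := [pred x | (x \notin cover U) && (h != x)].
pose Ux x := [set h; x] |: U.
have [x0 x0X|X0] := pickP X; last first.
  have := card_free hU; rewrite (eq_card0 X0).
  move: Upos; rewrite -sum1_card (sum_pmext _ hU) big_pred0 //.
pose w := #|pmext (Ux x0)|.
have wE x : X x -> #|pmext (Ux x)| = w.
  move=> /andP[xU hx]; have /andP[x0U hx0] := x0X.
  rewrite /w -!sum1_card (@sum_pmext_swap _ nat _ h x0 x) //.
set r := #|X|.
have cardU : #|pmext U| = (r * w)%N.
  rewrite -sum1_card (sum_pmext _ hU) -sum_nat_const; apply: eq_bigr => x xX.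
  by rewrite sum1_card; exact: wE.
have r0 : 0 < r%:R :> R by rewrite ltr0n; move: Upos; rewrite cardU muln_gt0 => /andP[].
have w0 : 0 < w%:R :> R by rewrite ltr0n; move: Upos; rewrite cardU muln_gt0 => /andP[].
pose m x := pmean F (Ux x); set mu := pmean F U.
have mxE x : X x -> w%:R * m x = \sum_(M in pmext (Ux x)) F M.
  by move=> xX; rewrite -(wE x xX) pmean_mul.
have mle x y : X x -> X y -> m x - m y <= c.
  move=> xX yX; rewrite -(ler_pM2l w0) mulrBr !mxE //.
  have /andP[xU hx] := xX; have /andP[yU hy] := yX.
  rewrite (@sum_pmext_swap _ _ F h x y) // -sumrB -(wE x xX) -sum_constR.
  by apply: ler_sum => M; rewrite inE => /andP[Mpm _]; exact: Fc.
have summ : \sum_(x | X x) (m x - mu) = 0.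
  rewrite sumrB sum_constR; apply/eqP; rewrite subr_eq0; apply/eqP.
  apply: (mulfI (lt0r_neq0 w0)); rewrite mulrA -natrM mulnC -cardU pmean_mul.
  by rewrite mulr_sumr (sum_pmext _ hU); apply: eq_bigr => x; exact: mxE.
have mmu x : X x -> `|m x - mu| <= c.
  move=> xX; have rmx : r%:R * (m x - mu) = \sum_(y | X y) (m x - m y).
    rewrite -[LHS]subr0 -[X in _ - X]summ -sum_constR -sumrB.
    by apply: eq_bigr => y _; lra.
  rewrite -(ler_pM2l r0) -[r%:R in leLHS]gtr0_norm // -normrM rmx.
  apply: le_trans (ler_norm_sum _ _ _) _; rewrite -sum_constR.
  by apply: ler_sum => y yX; rewrite ler_norml lerNl opprB !mle.
rewrite (sum_pmext _ hU).
pose E := expR (2 * (s * c) ^+ 2 * k%:R).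
apply: (@le_trans _ _ (\sum_(x | X x)
    (1 + s * (m x - mu) + 2 * (s * c) ^+ 2) * (w%:R * E))).
  apply: ler_sum => x xX.
  apply: (@le_trans _ _ (expR (s * (m x - mu)) * (w%:R * E))).
    rewrite (eq_bigr (fun M => expR (s * (m x - mu)) * expR (s * (F M - m x)))).
      rewrite -mulr_sumr ler_pM2l ?expR_gt0 // -(wE x xX) IH //.
      rewrite -ltnS (leq_trans _ Uk) //; apply: proper_card.
      rewrite properE; apply/andP; split.
        by rewrite setCS cover_setU1 subsetUr.
      apply/subsetPn; exists h; first by rewrite inE.
      by rewrite cover_setU1 !inE eqxx.
    by move=> M _; rewrite -expRD; congr expR; lra.
  rewrite ler_wpM2r //; first by rewrite mulr_ge0 ?expR_ge0 // ltW.
  have le_sc : `|s * (m x - mu)| <= s * c by rewrite normrM ger0_norm // ler_wpM2l ?mmu.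
  apply: le_trans (expR_le_quadratic _) _.
    by apply: le_trans (ler_norm _) _; exact: le_trans sc.
  rewrite lerD2l ler_wpM2l // -(real_normK (num_real _)).
  by rewrite lerXn2r ?nnegrE.
rewrite -mulr_suml !big_split /= -mulr_sumr summ mulr0 addr0 !sum_constR.
rewrite -/r -mulrDr cardU natrM.
rewrite (_ : _ * (w%:R * E) = (r%:R * w%:R) * ((1 + 2 * (s * c) ^+ 2) * E)); last by ring.
rewrite ler_wpM2l ?mulr_ge0 ?(ltW r0) ?(ltW w0) //.
rewrite -[k.+1%:R]natr1 mulrDr mulr1 expRD [leRHS]mulrC.
by rewrite ler_wpM2r ?expR_ge0 // expR_ge1Dx.
Qed.

(** Azuma-Hoeffding inequality for perfect matchings: revealing the pairs one
    after the other gives a martingale with at most [#|T|] bounded steps. *)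
Lemma pmatch_azuma F (c x : R) : 0 < c -> 0 < x -> x <= 2 * c ->
  (forall M y z, M \in pmatch T -> F M - F (swapm y z M) <= c) ->
  #|[set M in pmatch T | pmean F set0 + x * #|T|%:R <= F M]|%:R <=
  #|pmatch T|%:R * expR (- (x ^+ 2 / (8 * c ^+ 2)) * #|T|%:R).
Proof.
(* [s] minimizes 2 (s c)^2 - s x, the exponent given by Markov's inequality. *)
move=> c0 x0 xc Fc; set N : R := #|T|%:R; set s := x / (4 * c ^+ 2).
have s0 : 0 <= s by rewrite divr_ge0 ?mulr_ge0 ?sqr_ge0 // ltW.
have c00 := lt0r_neq0 c0.
have scE : s * c = x / (4 * c) by rewrite /s; field.
have sc : s * c <= 2^-1 by rewrite scE ler_pdivrMr ?mulr_gt0 //; lra.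
have := @mgf_pmext F c s (ltW c0) s0 sc Fc #|T| set0 (max_card _).
rewrite pmext0 => mgf.
rewrite -(ler_pM2r (expR_gt0 (s * (x * N)))) -[leRHS]mulrA -expRD.
rewrite (_ : - _ * _ + _ = 2 * (s * c) ^+ 2 * N); last first.
  by rewrite /s; field.
apply: le_trans mgf; rewrite -sum1_card natr_sum mulr_suml.
rewrite (eq_bigl (fun M => (M \in pmatch T) &&
    (pmean F set0 + x * N <= F M))); last by move=> M; rewrite inE.
rewrite big_mkcondr /=; apply: ler_sum => M Mpm; case: ifPn => [h|_].
  by rewrite mul1r ler_expR ler_wpM2l // lerBrDl.
exact: expR_ge0.
Qed.

(** With [lab] the identity this counts pairs; with [lab] the end vertices of a
    pair it counts adjacent vertices, parallel edges being counted once. *)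
Definition nlabels (L : finType) (lab : {set T} -> L) A M : R :=
  #|[set lab B | B in M :&: A]|%:R.

Lemma nlabels_swapm (L : finType) (lab : {set T} -> L) A M x y :
  M \in pmatch T -> `|nlabels lab A M - nlabels lab A (swapm x y M)| <= 2.
Proof.
have sub M1 M2 : nlabels lab A M1 <= nlabels lab A M2 + #|M1 :\: M2|%:R.
  rewrite -natrD ler_nat; apply: (@leq_trans
    #|[set lab B | B in M2 :&: A] :|: [set lab B | B in M1 :\: M2]|).
    apply/subset_leq_card/subsetP => _ /imsetP[B /setIP[BM BA] ->].
    rewrite inE; have [BM2|BM2] := boolP (B \in M2).
      by rewrite imset_f // inE BM2.
    by rewrite (imset_f lab (_ : B \in M1 :\: M2)) ?orbT // inE BM2.
  rewrite cardsU; apply: (leq_trans (leq_subr _ _)).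
  by rewrite leq_add2l leq_imset_card.
move=> Mpm; rewrite ler_norml; apply/andP; split.
  rewrite lerNl opprB lerBlDl; apply: le_trans (sub _ M) _.
  rewrite lerD2l (ler_nat _ _ 2%N).
  by rewrite -{2}[M](swapmK x y) card_setD_swapm // swapm_pmatch.
rewrite lerBlDl; apply: le_trans (sub _ (swapm x y M)) _.
by rewrite lerD2l (ler_nat _ _ 2%N) card_setD_swapm.
Qed.

Lemma nlabels_azuma_upper (L : finType) (lab : {set T} -> L) A (x : R) :
  0 < x -> x <= 4 ->
  #|[set M in pmatch T |
      pmean (nlabels lab A) set0 + x * #|T|%:R <= nlabels lab A M]|%:R <=
  #|pmatch T|%:R * expR (- (x ^+ 2 / 32) * #|T|%:R).
Proof.
move=> x0 x4; rewrite (_ : 32 = 8 * 2 ^+ 2); last by ring.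
apply: pmatch_azuma => //; first by lra.
by move=> M y z /(nlabels_swapm lab A y z); rewrite ler_norml => /andP[].
Qed.

Lemma nlabels_azuma_lower (L : finType) (lab : {set T} -> L) A (x : R) :
  0 < x -> x <= 4 ->
  #|[set M in pmatch T |
      nlabels lab A M <= pmean (nlabels lab A) set0 - x * #|T|%:R]|%:R <=
  #|pmatch T|%:R * expR (- (x ^+ 2 / 32) * #|T|%:R).
Proof.
move=> x0 x4; rewrite (_ : 32 = 8 * 2 ^+ 2); last by ring.
rewrite (_ : [set M in _ | _] = [set M in pmatch T |
  pmean (fun M => - nlabels lab A M) set0 + x * #|T|%:R <= - nlabels lab A M]).
  apply: pmatch_azuma => //; first by lra.
  move=> M y z /(nlabels_swapm lab A y z); rewrite distrC.
  by rewrite ler_norml opprK addrC => /andP[].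
apply/setP => M; rewrite !inE /pmean sumrN mulNr; congr (_ && _).
by rewrite [in RHS]lerNr opprD opprK.
Qed.

End concentration.

(** * Independent vertex sampling *)

Section bernoulli.
Context (R : realType) (V : finType).
Implicit Types (S A B : {set V}) (F G : {set V} -> R) (p : R).

(** The expectation over the random set that contains each point independently
    with probability [p]. *)
Definition bern p F : R := \sum_(S : {set V}) p ^+ #|S| * (1 - p) ^+ #|~: S| * F S.

Lemma eq_bern p F G : F =1 G -> bern p F = bern p G.
Proof. by move=> FG; apply: eq_bigr => S _; rewrite FG. Qed.

Lemma bernD p F G : bern p (fun S => F S + G S) = bern p F + bern p G.
Proof. by rewrite -big_split; apply: eq_bigr => S _; rewrite mulrDr. Qed.

Lemma bernZ p c F : bern p (fun S => c * F S) = c * bern p F.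
Proof. by rewrite mulr_sumr; apply: eq_bigr => S _; rewrite mulrCA. Qed.

Lemma bernN p F : bern p (fun S => - F S) = - bern p F.
Proof. by rewrite -sumrN; apply: eq_bigr => S _; rewrite mulrN. Qed.

Lemma bernB p F G : bern p (fun S => F S - G S) = bern p F - bern p G.
Proof. by rewrite bernD bernN. Qed.

Lemma bern_sum p (I : finType) (P : pred I) (F : I -> {set V} -> R) :
  bern p (fun S => \sum_(i | P i) F i S) = \sum_(i | P i) bern p (F i).
Proof.
by rewrite /bern exchange_big; apply: eq_bigr => S _; rewrite mulr_sumr.
Qed.

Lemma sum_setU1 (v : V) F :
  \sum_(S : {set V}) F S = \sum_(S : {set V} | v \notin S) (F S + F (v |: S)).
Proof.
rewrite (bigID (fun S : {set V} => v \in S)) /= addrC big_split /=; congr (_ + _).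
rewrite (reindex_onto (fun S => v |: S) (fun S => S :\ v)) /=.
  apply: eq_bigl => S; rewrite setU11 /=; have [vS|vS] := boolP (v \in S).
    by apply/eqP => e; move: vS; rewrite -e !inE eqxx.
  by rewrite setU1K ?eqxx.
by move=> S vS; rewrite setD1K.
Qed.

(** Conditioning on whether [v] is selected. *)
Lemma bern_split p F (v : V) :
  bern p F = p * bern p (fun S => F (v |: S)) + (1 - p) * bern p (fun S => F (S :\ v)).
Proof.
rewrite -!bernZ -bernD /bern !(sum_setU1 v); apply: eq_bigr => S vS.
have c1 : #|v |: S| = #|S|.+1 by rewrite cardsU1 vS.
have c2 : #|~: S| = #|~: (v |: S)|.+1.
  by rewrite setCU setIC -setDE (cardsD1 v) inE vS.
rewrite setUA setUid setU1K // (_ : S :\ v = S); last first.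
  by apply/setP => w; rewrite !inE; case: eqVneq => //= ->; apply/esym/negbTE.
rewrite c1 c2 !exprS; ring.
Qed.

Lemma bern_cst p c : bern p (fun=> c) = c.
Proof.
rewrite /bern -mulr_suml -[RHS]mul1r; congr (_ * _).
transitivity (\prod_(v : V) (p + (1 - p))); last first.
  by rewrite addrC subrK big1.
rewrite bigA_distr; apply: eq_big => [S|S _]; first by rewrite inE.
rewrite big_if /= !prodr_const; congr (_ * _ ^+ _).
by apply: eq_card => v; rewrite !inE.
Qed.

Lemma ler_bern p F G : 0 <= p -> p <= 1 -> (forall S, F S <= G S) ->
  bern p F <= bern p G.
Proof.
move=> p0 p1 FG; apply: ler_sum => S _; rewrite ler_wpM2l //.
by rewrite mulr_ge0 ?exprn_ge0 // subr_ge0.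
Qed.

Lemma ler_norm_bern p F : 0 <= p -> p <= 1 -> `|bern p F| <= bern p (fun S => `|F S|).
Proof.
move=> p0 p1; apply: le_trans (ler_norm_sum _ _ _) _; apply: ler_sum => S _.
by rewrite normrM ger0_norm // mulr_ge0 ?exprn_ge0 // subr_ge0.
Qed.

Lemma bern_mem p v F :
  bern p (fun S => (v \in S)%:R * F (S :\ v)) = p * bern p (fun S => F (S :\ v)).
Proof.
rewrite (bern_split _ _ v); rewrite [X in _ + _ * X](_ : _ = 0) ?mulr0 ?addr0.
  congr (_ * _); apply: eq_bern => S; rewrite setU11 mul1r; congr F.
  by apply/setP => w; rewrite !inE; case: eqVneq.
rewrite -[RHS](bern_cst p 0); apply: eq_bern => S.
by rewrite setD11 mul0r.
Qed.

Lemma bern_in p v : bern p (fun S => (v \in S)%:R) = p.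
Proof.
have := bern_mem p v (fun=> 1); rewrite bern_cst mulr1 => H; rewrite -[RHS]H.
by apply: eq_bern => S; rewrite mulr1.
Qed.

Lemma bern_mem2 p u v F : u != v ->
  bern p (fun S => (u \in S)%:R * (v \in S)%:R * F (S :\ u :\ v)) =
  p ^+ 2 * bern p (fun S => F (S :\ u :\ v)).
Proof.
move=> uv; have DC (S : {set V}) : S :\ u :\ v = S :\ v :\ u.
  by apply/setP => w; rewrite !inE andbCA.
have vD (S : {set V}) : (v \in S :\ u) = (v \in S).
  by rewrite in_setD1 eq_sym uv.
rewrite expr2 -mulrA (@eq_bern _ _
  (fun S => (u \in S)%:R * ((v \in S :\ u)%:R * F (S :\ u :\ v)))); last first.
  by move=> S; rewrite vD mulrA.
rewrite (bern_mem p u (fun S => (v \in S)%:R * F (S :\ v))); congr (_ * _).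
rewrite (@eq_bern _ _ (fun S => (v \in S)%:R * F (S :\ v :\ u))).
  rewrite (bern_mem p v (fun S => F (S :\ u))); congr (_ * _).
  by apply: eq_bern => S; rewrite DC.
by move=> S; rewrite vD DC.
Qed.

Lemma bern_mem3 p u v w : u != v -> u != w -> v != w ->
  bern p (fun S => (u \in S)%:R * (v \in S)%:R * (w \in S)%:R) = p ^+ 3.
Proof.
move=> uv uw vw; have := bern_mem2 p (fun S => (w \in S)%:R) uv.
rewrite (_ : bern p (fun S => (w \in S :\ u :\ v)%:R) = p).
  move=> H; rewrite exprSr -H; apply: eq_bern => S.
  by rewrite !inE (eq_sym w v) vw (eq_sym w u) uw.
rewrite -[RHS](bern_in p w); apply: eq_bern => S.
by rewrite !inE (eq_sym w v) vw (eq_sym w u) uw.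
Qed.

Lemma bern_disjoint p A :
  bern p (fun S => [disjoint A & S]%:R) = (1 - p) ^+ #|A|.
Proof.
have [k] := ubnP #|A|; elim: k A => // k IH A; rewrite ltnS => Ak.
have [->|[x xA]] := set_0Vmem A.
  rewrite cards0 expr0 -[RHS](bern_cst p 1); apply: eq_bern => S.
  by rewrite -setI_eq0 set0I eqxx.
rewrite (bern_split _ _ x) [X in p * X](_ : _ = 0) ?mulr0 ?add0r; last first.
  rewrite -[RHS](bern_cst p 0); apply: eq_bern => S.
  by rewrite -setI_eq0; case: eqP => // /setP/(_ x); rewrite !inE xA eqxx.
have cA : #|A| = #|A :\ x|.+1 by rewrite (cardsD1 x) xA.
rewrite cA exprS -IH; last by rewrite -cA.
congr (_ * _); apply: eq_bern => S.
by rewrite -!setI_eq0 setIDA setIDAC.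
Qed.

End bernoulli.

(** * Poisson approximation by the Stein-Chen method *)

Section stein.
Context (R : realType) (n : nat).
Local Notation V := 'I_n.
Implicit Types (S : {set V}) (e f : V * V) (E : {set V * V}).

Definition inS S e : bool := (e.1 \in S) && (e.2 \in S).
Definition touching e f : bool :=
  [|| e.1 == f.1, e.1 == f.2, e.2 == f.1 | e.2 == f.2].
Definition nb_in E S : nat := \sum_(e in E) inS S e.
Definition cherries E : {set (V * V) * (V * V)} :=
  [set ef | [&& ef.1 \in E, ef.2 \in E, ef.1 != ef.2 & touching ef.1 ef.2]].

(** Two distinct edges that touch have at least three vertices in all. *)
Lemma bern_cherry (p : R) E e f : 0 <= p -> p <= 1 ->
  {in E, forall e, (e.1 < e.2)%N} -> (e, f) \in cherries E ->
  bern p (fun S => (inS S e)%:R * (inS S f)%:R) <= p ^+ 3.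
Proof.
move=> p0 p1 Elt; rewrite inE /= => /and4P[eE fE nef mef].
have le := Elt _ eE; have lf := Elt _ fE.
have e12 : e.1 != e.2 by rewrite neq_ltn le.
have [w [w1 w2 wf]] : exists w, [/\ e.1 != w, e.2 != w & (w == f.1) || (w == f.2)].
  have [h|] := boolP ((e.1 != f.1) && (e.2 != f.1)).
    by case/andP: h => *; exists f.1; rewrite eqxx.
  rewrite negb_and !negbK => h1.
  have [h|] := boolP ((e.1 != f.2) && (e.2 != f.2)).
    by case/andP: h => *; exists f.2; rewrite eqxx orbT.
  rewrite negb_and !negbK => h2; exfalso; move: h1 h2 nef le lf.
  case: e {eE e12 mef} => a b; case: f {fE} => c d /=.
  move=> /orP[]/eqP <- /orP[]/eqP <-; rewrite ?ltnn ?eqxx //.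
  by move=> _ h /(ltn_trans h); rewrite ltnn.
rewrite -(bern_mem3 p e12 w1 w2); apply: ler_bern => // S.
rewrite -!natrM ler_nat !mulnb; have [|//] := boolP (inS S e && inS S f).
move=> /andP[/andP[-> ->]]; rewrite /inS.
by case/orP: wf => /eqP -> /andP[a b]; rewrite ?a ?b.
Qed.

(** Let [W] count the selected edges and [We e] those that do not touch [e]. The
    selection of [e] is independent of [We e], so with [We e] in place of [W] the
    two terms cancel in expectation. The error comes from the selections of an
    edge touching [e]: such an edge, possibly [e] itself, costs p^2 in the first
    term, whose coefficient is p^2, and [e] together with another edge costs p^3
    in the second. *)
Lemma stein_chen (p c : R) (g : nat -> R) E : 0 <= p -> p <= 1 ->
  {in E, forall e, (e.1 < e.2)%N} -> (forall k, `|g k| <= c) ->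
  `|bern p (fun S => p ^+ 2 * #|E|%:R * g (nb_in E S).+1
              - (nb_in E S)%:R * g (nb_in E S))| <=
  2 * c * (p ^+ 3 * #|cherries E|%:R + p ^+ 4 * (#|cherries E| + #|E|)%:R).
Proof.
move=> p0 p1 Elt gc.
have c0 : 0 <= c := le_trans (normr_ge0 _) (gc 0%N).
pose W := nb_in E; pose I e S : R := (inS S e)%:R.
pose We e S : nat := (\sum_(f in E | ~~ touching e f) inS S f)%N.
have WE S : (W S)%:R = \sum_(e in E) I e S by rewrite /W /nb_in natr_sum.
have gdiff a b : `|g a - g b| <= 2 * c * (a != b)%:R.
  have [->|_] := eqVneq a b; first by rewrite subrr normr0 mulr0.
  by rewrite mulr1 mulr_natl mulr2n; apply: le_trans (ler_normB _ _) _; exact: lerD.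
have Wsplit e S : W S = (\sum_(f in E | touching e f) inS S f + We e S)%N.
  by rewrite /W /nb_in (bigID (touching e)).
have indep e : e \in E ->
   bern p (fun S => I e S * g (We e S).+1) = p ^+ 2 * bern p (fun S => g (We e S).+1).
  move=> eE; have e12 : e.1 != e.2 by rewrite neq_ltn Elt.
  have WeD S : We e (S :\ e.1 :\ e.2) = We e S.
    apply: eq_bigr => f /andP[_]; rewrite /touching !negb_or => /and4P[n1 n2 n3 n4].
    by rewrite /inS !inE !(eq_sym f.1) !(eq_sym f.2) n1 n2 n3 n4.
  have := bern_mem2 p (fun S => g (We e S).+1) e12.
  rewrite (@eq_bern _ _ _ (fun S => g (We e (S :\ e.1 :\ e.2)).+1)
     (fun S => g (We e S).+1)); last by move=> S; rewrite WeD.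
  move=> <-; apply: eq_bern => S; rewrite WeD /I /inS -natrM mulnb //.
(* Adding the terms that vanish by [indep] turns [W] into [We e]. *)
have rew : bern p (fun S => p ^+ 2 * #|E|%:R * g (W S).+1 - (W S)%:R * g (W S)) =
  \sum_(e in E) bern p (fun S => p ^+ 2 * (g (W S).+1 - g (We e S).+1)
      + I e S * (g (We e S).+1 - g (W S))).
  rewrite -bern_sum.
  transitivity (bern p (fun S => p ^+ 2 * #|E|%:R * g (W S).+1 - (W S)%:R * g (W S))
    + \sum_(e in E) bern p (fun S => I e S * g (We e S).+1 - p ^+ 2 * g (We e S).+1)).
    rewrite big1 ?addr0 // => e eE.
    by rewrite bernB indep // bernZ subrr.
  rewrite -bern_sum -bernD; apply: eq_bern => S.
  rewrite WE mulr_suml -mulrA [#|E|%:R * _]mulr_natl -sumr_const mulr_sumr.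
  by rewrite -sumrB -big_split /=; apply: eq_bigr => e _; ring.
rewrite rew; apply: le_trans (ler_norm_sum _ _ _) _.
have bnd1 e S : e \in E ->
   `|g (W S).+1 - g (We e S).+1| <= 2 * c * \sum_(f in E | touching e f) I f S.
  move=> eE; apply: le_trans (gdiff _ _) _; rewrite ler_wpM2l ?mulr_ge0 //.
  rewrite -natr_sum ler_nat (Wsplit e).
  by case: (\sum_(f in E | touching e f) inS S f)%N => [|k]; [rewrite eqxx|case: eqP].
have bnd2 e S : e \in E ->
   `|I e S * (g (We e S).+1 - g (W S))| <=
   2 * c * \sum_(f in E | touching e f && (e != f)) I e S * I f S.
  move=> eE; rewrite /I; case eS : (inS S e); last first.
    rewrite !mul0r normr0 mulr_ge0 ?mulr_ge0 // sumr_ge0 // => f _.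
    by rewrite mul0r.
  rewrite mul1r; apply: le_trans (gdiff _ _) _; rewrite ler_wpM2l ?mulr_ge0 //.
  under eq_bigr do rewrite mul1r; rewrite -natr_sum ler_nat (Wsplit e).
  rewrite (bigD1 e) /=; last by rewrite eE /touching eqxx.
  rewrite eS /= -addnA add1n eqSS.
  rewrite (eq_bigl (fun f => (f \in E) && (touching e f && (e != f)))); last first.
    by move=> f; rewrite andbA eq_sym.
  by case: (\sum_(f in E | _ && _) inS S f)%N => [|k]; [rewrite eqxx|case: eqP].
apply: (@le_trans _ _ (\sum_(e in E) (p ^+ 2 * (2 * c * \sum_(f in E | touching e f) p ^+ 2)
     + 2 * c * \sum_(f in E | touching e f && (e != f)) p ^+ 3))).
  apply: ler_sum => e eE; rewrite bernD; apply: le_trans (ler_normD _ _) _.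
  have p20 : 0 <= p ^+ 2 by exact: sqr_ge0.
  apply: lerD.
    rewrite bernZ normrM ger0_norm // ler_wpM2l //.
    apply: le_trans (ler_norm_bern _ p0 p1) _.
    apply: le_trans (ler_bern p0 p1 (fun S => bnd1 e S eE)) _.
    rewrite bernZ ler_wpM2l ?mulr_ge0 // bern_sum; apply: ler_sum => f /andP[fE _].
    have f12 : f.1 != f.2 by rewrite neq_ltn Elt.
    rewrite -[leRHS]mulr1 -(@bern_cst R V p 1) -(bern_mem2 p (fun=> 1) f12).
    by rewrite le_eqVlt (@eq_bern _ _ _ (fun S => I f S) (fun S => (f.1 \in S)%:R * (f.2 \in S)%:R * 1)) ?eqxx // => S; rewrite mulr1 /I /inS -mulnb natrM.
  apply: le_trans (ler_norm_bern _ p0 p1) _.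
  apply: le_trans (ler_bern p0 p1 (fun S => bnd2 e S eE)) _.
  rewrite bernZ ler_wpM2l ?mulr_ge0 // bern_sum; apply: ler_sum => f /and3P[fE mef nef].
  by apply: (bern_cherry p0 p1 Elt); rewrite inE eE fE nef mef.
have cc : \sum_(e in E) \sum_(f in E | touching e f && (e != f)) p ^+ 3 = p ^+ 3 * #|cherries E|%:R.
  rewrite pair_big_dep /= mulr_natr -sumr_const; apply: eq_bigl => ef.
  by rewrite inE [touching _ _ && _]andbC.
have cm : \sum_(e in E) \sum_(f in E | touching e f) p ^+ 2 =
    p ^+ 2 * (#|cherries E| + #|E|)%:R.
  rewrite natrD mulrDr !mulr_natr -!sumr_const.
  rewrite (eq_bigr (fun e => \sum_(f in E | touching e f && (e != f)) p ^+ 2 + p ^+ 2)).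
    rewrite big_split /= pair_big_dep /=; congr (_ + _); apply: eq_bigl => ef.
    by rewrite inE [touching _ _ && _]andbC.
  move=> e eE; rewrite (bigD1 e) /=; last by rewrite eE /touching eqxx.
  rewrite addrC; congr (_ + _); apply: eq_bigl => f; by rewrite andbA [e == f]eq_sym.
rewrite big_split /= -!mulr_sumr cc cm.
rewrite le_eqVlt; apply/orP; left; apply/eqP; ring.
Qed.

End stein.

(** * Statistics of a multigraph *)

Section statistics.
Context (n : nat) (G : mgraph n) (V : {set 'I_n}).

Definition simple_edges : {set 'I_n * 'I_n} :=
  [set e : 'I_n * 'I_n | [&& (e.1 < e.2)%N, e.1 \in V, e.2 \in V & (0 < G e.1 e.2)%N]]%SET.

Definition loopy : {set 'I_n} := [set v : 'I_n | (0 < G v v)%N]%SET.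

Definition bad_vertices : {set 'I_n} := (~: V :|: loopy)%SET.

Definition double_edges : {set 'I_n * 'I_n} :=
  [set e in simple_edges | (1 < G e.1 e.2)%N]%SET.

Lemma simple_edges_lt : {in simple_edges, forall e : 'I_n * 'I_n, (e.1 < e.2)%N}.
Proof. by move=> e; rewrite inE => /and4P[]. Qed.

End statistics.

Local Open Scope nat_scope.

(** * Edge counts in the configuration model *)

Section cm_counts.
Variables (n : nat) (d : nat -> nat).
Local Notation H := (half_edge n d).
Implicit Types (M : {set {set H}}) (B C : {set H}) (V : {set 'I_n}).

Definition ends B : {set 'I_n} := [set tag h | h in B].

Definition loop_pairs V : {set {set H}} :=
  [set B : {set H} | (#|B| == 2) && [exists i in V, ends B == [set i]]].

Definition edge_pairs V : {set {set H}} :=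
  [set B : {set H} | [&& #|B| == 2, ends B \subset V & #|ends B| == 2]].

Definition half_edges_at V : {set H} := [set h : H | tag h \in V].

Lemma card_half_edges_at V : #|half_edges_at V| = \sum_(i in V) d i.
Proof.
rewrite -sum1_card (partition_big (fun h : H => tag h) (mem V)) /=; last first.
  by move=> h; rewrite inE.
apply: eq_bigr => i iV; pose f (x : 'I_(d i)) : H := Tagged (fun i : 'I_n => 'I_(d i)) x.
have f_inj : injective f by move=> x y /eqP; rewrite eq_Tagged => /eqP.
rewrite sum1_card -[RHS](card_ord (d i)) -(card_imset _ f_inj).
apply: eq_card => h; rewrite unfold_in; apply/andP/imsetP.
  case: h => j x /= [_ /eqP e]; move: x; rewrite e => x; by exists x.
by move=> [x _ ->]; rewrite inE /= eqxx.
Qed.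

Lemma card_half_edge : #|{: H}| = ell n d.
Proof.
rewrite /ell -cardsT (_ : [set: H] = half_edges_at setT).
  by rewrite card_half_edges_at; apply: eq_bigl => i; rewrite inE.
by apply/setP => h; rewrite !inE.
Qed.

Lemma cm_graphE M i j : cm_graph M i j = #|[set B in M | ends B == [set i; j]]|.
Proof. by rewrite mxE. Qed.

Lemma loop_pairs2 V B : B \in loop_pairs V -> #|B| = 2.
Proof. by rewrite inE => /andP[/eqP]. Qed.

Lemma edge_pairs2 V B : B \in edge_pairs V -> #|B| = 2.
Proof. by rewrite inE => /and3P[/eqP]. Qed.

Lemma ends_neq0 B : #|B| = 2 -> ends B != set0.
Proof. by rewrite imset_eq0 -cards_eq0 => ->. Qed.

Lemma card_ends B : #|B| = 2 -> (#|ends B| == 1) || (#|ends B| == 2).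
Proof.
move=> B2; have := leq_imset_card (fun h : H => tag h) B; rewrite -/(ends B).
have := ends_neq0 B2; rewrite -cards_eq0 B2.
by case: #|ends B| => [|[|[|]]].
Qed.

Lemma card_loopy M V : M \in perfect_matchings n d ->
  #|V :&: loopy (cm_graph M)| <= #|M :&: loop_pairs V|.
Proof.
move=> /pmatchP[_ _ M2]; pose v B := [pick i | ends B == [set i]].
rewrite -(card_imset _ (@Some_inj _)).
apply: (@leq_trans #|[set v B | B in M :&: loop_pairs V]|); last exact: leq_imset_card.
apply/subset_leq_card/subsetP => _ /imsetP[i /setIP[iV +] ->].
rewrite inE cm_graphE setUid => /card_gt0P[B]; rewrite inE => /andP[BM Bi].
apply/imsetP; exists B.
  rewrite !inE BM M2 //=; apply/exists_inP; by exists i.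
rewrite /v; case: pickP => [j|/(_ i)]; last by rewrite Bi.
by rewrite (eqP Bi) => /eqP/set1_inj ->.
Qed.

Lemma sum_cm_graph M V : M \in perfect_matchings n d ->
  \sum_(e : 'I_n * 'I_n | [&& e.1 < e.2, e.1 \in V & e.2 \in V]) cm_graph M e.1 e.2 =
  #|M :&: edge_pairs V|.
Proof.
move=> /pmatchP[_ _ M2].
under eq_bigr do rewrite cm_graphE -sum1_card.
rewrite (exchange_big_dep (mem M)) /=; last by move=> e B _; rewrite inE => /andP[].
rewrite -sum1_card [RHS](eq_bigl (fun B => (B \in M) && (B \in edge_pairs V))); last first.
  by move=> B; rewrite in_setI.
rewrite [RHS]big_mkcondr /=; apply: eq_bigr => B BM.
have B2 := M2 _ BM.
have [|Bn] := boolP (B \in edge_pairs V).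
  rewrite inE B2 eqxx /= => /andP[BV /cards2P[i [j [ij eB]]]].
  have [x [y [lt eB']]] : exists x y : 'I_n, x < y /\ ends B = [set x; y].
    move: ij; rewrite neq_ltn => /orP[] lt; first by exists i, j.
    by exists j, i; rewrite setUC.
  rewrite (big_pred1 (x, y)) // => -[a b] /=; rewrite !inE BM /= eB'.
  apply/andP/eqP => [[/and3P[ab _ _] /eqP e]|[-> ->]]; last first.
    have := BV; rewrite eB' subUset !sub1set => /andP[-> ->].
    by rewrite lt eqxx.
  have : x \in [set a; b] by rewrite -e !inE eqxx.
  have : y \in [set a; b] by rewrite -e !inE eqxx orbT.
  rewrite !inE => /orP[]/eqP ye /orP[]/eqP xe; subst => //.
  - by rewrite ltnn in lt.
  - by have := ltn_trans lt ab; rewrite ltnn.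
  - by rewrite ltnn in lt.
rewrite big_pred0 // => -[a b] /=; apply/negP => /andP[/and3P[ab aV bV]].
rewrite inE BM => /= /eqP eB; move/negP: Bn; apply.
rewrite inE B2 eqxx eB /= subUset !sub1set aV bV cards2 /=.
by rewrite neq_ltn ab.
Qed.

Lemma card_simple_double M V : M \in perfect_matchings n d ->
  #|simple_edges (cm_graph M) V| + #|double_edges (cm_graph M) V| <=
  #|M :&: edge_pairs V|.
Proof.
move=> Mpm; rewrite -(sum_cm_graph _ Mpm).
have -> : #|double_edges (cm_graph M) V| =
    \sum_(e in simple_edges (cm_graph M) V) (1 < cm_graph M e.1 e.2).
  by rewrite -big_mkcondr /= sum1_card; apply: eq_card => e; rewrite [LHS]inE.
rewrite -sum1_card -big_split /=.
rewrite [X in _ <= X](bigID (fun e : 'I_n * 'I_n => 0 < cm_graph M e.1 e.2)) /=.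
rewrite (leq_trans _ (leq_addr _ _)) //.
rewrite [X in _ <= X](eq_bigl (mem (simple_edges (cm_graph M) V))); last first.
  by move=> e; rewrite /= [RHS]inE -!andbA.
apply: leq_sum => e; rewrite inE => /and4P[_ _ _].
by case: (cm_graph M _ _) => [|[|]].
Qed.

Lemma card_simple_edges M V : M \in perfect_matchings n d ->
  #|simple_edges (cm_graph M) V| = #|[set ends B | B in M :&: edge_pairs V]|.
Proof.
move=> /pmatchP[_ _ M2].
rewrite -(@card_in_imset _ _ (fun e : 'I_n * 'I_n => [set e.1; e.2])).
  apply: eq_card => U; apply/imsetP/imsetP => [[e]|[B /setIP[BM]]].
    rewrite inE cm_graphE => /and4P[lt e1 e2 /card_gt0P[B]]; rewrite inE => /andP[BM /eqP eB] ->.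
    exists B => //; rewrite !inE BM M2 // eB eqxx /= subUset !sub1set e1 e2 cards2.
    by rewrite neq_ltn lt.
  rewrite inE => /and3P[_ BV /cards2P[i [j [ij eB]]]] ->.
  move: BV; rewrite eB subUset !sub1set => /andP[iV jV].
  move: ij; rewrite neq_ltn => /orP[] lt; [exists (i, j) => //|exists (j, i); rewrite /= 1?setUC //];
    rewrite inE /= lt iV jV cm_graphE; apply/card_gt0P; exists B; rewrite inE BM eB /= //.
  by rewrite setUC.
move=> [a b] [a' b']; rewrite !inE /= => /and4P[ab _ _ _] /and4P[ab' _ _ _] e.
have : a \in [set a'; b'] by rewrite -e !inE eqxx.
have : b \in [set a'; b'] by rewrite -e !inE eqxx orbT.
rewrite !inE => /orP[]/eqP be /orP[]/eqP ae; subst => //.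
- by rewrite ltnn in ab.
- by have := ltn_trans ab ab'; rewrite ltnn.
- by rewrite ltnn in ab.
Qed.

Lemma nb_edges_cm M : M \in perfect_matchings n d ->
  2 * nb_edges (cm_graph M) + 2 * #|M :&: loop_pairs setT| = ell n d.
Proof.
move=> Mpm; have [_ _ M2] := pmatchP _ Mpm.
have -> : nb_edges (cm_graph M) = #|M :&: edge_pairs setT|.
  rewrite -(sum_cm_graph _ Mpm) /nb_edges pair_big_dep /=.
  by apply: eq_bigl => e; rewrite !inE !andbT.
rewrite -mulnDr -card_half_edge (card_pmatch Mpm) mulnC; congr (_ * _).
rewrite -cardsUI (_ : #|_ :&: (M :&: _)| = 0) ?addn0.
  apply: eq_card => B; rewrite inE !(finset.in_setI, inE).
  case BM : (B \in M) => //=; rewrite M2 //= subsetT /=.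
  have := card_ends (M2 _ BM); rewrite orbC => /orP[->//|/cards1P[i ->]].
  rewrite (_ : [exists i0, _]) ?orbT //; apply/existsP; exists i.
  by rewrite inE eqxx.
apply: eq_card0 => B; rewrite !inE; apply/negP.
move=> /andP[/andP[_ /and3P[_ _ eB]] /andP[_ /andP[_ /existsP[i]]]].
by rewrite inE => /eqP ei; move: eB; rewrite ei cards1.
Qed.

Lemma simple_degree_cm M v : M \in perfect_matchings n d ->
  #|[set w | (w != v) && (0 < cm_graph M v w)]| <= d v.
Proof.
move=> Mpm; have [cM tM M2] := pmatchP _ Mpm.
pose other (B : {set H}) := [pick w | (w != v) && (w \in ends B)].
rewrite -(card_imset _ (@Some_inj _)).
have -> : d v = #|half_edges_at [set v]| by rewrite card_half_edges_at big_set1.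
apply: (@leq_trans #|[set other (pblock M h) | h in half_edges_at [set v]]|);
  last exact: leq_imset_card.
apply/subset_leq_card/subsetP => _ /imsetP[w + ->].
rewrite inE cm_graphE => /andP[wv /card_gt0P[B]]; rewrite inE => /andP[BM /eqP eB].
have : v \in ends B by rewrite eB !inE eqxx.
move=> /imsetP[h hB vh]; apply/imsetP; exists h; first by rewrite !inE vh.
rewrite (def_pblock tM BM hB) /other eB; case: pickP => [x|/(_ w)].
  by rewrite !inE => /andP[/negPf ->] /= /eqP ->.
by rewrite !inE wv eqxx orbT.
Qed.

Lemma card_loop_pairs V : #|loop_pairs V| <= \sum_(i in V) 'C(d i, 2).
Proof.
apply: (@leq_trans #|\bigcup_(i in V) [set B : {set H} |
    (B \subset half_edges_at [set i]) && (#|B| == 2)]|).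
  apply/subset_leq_card/subsetP => B; rewrite inE => /andP[B2 /exists_inP[i iV /eqP eB]].
  apply/bigcupP; exists i => //; rewrite inE B2 andbT; apply/subsetP => h hB.
  by rewrite inE -eB imset_f.
elim/big_rec2: _ => [|i s U _ IH]; first by rewrite cards0.
apply: leq_trans (leq_card_setU _ _) _; rewrite leq_add //.
by rewrite cards_draws card_half_edges_at big_set1.
Qed.

Lemma card_pairs_at V :
  #|edge_pairs V| + #|loop_pairs V| = 'C(\sum_(i in V) d i, 2).
Proof.
rewrite -card_half_edges_at -cards_draws -cardsUI.
rewrite (_ : #|edge_pairs V :&: _| = 0) ?addn0.
  apply: eq_card => B; rewrite !inE.
  have [B2|_] := eqVneq #|B| 2; rewrite ?andbF //= andbT.
  have -> : (B \subset half_edges_at V) = (ends B \subset V).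
    apply/subsetP/subsetP => [BV _ /imsetP[h hB ->]|eV h hB].
      by have := BV h hB; rewrite inE.
    by rewrite inE eV // imset_f.
  have := card_ends B2; have [->|_] /= := eqVneq #|ends B| 2.
    rewrite andbT => _; apply/orP/idP => [[//|/exists_inP[i iV /eqP ->]]|->].
      by rewrite sub1set.
    by left.
  rewrite orbF andbF /= => /cards1P[i ->]; rewrite sub1set.
  apply/exists_inP/idP => [[j jV /eqP/set1_inj ->//]|iV]; by exists i.
apply: eq_card0 => B; rewrite !inE; apply/negP => /andP[/and3P[_ _ eB] /andP[_]].
by move=> /exists_inP[i _ /eqP ei]; move: eB; rewrite ei cards1.
Qed.

Lemma card_same_ends V D B : {in V &, forall i j : 'I_n, d i * d j <= D} ->
  B \in edge_pairs V -> #|[set C in edge_pairs V | ends C == ends B]| <= D.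
Proof.
move=> dD; rewrite inE => /and3P[_ BV /cards2P[i [j [ij eB]]]].
have [iV jV] : i \in V /\ j \in V.
  by move: BV; rewrite eB subUset !sub1set => /andP[].
apply: leq_trans (dD i j iV jV); pose X i0 := half_edges_at [set i0].
have cX i0 : #|X i0| = d i0 by rewrite card_half_edges_at big_set1.
rewrite -[d i]cX -[d j]cX -cardsX.
apply: (@leq_trans #|[set [set p.1; p.2] | p in setX (X i) (X j)]|); last exact: leq_imset_card.
apply/subset_leq_card/subsetP => C; rewrite !inE => /andP[/and3P[/cards2P[x [y [xy ->]]] _ _]].
have -> : ends [set x; y] = [set tag x; tag y] by rewrite /ends imsetU !imset_set1.
rewrite eB => /eqP e.
have : tag x \in [set i; j] by rewrite -e !inE eqxx.
have : tag y \in [set i; j] by rewrite -e !inE eqxx orbT.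
have : i \in [set tag x; tag y] by rewrite e !inE eqxx.
have : j \in [set tag x; tag y] by rewrite e !inE eqxx orbT.
rewrite !inE => jxy ixy /orP[]/eqP ye /orP[]/eqP xe.
- by move: jxy; rewrite xe ye orbb eq_sym (negPf ij).
- by apply/imsetP; exists (y, x); rewrite ?inE /= ?xe ?ye ?eqxx // setUC.
- by apply/imsetP; exists (x, y); rewrite ?inE /= ?xe ?ye ?eqxx.
- by move: ixy; rewrite xe ye orbb (negPf ij).
Qed.

End cm_counts.

Local Open Scope ring_scope.

(** * Typical configuration-model graphs *)

Lemma bin2_double m : ('C(m, 2) * 2 = m * m.-1)%N.
Proof. by have := bin_ffact m 2; rewrite ffactnS ffactn1. Qed.

Section typical.
Context {R : realType} (n : nat) (d : nat -> nat).
Local Notation H := (half_edge n d).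
Local Notation pm := (perfect_matchings n d).
Local Notation N := ((ell n d)%:R : R).
Implicit Types (eps : R) (M : {set {set H}}) (V : {set 'I_n}).

Definition small_vertices eps : {set 'I_n} :=
  [set i : 'I_n | (d i)%:R <= eps * Num.sqrt N].

Definition degsum V : nat := \sum_(i in V) d i.

Lemma degsum_le V : (degsum V <= ell n d)%N.
Proof. by rewrite /degsum /ell big_mkcond; apply: leq_sum => i _; case: ifP. Qed.

Lemma pmeanE F : pm != set0 ->
  (pmean F set0 : R) * #|pm|%:R = \sum_(M in pm) F M.
Proof.
by move=> pm0; have := pmean_mul F (set0 : {set {set H}}); rewrite pmext0 mulrC.
Qed.

Lemma nlabels_id (A M : {set {set H}}) : nlabels R id A M = #|M :&: A|%:R :> R.
Proof. by rewrite /nlabels imset_id. Qed.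

Lemma pmean_pairs (A : {set {set H}}) : pm != set0 -> (1 < ell n d)%N ->
  {in A, forall B : {set H}, #|B| = 2%N} ->
  (pmean (nlabels R id A) set0 : R) * (N - 1) = #|A|%:R.
Proof.
move=> pm0 N1 A2; have pm1 : #|pm|%:R != 0 :> R by rewrite pnatr_eq0 cards_eq0.
apply: (mulIf pm1); rewrite mulrAC pmeanE //.
rewrite (eq_bigr (fun M => #|M :&: A|%:R)); last by move=> M _; rewrite nlabels_id.
rewrite -natr_sum -(natrB _ (ltnW N1)) -!natrM; congr (_%:R).
by have := mean_pairs A2; rewrite card_half_edge.
Qed.

Lemma loop_pairs_le V D : {in V, forall i : 'I_n, (d i <= D)%N} ->
  (2 * #|loop_pairs d V| <= D * degsum V)%N.
Proof.
move=> dD; apply: (leq_trans (leq_mul (leqnn 2) (card_loop_pairs d V))).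
rewrite !big_distrr /=; apply: leq_sum => i iV.
rewrite mulnC bin2_double mulnC leq_mul //.
by apply: leq_trans (dD i iV); exact: leq_pred.
Qed.

(** N - 2 e(G) is twice the number of loops, whose mean is about half of the
    maximal degree at most. *)
Lemma many_loops_tail eps D : 0 < eps -> eps <= 1 -> (1 < ell n d)%N ->
  (forall i : 'I_n, (d i <= D)%N) -> 4 * D%:R <= eps * N ->
  #|[set M in pm | eps * N < N - 2 * (nb_edges (cm_graph M))%:R]|%:R <=
  #|pm|%:R * expR (- ((eps / 4) ^+ 2 / 32) * N).
Proof.
move=> e0 e1 N1 dD De; have [pm0|pm0] := eqVneq pm set0.
  by rewrite pm0 cards0 mul0r lern0 cards_eq0; apply/eqP/setP => M; rewrite !inE.
have N1' : 1 < N by rewrite ltr1n.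
have x0 : 0 < eps / 4 by rewrite divr_gt0.
have x4 : eps / 4 <= 4 by lra.
have := nlabels_azuma_upper (fun B => B) (@loop_pairs n d setT) x0 x4.
rewrite card_half_edge; apply: le_trans; rewrite ler_nat; apply/subset_leq_card/subsetP => M.
rewrite inE => /andP[Mpm h]; rewrite inE Mpm /= nlabels_id.
have := pmean_pairs pm0 N1 (@loop_pairs2 n d setT).
have := nb_edges_cm Mpm; move/(congr1 (fun k => k%:R : R)).
rewrite natrD !natrM => nbE.
have : (2 * #|loop_pairs d [set: 'I_n]| <= D * ell n d)%N.
  apply: (leq_trans (@loop_pairs_le setT D _)); first by move=> i _; exact: dD.
  by rewrite leq_mul // degsum_le.
rewrite -(ler_nat R) !natrM => lp mE.
set m := pmean _ _ in mE *; set l := #|loop_pairs d [set: 'I_n]|%:R in lp mE.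
have m_le : m <= eps / 4 * N.
  rewrite -(ler_pM2r (_ : 0 < N - 1)); last by rewrite subr_gt0.
  have N2 : 2 <= N by rewrite (ler_nat _ 2).
  have h1 : 4 * D%:R * N <= eps * N * N by rewrite ler_wpM2r.
  have h2 : 0 <= eps * N * (N - 2) by rewrite !mulr_ge0 ?subr_ge0 // ltW.
  rewrite mE; lra.
lra.
Qed.

(** With S half-edges at [V] there are at most S (S - 1) / 2 candidates, each of
    which is a pair of the matching with probability 1 / (N - 1). *)
Lemma edge_pairs_tail eps V : 0 < eps -> eps <= 1 -> (1 < ell n d)%N ->
  #|[set M in pm | (((degsum V)%:R / N) ^+ 2 / 2 + eps) * N <=
      #|M :&: edge_pairs d V|%:R]|%:R <=
  #|pm|%:R * expR (- (eps ^+ 2 / 32) * N).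
Proof.
move=> e0 e1 N1; have [pm0|pm0] := eqVneq pm set0.
  by rewrite pm0 cards0 mul0r lern0 cards_eq0; apply/eqP/setP => M; rewrite !inE.
have N1' : 1 < N by rewrite ltr1n.
have x4 : eps <= 4 by lra.
have := nlabels_azuma_upper (fun B => B) (edge_pairs d V) e0 x4.
rewrite card_half_edge; apply: le_trans; rewrite ler_nat; apply/subset_leq_card/subsetP => M.
rewrite inE => /andP[Mpm h]; rewrite inE Mpm /= nlabels_id.
apply: le_trans h; rewrite mulrDl lerD2r.
have mE := pmean_pairs pm0 N1 (@edge_pairs2 n d V).
set m := pmean _ _ in mE *; set s := (degsum V)%:R.
have sN : s <= N by rewrite ler_nat degsum_le.
have E2 : 2 * #|edge_pairs d V|%:R <= s * (s - 1) :> R.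
  have := card_pairs_at d V; rewrite -/(degsum V) => /(congr1 (fun k => k * 2)%N).
  rewrite bin2_double.
  rewrite /s; case: (degsum V) => [|k] e.
    have -> : #|edge_pairs d V| = 0%N by lia.
    by rewrite !mulr0 mul0r.
  rewrite [k.+1%:R - 1](_ : _ = k%:R); last by rewrite -natr1 addrK.
  rewrite -!natrM ler_nat; move: e; rewrite /=; nia.
have -> : (s / N) ^+ 2 / 2 * N = s ^+ 2 / (2 * N) by field; rewrite gt_eqF // (lt_trans ltr01).
rewrite ler_pdivlMr; last by lra.
rewrite -(ler_pM2r (_ : 0 < N - 1)); last by rewrite subr_gt0.
have -> : m * (2 * N) * (N - 1) = 2 * #|edge_pairs d V|%:R * N by rewrite -mE; ring.
have s0 : 0 <= s by [].
nra.
Qed.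

(** Inclusion-exclusion: the number of pairs of the matching exceeds the number
    of distinct pairs of end vertices by at most the number of couples of
    parallel edges ([card_imset_defect]). A pair of half-edges is parallel to at
    most [D] others, and two disjoint pairs occur together with probability
    1 / ((N - 1) (N - 3)). *)
Lemma pmean_ends V D : pm != set0 -> (3 < ell n d)%N ->
  {in V &, forall i j : 'I_n, (d i * d j <= D)%N} ->
  #|edge_pairs d V|%:R * (N - 3 - D%:R) <=
  (pmean (nlabels R (@ends n d) (edge_pairs d V)) set0 : R) * ((N - 1) * (N - 3)).
Proof.
move=> pm0 N3 dD; set E := edge_pairs d V; have E2 := @edge_pairs2 n d V.
have N1 : (1 < ell n d)%N by lia.
have pm1 : 0 < #|pm|%:R :> R by rewrite ltr0n card_gt0.
pose Q := [set U : {set {set H}} | (U \subset E) && [exists x, exists y,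
        [&& x != y, ends x == ends y & U == [set x; y]]]].
have cQ : (#|Q| <= #|E| * D)%N.
  apply: (@leq_trans #|[set [set p.1; p.2] | p : {set H} * {set H} in
      [set p : {set H} * {set H} | (p.1 \in E) && (p.2 \in [set C in E | ends C == ends p.1])]]|).
    apply/subset_leq_card/subsetP => U; rewrite inE => /andP[UE /existsP[x /existsP[y]]].
    move=> /and3P[xy /eqP exy /eqP Ue]; apply/imsetP; exists (x, y) => //.
    have xE : x \in E by apply: (subsetP UE); rewrite Ue !inE eqxx.
    have yE : y \in E by apply: (subsetP UE); rewrite Ue !inE eqxx orbT.
    by rewrite inE /= xE; apply/setIdP; rewrite yE exy.
  apply: (leq_trans (leq_imset_card _ _)).
  rewrite -sum1_card (partition_big (fun p : {set H} * {set H} => p.1) (mem E)) /=; last first.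
    by move=> p; rewrite inE => /andP[].
  rewrite -sum_nat_const; apply: leq_sum => B BE.
  apply: leq_trans (card_same_ends dD BE); rewrite sum1_card.
  have inj : injective (fun C : {set H} => (B, C)) by move=> C C' [].
  rewrite -(card_imset _ inj); apply/subset_leq_card/subsetP => -[B' C].
  rewrite unfold_in inE /= => /andP[/andP[_ CE] /eqP e]; subst B'.
  exact: imset_f.
have Q2 : {in Q, forall U : {set {set H}}, #|U| = 2%N}.
  move=> U; rewrite inE => /andP[_ /existsP[x /existsP[y /and3P[xy _ /eqP ->]]]].
  by rewrite cards2 xy.
have QM M : #|[set U in Q | U \subset M]| = #|[set U : {set {set H}} |
    (U \subset M :&: E) && [exists x, exists y,
        [&& x != y, ends x == ends y & U == [set x; y]]]]|.
  by apply: eq_card => U; rewrite !inE subsetI andbC andbA.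
have N3' : (3 < #|{: H}|)%N by rewrite card_half_edge.
have := sum_pmext2_le N3' Q2; rewrite -sum_count_sub card_half_edge => sQ.
have sF : \sum_(M in pm) #|M :&: E|%:R <=
   (pmean (nlabels R (@ends n d) E) set0 : R) * #|pm|%:R +
   (\sum_(M in pm) #|[set U in Q | U \subset M]|)%:R.
  rewrite pmeanE // natr_sum -big_split /=; apply: ler_sum => M _.
  by rewrite QM /nlabels -natrD ler_nat card_imset_defect.
have sE : (\sum_(M in pm) #|M :&: E|%:R) * (N - 1) = #|E|%:R * #|pm|%:R :> R.
  rewrite -natr_sum -(natrB _ (ltnW N1)) -!natrM; congr (_%:R).
  by have := mean_pairs E2; rewrite card_half_edge.
move: sQ; rewrite -(ler_nat R) !natrM natrB ?(ltnW N1) // natrB ?(ltnW N3) // => sQ.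
have cQ' : #|Q|%:R <= #|E|%:R * D%:R :> R by rewrite -natrM ler_nat.
have N1' : 0 <= N - 1 by rewrite subr_ge0 ler1n; lia.
have N3r : 0 <= N - 3 by rewrite subr_ge0 (ler_nat _ 3); lia.
rewrite -(ler_pM2r pm1).
set sg := \sum_(M in pm) #|M :&: E|%:R in sF sE.
set sq := (\sum_(M in pm) _)%:R in sQ sF.
set m := pmean _ _ in sF *.
have h1 : sg * ((N - 1) * (N - 3)) <= (m * #|pm|%:R + sq) * ((N - 1) * (N - 3)).
  by rewrite ler_wpM2r // mulr_ge0.
have h2 : #|Q|%:R * #|pm|%:R <= #|E|%:R * D%:R * #|pm|%:R :> R by rewrite ler_wpM2r.
have h3 : sg * ((N - 1) * (N - 3)) = #|E|%:R * #|pm|%:R * (N - 3) by rewrite mulrA sE.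
lra.
Qed.

Lemma simple_edges_tail eps (V := small_vertices eps) : 0 < eps -> eps <= 1 ->
  (8 <= ell n d)%N -> 1 <= eps * N ->
  #|[set M in pm | #|simple_edges (cm_graph M) V|%:R <=
       (((degsum V)%:R / N) ^+ 2 / 2 - 4 * eps) * N]|%:R <=
  #|pm|%:R * expR (- (eps ^+ 2 / 32) * N).
Proof.
move=> e0 e1 N8 eN; have [pm0|pm0] := eqVneq pm set0.
  by rewrite pm0 cards0 mul0r lern0 cards_eq0; apply/eqP/setP => M; rewrite !inE.
have N8' : 8 <= N by rewrite (ler_nat _ 8).
have x4 : eps <= 4 by lra.
have := nlabels_azuma_lower (@ends n d) (edge_pairs d V) e0 x4.
rewrite card_half_edge; apply: le_trans; rewrite ler_nat; apply/subset_leq_card/subsetP => M.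
rewrite inE => /andP[Mpm h]; rewrite inE Mpm /=.
rewrite /nlabels -(card_simple_edges V Mpm); apply: le_trans h _.
rewrite [leLHS](_ : _ = (((degsum V)%:R / N) ^+ 2 / 2 - 3 * eps) * N - eps * N); last by ring.
rewrite lerD2r.
(* Two small vertices are joined by at most eps^2 N pairs of half-edges. *)
pose D := Num.truncn (eps ^+ 2 * N).
have e2N : 0 <= eps ^+ 2 * N by rewrite mulr_ge0 ?sqr_ge0.
have smallP i : i \in V -> (d i)%:R <= eps * Num.sqrt N by rewrite inE.
have sqN : Num.sqrt N * Num.sqrt N = N by rewrite -expr2 sqr_sqrtr.
have dD : {in V &, forall i j : 'I_n, (d i * d j <= D)%N}.
  move=> i j /smallP iV /smallP jV; rewrite -ltnS -(ltr_nat R).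
  apply: le_lt_trans (truncnS_gt _); rewrite natrM.
  apply: le_trans (ler_pM _ _ iV jV) _ => //.
  by rewrite mulrACA sqN.
have := pmean_ends pm0 (_ : 3 < ell n d)%N dD; rewrite (leq_trans _ N8) // => /(_ isT).
set m := pmean _ _; set s := (degsum V)%:R; set E := #|edge_pairs d V|%:R => mE.
have DN : D%:R <= eps ^+ 2 * N by rewrite truncn_le.
have sN : s <= N by rewrite ler_nat degsum_le.
have s0 : 0 <= s by [].
set L := #|loop_pairs d V|%:R : R.
have EL : 2 * E + 2 * L = s * (s - 1).
  have := card_pairs_at d V; rewrite -/(degsum V) => /(congr1 (fun k => k * 2)%N).
  rewrite bin2_double mulnDl => /(congr1 (fun k => k%:R : R)).
  rewrite natrD !natrM -/E -/L => e; rewrite ![2 * _]mulrC e /s.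
  case: (degsum V) => [|k]; first by rewrite !mul0r.
  by rewrite [k.+1%:R - 1](_ : _ = k%:R) // -natr1 addrK.
have L2 : 2 * L <= eps * N * s.
  have := card_loop_pairs d V; move=> /(leq_mul (leqnn 2)).
  rewrite big_distrr /= -(ler_nat R) natrM -/L natr_sum => /le_trans; apply.
  rewrite /s /degsum natr_sum mulr_sumr; apply: ler_sum => i iV.
  rewrite mulnC bin2_double natrM mulrC ler_wpM2r //.
  apply: (@le_trans _ _ (d i)%:R); first by rewrite ler_nat leq_pred.
  apply: le_trans (smallP i iV) _; rewrite ler_wpM2l ?(ltW e0) //.
  rewrite -[leRHS]sqN -[leLHS]mul1r ler_wpM2r ?sqrtr_ge0 //.
  by rewrite -[leLHS]sqrtr1 ler_wsqrtr //; lra.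
have Np : 0 < N by lra.
rewrite -(ler_pM2r (_ : 0 < (N - 1) * (N - 3))); last by rewrite mulr_gt0 //; lra.
apply: le_trans mE.
set X := eps * N in eN L2 *.
have E0 : 0 <= E by [].
have L0 : 0 <= L by [].
have s2N : s ^+ 2 / N <= s by rewrite ler_pdivrMr // expr2 ler_wpM2l.
have b1 : (s / N) ^+ 2 / 2 * N * ((N - 1) * (N - 3)) <= s ^+ 2 * (N - 3) / 2.
  have -> : (s / N) ^+ 2 / 2 * N * ((N - 1) * (N - 3)) =
      s ^+ 2 * (N - 3) / 2 - s ^+ 2 / N * (N - 3) / 2 by field; rewrite gt_eqF.
  by rewrite lerBlDr lerDl !mulr_ge0 ?sqr_ge0 ?invr_ge0 ?subr_ge0 // ?ltW //; lra.
have b2 : E * D%:R <= X * N ^+ 2 / 2.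
  have e2 : E <= N ^+ 2 / 2 by nra.
  have e3 : D%:R <= X by apply: le_trans DN _; rewrite expr2 -mulrA -/X ler_piMl //; lra.
  have := ler_pM E0 (ler0n _ _) e2 e3; lra.
have b3 : (s + 2 * L) * (N - 3) <= 2 * X * N * (N - 3).
  rewrite ler_wpM2r //; first by lra.
  have : X * s <= X * N by rewrite ler_wpM2l //; lra.
  have : N <= X * N by rewrite ler_peMl //; lra.
  lra.
have b4 : 0 <= X * (N ^+ 2 * 3 / 2 - 9 * N + 9).
  by rewrite mulr_ge0 //; [lra|nra].
have -> : ((s / N) ^+ 2 / 2 - 3 * eps) * N * ((N - 1) * (N - 3)) =
  (s / N) ^+ 2 / 2 * N * ((N - 1) * (N - 3)) - 3 * X * ((N - 1) * (N - 3)).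
  by rewrite /X; ring.
have -> : E * (N - 3 - D%:R) = (s ^+ 2 - s - 2 * L) * (N - 3) / 2 - E * D%:R.
  have -> : E = (s ^+ 2 - s - 2 * L) / 2 by lra.
  by field.
lra.
Qed.

(** The mean number of these loops is of order eps * sqrt N, whereas deviations
    of order N are the scale of [pmatch_azuma]. A factorial moment of order
    k ~ 2 eps sqrt N gives the bound 2^-k instead, and k^4 <= 256 * 2^k. *)
Lemma small_loops_tail eps (V := small_vertices eps) : 0 < eps -> eps <= 1 ->
  1 <= eps * Num.sqrt N -> 8 <= Num.sqrt N ->
  #|[set M in pm | 4 * eps * Num.sqrt N < #|V :&: loopy (cm_graph M)|%:R]|%:R <=
  #|pm|%:R * (256 / (eps ^+ 4 * N ^+ 2)).
Proof.
move=> e0 e1 eN N8; set sq := Num.sqrt N in eN N8 *.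
have sqN : sq * sq = N by rewrite -expr2 sqr_sqrtr.
pose k := Num.truncn (2 * eps * sq); pose m := (Num.truncn (4 * eps * sq)).+1.
have es0 : 0 < eps * sq by lra.
have k_le : k%:R <= 2 * eps * sq by rewrite truncn_le; lra.
have k_gt : 2 * eps * sq < k.+1%:R := truncnS_gt _.
have m_gt : 4 * eps * sq < m%:R := truncnS_gt _.
have m_le : m.-1%:R <= 4 * eps * sq by rewrite truncn_le; lra.
have k_ge : eps * sq <= k%:R by move: k_gt; rewrite -natr1; lra.
have k0 : (0 < k)%N by rewrite -(ltr0n R); lra.
have km : (k <= m)%N.
  by rewrite -(ler_nat R) (le_trans k_le) // ltW // (le_lt_trans _ m_gt) //; lra.
have Npos : (0 < #|{: H}|)%N by rewrite card_half_edge -(ltr0n R) -sqN; nra.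
have kN : (4 * k <= #|{: H}|)%N.
  rewrite card_half_edge -(ler_nat R) natrM -sqN; nra.
have loopsV : (4 * #|loop_pairs d V| <= #|{: H}| * (m.+1 - k))%N.
  rewrite card_half_edge -(ler_nat R) !natrM natrB ?(leqW km) // -[m.+1%:R]natr1.
  have : (2 * #|loop_pairs d V| <= Num.truncn (eps * sq) * degsum V)%N.
    apply: loop_pairs_le => i; rewrite inE => iV.
    by rewrite truncn_ge_nat // ltW.
  rewrite -(ler_nat R) !natrM => h.
  have tr : (Num.truncn (eps * sq))%:R <= eps * sq by rewrite truncn_le ltW.
  have sN : (degsum V)%:R <= N by rewrite ler_nat degsum_le.
  have h2 := ler_pM (ler0n _ _) (ler0n _ _) tr sN.
  have h3 : 2 * (eps * sq) * N <= (m%:R + 1 - k%:R) * N.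
    by rewrite ler_wpM2r //; lra.
  lra.
have tail := pair_count_tail k0 km Npos kN loopsV.
apply: (@le_trans _ _ (#|[set M in pm | (m <= #|M :&: loop_pairs d V|)%N]|%:R)).
  rewrite ler_nat; apply/subset_leq_card/subsetP => M; rewrite inE => /andP[Mpm h].
  rewrite inE Mpm /=; apply: leq_trans (card_loopy V Mpm).
  by rewrite /m truncn_lt_nat //; lra.
set q := #|[set M in _ | _]| in tail *.
(* The fourth power of k <= 4 * 2^(k/4). *)
have q4 : k%:R ^+ 4 <= 256 * 2 ^+ k :> R.
  have kj : k%:R <= 4 * 2 ^+ (k %/ 4) :> R.
    have : ((k %/ 4).+1 <= 2 ^ (k %/ 4))%N by exact: ltn_expl.
    rewrite -(ler_nat R) natrX => jj.
    have : (k <= (k %/ 4).+1 * 4)%N by apply: ltnW; rewrite -ltn_divLR.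
    by rewrite -(ler_nat R) natrM; lra.
  apply: (@le_trans _ _ ((4 * 2 ^+ (k %/ 4)) ^+ 4)).
    by rewrite lerXn2r ?nnegrE ?mulr_ge0 ?exprn_ge0.
  rewrite exprMn -exprM (_ : 4 ^+ 4 = 256); last by ring.
  by rewrite ler_wpM2l // ler_weXn2l ?ler1n // leq_divM.
have N2 : 0 < N ^+ 2 by rewrite exprn_gt0 // -sqN; nra.
rewrite mulrA ler_pdivlMr; last by rewrite mulr_gt0 // exprn_gt0.
have e4 : eps ^+ 4 * N ^+ 2 <= 256 * 2 ^+ k.
  rewrite -sqN (_ : eps ^+ 4 * (sq * sq) ^+ 2 = (eps * sq) ^+ 4); last by ring.
  apply: (@le_trans _ _ (k%:R ^+ 4)); first by rewrite lerXn2r ?nnegrE // ltW.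
  exact: q4.
apply: le_trans (ler_wpM2l (ler0n _ q) e4) _.
rewrite mulrCA [leRHS]mulrC ler_wpM2l //.
by move: tail; rewrite -(ler_nat R) natrM natrX.
Qed.

End typical.

(** * Loops at vertices of large degree *)

Section many_loops.
Context {R : realType} (n : nat) (d : nat -> nat).
Local Notation H := (half_edge n d).
Local Notation pm := (perfect_matchings n d).
Local Notation N := ((ell n d)%:R : R).
Local Notation s := (Num.sqrt N).

(** Bonferroni's inequality for the pairs of the matching inside a set [X] of
    half-edges at [i]. Keeping only about eps * sqrt N of the half-edges makes the
    mean number of pairs of order eps^2, and the second factorial moment at most
    half of the mean. *)
Lemma loop_probability_ge eps (i : 'I_n) : 0 < eps -> eps <= 1 ->
  4 <= eps * s -> eps * s < (d i)%:R ->
  eps ^+ 2 / 16 * #|pm|%:R <= #|[set M in pm | i \in loopy (cm_graph M)]|%:R.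
Proof.
move=> e0 e1 es4 di; have sN : s * s = N by rewrite -expr2 sqr_sqrtr.
have s4 : 4 <= s by apply: le_trans es4 _; rewrite ler_piMl ?sqrtr_ge0.
have N16 : 16 <= N by rewrite -sN; nra.
have N3 : (3 < ell n d)%N by rewrite -(ltr_nat R); lra.
have N1 : (1 <= ell n d)%N by lia.
pose q := Num.truncn (eps * s).
have q_le : q%:R <= eps * s by rewrite truncn_le; lra.
have q_gt : eps * s < q%:R + 1 by rewrite natr1; exact: truncnS_gt.
have q4 : (4 <= q)%N by rewrite truncn_ge_nat //; lra.
clearbody q; have q1 : (1 <= q)%N := leq_trans (isT : (1 <= 4)%N) q4.
have qd : (q <= #|half_edges_at d [set i]|)%N.
  rewrite card_half_edges_at big_set1 -(ler_nat R); lra.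
have [X XH Xq] : exists2 X : {set H}, X \subset half_edges_at d [set i] & #|X| = q.
  have : (0 < #|[set X : {set H} | (X \subset half_edges_at d [set i]) & #|X| == q]|)%N.
    by rewrite cards_draws bin_gt0.
  by move=> /card_gt0P[X]; rewrite inE => /andP[XH /eqP Xq]; exists X.
pose A := [set B : {set H} | B \subset X & #|B| == 2%N].
have A2 : {in A, forall B : {set H}, #|B| = 2%N} by move=> B; rewrite inE => /andP[_ /eqP].
have cA : (#|A| * 2 = q * q.-1)%N by rewrite -bin2_double -Xq -cards_draws.
have loopA M : M \in pm -> (0 < #|M :&: A|)%N -> i \in loopy (cm_graph M).
  move=> Mpm /card_gt0P[B /setIP[BM]]; rewrite !inE => /andP[BX B2].
  rewrite cm_graphE; apply/card_gt0P; exists B; rewrite inE BM setUid /=.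
  have : B != set0 by rewrite -cards_eq0 (eqP B2).
  move=> /set0Pn[h hB]; rewrite eqEsubset; apply/andP; split.
    apply/subsetP => _ /imsetP[h' h'B ->].
    by have := subsetP (subset_trans BX XH) _ h'B; rewrite inE.
  rewrite sub1set; apply/imsetP; exists h => //.
  by have := subsetP (subset_trans BX XH) _ hB; rewrite !inE => /eqP.
set L := [set M in pm | _].
(* k <= [k > 0] + k (k - 1) / 2 for every natural number k. *)
have bonf : (\sum_(M in pm) #|M :&: A| <= #|L| + \sum_(M in pm) 'C(#|M :&: A|, 2))%N.
  have -> : #|L| = (\sum_(M in pm) (i \in loopy (cm_graph M)))%N.
    by rewrite -big_mkcondr -sum1_card; apply: eq_bigl => M; rewrite [LHS]inE.
  rewrite -big_split /=; apply: leq_sum => M Mpm.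
  have := loopA M Mpm; case: #|M :&: A| => [//|k] /(_ isT) ->.
  by rewrite binS bin1 add1n ltnS leq_addl.
have m1 := mean_pairs A2; rewrite card_half_edge in m1.
have m2 : ((\sum_(M in pm) 'C(#|M :&: A|, 2)) * ((ell n d - 1) * (ell n d - 3)) <=
    'C(#|A|, 2) * #|pm|)%N.
  rewrite (sum_bin_pairs A 2) -card_half_edge -cards_draws.
  apply: sum_pmext2_le; first by rewrite card_half_edge.
  by move=> U; rewrite inE => /andP[_ /eqP].
have cA2 : ('C(#|A|, 2) * 2 <= #|A| * #|A|)%N by rewrite bin2_double leq_mul // leq_pred.
move: bonf m1 m2 cA2; rewrite -!(ler_nat R) => bonf /(congr1 (fun k => k%:R : R)).
rewrite !natrM !natrB ?(ltnW N3) //.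
set a := #|A|%:R : R; set S1 := (\sum_(M in pm) #|M :&: A|)%:R : R.
set S2 := (\sum_(M in pm) 'C(#|M :&: A|, 2))%:R : R.
set C2 := 'C(#|A|, 2)%:R : R; set p := #|pm|%:R : R; set l := #|L|%:R : R.
move: bonf; rewrite natrD -/S1 -/S2 -/l => bonf m1 m2 cA2.
have p0 : 0 <= p by [].
have a0 : 0 <= a by [].
have aE : a * 2 = q%:R * (q%:R - 1).
  have := congr1 (fun k => k%:R : R) cA; rewrite !natrM -/a => ->.
  by rewrite -subn1 natrB.
have q2N : q%:R * q%:R <= N.
  rewrite -sN; apply: ler_pM => //; apply: le_trans q_le _; rewrite ler_piMl ?sqrtr_ge0 //.
have a_le : a <= N / 2 by have q00 : 0 <= q%:R :> R := ler0n _ _; lra.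
have a_ge : eps ^+ 2 * N / 8 <= a.
  have h1 : eps * s / 2 <= q%:R - 1 by lra.
  have h2 : eps * s / 2 <= q%:R by lra.
  have := ler_pM (_ : 0 <= eps * s / 2) (_ : 0 <= eps * s / 2) h2 h1.
  have -> : eps * s / 2 * (eps * s / 2) = eps ^+ 2 * (s * s) / 4 by field.
  rewrite sN => le4; have := le4 _ _; rewrite -aE; lra.
have C2a : C2 <= a * a / 2 by lra.
have N3r : 0 < N - 3 by lra.
have N1r : 0 < N - 1 by lra.
have h : p * a / 2 <= l * (N - 1).
  have h1 : C2 * p <= a * a / 2 * p by rewrite ler_wpM2r.
  have h2 : a * p * a <= a * p * (N / 2) by rewrite ler_wpM2l // mulr_ge0.
  have h3 : S2 * (N - 1) <= p * a / 2.
    rewrite -(ler_pM2r N3r); have h4 : 0 <= a * p * (N - 6) by rewrite !mulr_ge0 //; lra.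
    lra.
  have h5 : S1 * (N - 1) <= (l + S2) * (N - 1) by rewrite ler_wpM2r // ltW.
  lra.
rewrite -(ler_pM2r N1r); apply: le_trans h.
have h6 : p * (eps ^+ 2 * N / 8) <= p * a by rewrite ler_wpM2l.
have h7 : 0 <= p * eps ^+ 2 by rewrite mulr_ge0 ?sqr_ge0.
lra.
Qed.

(** The number of loopy vertices in [W] is at most [#|W|] and has mean at least
    twice eps^2 / 32 * [#|W|]; so it is at least half of that with probability at
    least eps^2 / 32. *)
Lemma many_loops_law eps (W : {set 'I_n}) : 0 < eps -> eps <= 1 ->
  4 <= eps * s -> (forall i, i \in W -> eps * s < (d i)%:R) -> (0 < #|W|)%N ->
  eps ^+ 2 / 32 * #|pm|%:R <=
  #|[set M in pm | eps ^+ 2 / 32 * #|W|%:R <= #|W :&: loopy (cm_graph M)|%:R]|%:R.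
Proof.
move=> e0 e1 es4 Wd W0; set c := eps ^+ 2 / 32; set L := [set M in pm | _].
have K0 : 0 < #|W|%:R :> R by rewrite ltr0n.
have sumE : \sum_(M in pm) #|W :&: loopy (cm_graph M)|%:R =
    \sum_(i in W) #|[set M in pm | i \in loopy (cm_graph M)]|%:R :> R.
  rewrite -!natr_sum; congr (_%:R).
  under eq_bigr do rewrite -sum1_card.
  rewrite (exchange_big_dep (mem W)) /=; last by move=> M i _ /setIP[].
  apply: eq_bigr => i iW; rewrite -sum1_card; apply: eq_bigl => M.
  by rewrite [in RHS]inE finset.in_setI iW.
have lower : 2 * c * #|pm|%:R * #|W|%:R <= \sum_(M in pm) #|W :&: loopy (cm_graph M)|%:R.
  have -> : #|W|%:R = \sum_(i in W) 1 :> R by rewrite sumr_const.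
  rewrite sumE mulr_sumr; apply: ler_sum => i iW.
  rewrite mulr1; apply: le_trans (loop_probability_ge e0 e1 es4 (Wd i iW)).
  by rewrite /c le_eqVlt; apply/orP; left; apply/eqP; field.
have upper : \sum_(M in pm) #|W :&: loopy (cm_graph M)|%:R <=
    (c * #|pm|%:R + #|L|%:R) * #|W|%:R :> R.
  have -> : #|L|%:R = \sum_(M in pm) (M \in L)%:R :> R.
    rewrite -sum1_card natr_sum big_mkcond [RHS]big_mkcond; apply: eq_bigr => M _.
    by rewrite inE; case: (M \in pm); case: (_ <= _).
  have -> : c * #|pm|%:R = \sum_(M in pm) c by rewrite sum_constR mulrC.
  rewrite -big_split mulr_suml /=; apply: ler_sum => M Mpm.
  have [ML|] := boolP (M \in L).
    apply: (@le_trans _ _ (1 * #|W|%:R)).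
      by rewrite mul1r ler_nat subset_leq_card // finset.subsetIl.
    by rewrite ler_wpM2r // lerDr divr_ge0 ?sqr_ge0.
  by rewrite inE Mpm /= -ltNge addr0 => /ltW.
rewrite -(ler_pM2r K0); lra.
Qed.

End many_loops.

From mathcomp Require Import all_classical all_reals all_analysis.
From mathcomp Require Import measurable_realfun.
Import numFieldNormedType.Exports.
Local Open Scope classical_set_scope.
Local Open Scope ring_scope.

(** * Poisson laws and the Stein equation *)

Section poisson.
Context {R : realType}.
Implicit Types (lam M : R) (h : nat -> R) (K : nat).

Lemma le_norm_cvg (u : nat -> R) (l a e : R) : u @ \oo --> l ->
  (\forall n \near \oo, `|a - u n| <= e) -> `|a - l| <= e.
Proof.
move=> ul ae; have al : `|a - u n| @[n --> \oo] --> `|a - l|.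
  by apply: cvg_norm; apply: cvgB => //; exact: cvg_cst.
rewrite -(cvg_lim _ al) //; apply: limr_le => //.
by apply/cvg_ex; exists `|a - l|.
Qed.

Definition pweight lam (j : nat) : R := lam ^+ j / j`!%:R.

Lemma pweight_ge0 lam j : 0 <= lam -> 0 <= pweight lam j.
Proof. by move=> ?; rewrite divr_ge0 // exprn_ge0. Qed.

Lemma sum_pweight_le lam K : 0 <= lam -> \sum_(j < K) pweight lam j <= expR lam.
Proof.
move=> l0; rewrite -(big_mkord xpredT).
apply: (@nondecreasing_cvgn_le R (series (exp_coeff lam)) _ _ K).
  by apply: nondecreasing_series => i _ _; exact: exp_coeff_ge0.
exact: is_cvg_series_exp_coeff.
Qed.

Lemma fact_mul_le a b : (a`! * b`! <= (a + b)`!)%N.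
Proof.
by rewrite -(bin_fact (leq_addr b a)) addKn leq_pmull // bin_gt0 leq_addr.
Qed.

(** The mean of [h] under the Poisson law conditioned to [0, K]. *)
Definition pmean_trunc lam h K : R :=
  (\sum_(j < K.+1) pweight lam j * h j) / \sum_(j < K.+1) pweight lam j.

Lemma sum_pweight_gt0 lam K : 0 <= lam -> 0 < \sum_(j < K.+1) pweight lam j.
Proof.
move=> l0; rewrite big_ord_recl ltr_wpDr //.
  by apply: sumr_ge0 => j _; exact: pweight_ge0.
by rewrite /pweight expr0 fact0 divr1.
Qed.

Lemma pmean_trunc_bound lam h K M : 0 <= lam -> (forall k, `|h k| <= M) ->
  `|pmean_trunc lam h K| <= M.
Proof.
move=> l0 hM; have s0 := sum_pweight_gt0 K l0.
rewrite normrM normfV (gtr0_norm s0) ler_pdivrMr //.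
apply: le_trans (ler_norm_sum _ _ _) _; rewrite mulr_sumr; apply: ler_sum => j _.
by rewrite normrM ger0_norm ?pweight_ge0 // mulrC ler_wpM2r ?pweight_ge0.
Qed.

(** The Stein equation for the conditioned law is solved backwards from [K], by
    a finite sum; as the bound is free of [K], the limit in [K] can be taken
    afterwards. *)
Lemma stein_solution lam h K M : 0 <= lam -> (forall k, `|h k| <= M) ->
  exists g : nat -> R, (forall k, `|g k| <= 2 * M * expR lam) /\
   forall k, (k <= K)%N -> lam * g k.+1 - k%:R * g k = h k - pmean_trunc lam h K.
Proof.
move=> l0 hM; set c0 := pmean_trunc lam h K.
have M0 : 0 <= M := le_trans (normr_ge0 _) (hM 0%N).
pose q k j : R := lam ^+ j * (k.-1)`!%:R / (k + j)`!%:R * (h (k + j)%N - c0).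
pose g k : R := if k is 0 then 0 else - \sum_(j < K.+1 - k) q k j.
exists g; split.
  case=> [|k] /=; first by rewrite normr0 !mulr_ge0 ?expR_ge0.
  rewrite normrN; apply: le_trans (ler_norm_sum _ _ _) _.
  apply: (@le_trans _ _ (\sum_(j < K.+1 - k.+1) pweight lam j * (2 * M))).
    apply: ler_sum => j _; rewrite normrM; apply: ler_pM => //.
      have p0 : 0 <= lam ^+ j * k`!%:R / (k.+1 + j)`!%:R.
        by rewrite mulr_ge0 ?invr_ge0 // mulr_ge0 ?exprn_ge0.
      rewrite ger0_norm // /pweight -mulrA ler_wpM2l ?exprn_ge0 //.
      rewrite ler_pdivrMr ?ltr0n ?fact_gt0 // mulrC ler_pdivlMr ?ltr0n ?fact_gt0 //.
      rewrite -natrM ler_nat; apply: (leq_trans (fact_mul_le _ _)).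
      by rewrite addSn factS leq_pmull.
    apply: le_trans (ler_normB _ _) _; rewrite mulr_natl mulr2n lerD //.
    exact: pmean_trunc_bound.
  by rewrite -mulr_suml mulrC ler_wpM2l ?mulr_ge0 // sum_pweight_le.
have eqS k : (k < K.+1)%N -> k%:R * g k = - \sum_(j < K.+1 - k)
    lam ^+ j * k`!%:R / (k + j)`!%:R * (h (k + j)%N - c0)
  \/ k = 0%N.
  case: k => [|k] kK; [by right|left].
  rewrite /g mulrN mulr_sumr; congr (- _); apply: eq_bigr => j _.
  by rewrite /q /= factS natrM; ring.
have eqL k : (k < K.+1)%N -> lam * g k.+1 = - \sum_(j < K.+1 - k)
    lam ^+ j * k`!%:R / (k + j)`!%:R * (h (k + j)%N - c0) + (h k - c0).
  move=> kK; rewrite /g mulrN mulr_sumr (subSn (ltnSE kK)) subSS big_ord_recl /=.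
  rewrite expr0 mul1r addn0 divff ?pnatr_eq0 -?lt0n ?fact_gt0 // mul1r opprD addrAC addNr add0r.
  congr (- _); apply: eq_bigr => j _.
  by rewrite /q /= /bump /= add1n exprS addSnnS; ring.
move=> k kK; rewrite eqL //; have [->|k0] := eqS k kK; first by ring.
subst k; rewrite mul0r subr0 subn0 (_ : \sum_(j < _) _ = 0) ?oppr0 ?add0r //.
rewrite (eq_bigr (fun j : 'I__ => pweight lam j * h j - pweight lam j * c0)).
  rewrite sumrB -mulr_suml mulrC /c0 /pmean_trunc divfK ?subrr //.
  by rewrite gt_eqF // sum_pweight_gt0.
by move=> j _; rewrite fact0 add0n mulr1 mulrBr.
Qed.

Lemma poisson_prob_set1 lam i : 0 <= lam ->
  poisson_prob lam 0 [set i] = (pweight lam i * expR (- lam))%:E.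
Proof.
rewrite le_eqVlt => /predU1P[<-|l0]; rewrite /poisson_prob.
  rewrite ltxx oppr0 expR0 mulr1 /pweight expr0n diracE.
  have [->|i0] := eqVneq i 0%N; first by rewrite mem_set //= fact0 divr1.
  by rewrite memNset /= ?mul0r // => e; rewrite -e eqxx in i0.
by rewrite l0 esum_set1 /poisson_pmf l0 // lee_fin -/(pweight lam i) mulr_ge0 ?expR_ge0 ?pweight_ge0 // ltW.
Qed.

Lemma poisson_integrable lam h M : (forall k, `|h k| <= M) ->
  (poisson_prob lam 0).-integrable setT (EFin \o h).
Proof.
move=> hM; apply: measurable_bounded_integrable => //.
  by rewrite (le_lt_trans (probability_le1 _ _)) // ltry.
exists M; split; first exact: num_real.
by move=> x Mx y _ /=; apply: le_trans (hM y) _; exact: ltW.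
Qed.

Let cvg_poisson_sum_ge0 lam h M : 0 <= lam -> (forall k, `|h k| <= M) ->
  (forall k, 0 <= h k) ->
  (\sum_(0 <= j < K) pweight lam j * h j) * expR (- lam) @[K --> \oo] -->
  (\int[poisson_prob lam 0]_k h k : R).
Proof.
move=> l0 hM h0; have ih := poisson_integrable lam hM.
have UT : \bigcup_i [set i] = [set: nat] by apply/seteqP; split => // i _; exists i.
have tT : trivIset setT (fun i : nat => [set i]).
  by move=> i j _ _ [x [-> ->]].
have := @ge0_integral_bigcup _ _ _ (poisson_prob lam 0) (fun i : nat => [set i])
  (EFin \o h) (fun=> I).
rewrite /= UT => /(_ _ _ tT) E.
suff : ((\sum_(0 <= j < K) pweight lam j * h j) * expR (- lam))%:E @[K --> \oo]
    --> (\int[poisson_prob lam 0]_k h k)%:E by move/fine_cvg.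
rewrite /Rintegral fineK; last exact: integrable_fin_num ih.
rewrite E //; last by move=> x _; rewrite lee_fin.
rewrite (_ : (fun K => _) = (fun K : nat => \sum_(0 <= i < K)
    \int[poisson_prob lam 0]_(x in [set i]) (h x)%:E)%E).
  by apply: is_cvg_nneseries => i _ _; apply: integral_ge0 => x _; rewrite lee_fin.
apply/funext => K; rewrite mulr_suml -sumEFin; apply: eq_bigr => i _.
rewrite (eq_integral (cst (h i)%:E)); last by move=> x; rewrite inE => ->.
rewrite integral_cst // /= poisson_prob_set1 // -EFinM; congr EFin; ring.
Qed.

Lemma cvg_poisson_sum lam h M : 0 <= lam -> (forall k, `|h k| <= M) ->
  (\sum_(j < K.+1) pweight lam j * h j) * expR (- lam) @[K --> \oo] -->
  (\int[poisson_prob lam 0]_k h k : R).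
Proof.
move=> l0 hM; have M0 : 0 <= M := le_trans (normr_ge0 _) (hM 0%N).
pose h1 k := h k + M; pose h2 (k : nat) := M.
have h1M k : `|h1 k| <= M + M by apply: le_trans (ler_normD _ _) _; rewrite lerD // ger0_norm.
have h2M k : `|h2 k| <= M by rewrite ger0_norm.
have h10 k : 0 <= h1 k by rewrite -lerBlDr sub0r; have := hM k; rewrite ler_norml => /andP[].
have c1 := cvg_poisson_sum_ge0 l0 h1M h10.
have c2 := cvg_poisson_sum_ge0 l0 h2M (fun=> M0).
have -> : \int[poisson_prob lam 0]_k h k = \int[poisson_prob lam 0]_k h1 k
    - \int[poisson_prob lam 0]_k h2 k.
  rewrite -RintegralB //; [|exact: poisson_integrable h1M|exact: poisson_integrable h2M].
  by apply: eq_Rintegral => k _; rewrite /h1 /h2 addrK.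
rewrite (cvg_shiftS (fun K => (\sum_(j < K) pweight lam j * h j) * expR (- lam))).
rewrite (_ : (fun K => _) = (fun K : nat =>
  (\sum_(0 <= j < K) pweight lam j * h1 j) * expR (- lam) -
  (\sum_(0 <= j < K) pweight lam j * h2 j) * expR (- lam))).
  exact: cvgB.
apply/funext => K; rewrite !big_mkord -mulrBl -sumrB; congr (_ * _).
by apply: eq_bigr => j _; rewrite -mulrBr /h1 /h2 addrK.
Qed.

Lemma cvg_pmean_trunc lam h M : 0 <= lam -> (forall k, `|h k| <= M) ->
  pmean_trunc lam h K @[K --> \oo] --> (\int[poisson_prob lam 0]_k h k : R).
Proof.
move=> l0 hM; have c1 := cvg_poisson_sum l0 hM.
have n1 (k : nat) : `|(fun=> 1 : R) k| <= 1 by rewrite normr1.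
have I1 : (\int[poisson_prob lam 0]_k (1 : R) : R) = 1.
  rewrite Rintegral_cst // mul1r -[RHS]/(fine (1%:E)); congr fine.
  exact: (@probability_setT _ _ _ (poisson_prob lam 0)).
have := cvg_poisson_sum l0 n1; rewrite I1 => c2.
have c3 := cvgM c1 (cvgV (oner_neq0 _) c2).
rewrite invr1 mulr1 in c3; apply: (cvg_trans _ (c3 _ _)); apply: near_eq_cvg.
near=> K => /=; under [X in _ / (X * _)]eq_bigr do rewrite mulr1.
rewrite -mulf_div divff ?mulr1 //; exact/lt0r_neq0/expR_gt0.
Unshelve. all: by end_near. Qed.

(** Evaluating the Stein equation at the count of selected edges reduces the
    difference of the means to [stein_chen]. For [K] >= #|E| the equation holds at
    every value of the count, and then [K] tends to infinity. *)
Lemma poisson_approx (n : nat) (p lam M : R) h (E : {set 'I_n * 'I_n}) :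
  0 <= p -> p <= 1 -> 0 <= lam -> {in E, forall e : 'I_n * 'I_n, (e.1 < e.2)%N} ->
  (forall k, `|h k| <= M) ->
  `|bern p (fun S => h (nb_in E S)) - \int[poisson_prob lam 0]_k h k| <=
  2 * M * expR lam * (`|lam - p ^+ 2 * #|E|%:R| +
     2 * (p ^+ 3 * #|cherries E|%:R + p ^+ 4 * (#|cherries E| + #|E|)%:R)).
Proof.
move=> p0 p1 l0 Elt hM; apply: (le_norm_cvg (cvg_pmean_trunc l0 hM)).
near=> K; have [g [gM gK]] := stein_solution K l0 hM.
set c := 2 * M * expR lam in gM *.
have WK S : (nb_in E S <= K)%N.
  apply: (@leq_trans #|E|); last by near: K; exact: nbhs_infty_ge.
  by rewrite -sum1_card /nb_in; apply: leq_sum => e _; exact: leq_b1.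
rewrite -{1}(@bern_cst R 'I_n p (pmean_trunc lam h K)) -bernB.
rewrite (@eq_bern _ _ _ _ (fun S => (lam - p ^+ 2 * #|E|%:R) * g (nb_in E S).+1 +
   (p ^+ 2 * #|E|%:R * g (nb_in E S).+1 - (nb_in E S)%:R * g (nb_in E S)))); last first.
  by move=> S; rewrite -gK //; ring.
rewrite bernD bernZ; apply: le_trans (ler_normD _ _) _; rewrite [leRHS]mulrDr lerD //.
  rewrite normrM mulrC ler_wpM2r //; apply: le_trans (ler_norm_bern _ p0 p1) _.
  by rewrite -[leRHS](@bern_cst R 'I_n p c); apply: ler_bern.
by rewrite [leRHS]mulrA [c * 2]mulrC; exact: stein_chen.
Unshelve. all: by end_near. Qed.

End poisson.

(** * Sampling a sparse multigraph *)

Section sparse.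
Context (n : nat) (G : mgraph n) (V : {set 'I_n}).
Local Notation simpleE := (simple_edges G V).
Local Notation doubleE := (double_edges G V).
Local Notation badV := (bad_vertices G V).
Implicit Types (S : {set 'I_n}) (e f : 'I_n * 'I_n).

Definition matching_sample S : bool :=
  [&& [disjoint badV & S], [forall e in doubleE, ~~ inS S e] &
      [forall ef in cherries simpleE, ~~ (inS S ef.1 && inS S ef.2)]].

Lemma eq_unlabel (m1 m2 : nat) (G1 : mgraph m1) (G2 : mgraph m2)
    (phi : 'I_m1 -> 'I_m2) : bijective phi ->
  (forall i j, G2 (phi i) (phi j) = G1 i j) -> unlabel G1 = unlabel G2.
Proof.
move=> bphi phiG; apply/eqquotP; apply/asboolP.
by exists phi.
Qed.

(** The selected edges are disjoint and simple, and every other vertex of the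
    sample is isolated. So, numbering the edges, the ends of the [i]-th one
    correspond to the vertices 2i and 2i + 1 of [disjoint_edges]. *)
Lemma sampled_matching S : matching_sample S ->
  sampled G S = disjoint_edges (nb_in simpleE S).
Proof.
move=> /and3P[dB /forall_inP dbl /forall_inP chr].
have SV v : v \in S -> v \in V /\ G v v = 0%N.
  move=> vS; have := disjointFl dB vS; rewrite !inE => /negbT.
  by rewrite negb_or negbK -eqn0Ngt => /andP[-> /eqP].
pose ES := [set e in simpleE | inS S e]%SET.
have kE : nb_in simpleE S = #|ES|.
  rewrite /nb_in -sum1_card -big_mkcondr /=; apply: eq_bigl => e.
  by rewrite [RHS]inE.
have ESP e : e \in ES -> [/\ (e.1 < e.2)%N, e.1 \in S, e.2 \in S & G e.1 e.2 = 1%N].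
  move=> /setIdP[eE /andP[e1 e2]]; have eE' := eE.
  move: eE'; rewrite inE => /and4P[lt _ _ Ge]; split=> //; apply/eqP.
  rewrite eqn_leq Ge andbT leqNgt; apply/negP => G2.
  have : e \in doubleE by rewrite inE eE.
  by move=> /dbl; rewrite /inS e1 e2.
have ESmeet e f : e \in ES -> f \in ES -> touching e f -> e = f.
  move=> /setIdP[eE eS] /setIdP[fE fS] mef; apply/eqP/negPn/negP => nef.
  have : (e, f) \in cherries simpleE.
    by rewrite inE /= eE fE nef mef.
  by move=> /chr; rewrite /= eS fS.
have edge v w : v \in S -> w \in S -> (0 < G v w)%N ->
    exists e, [/\ e \in ES, (v == e.1) || (v == e.2) & (w == e.1) || (w == e.2)].
  move=> vS wS Gvw; have [vV v0] := SV _ vS; have [wV w0] := SV _ wS.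
  have : v != w by apply: contraTneq Gvw => ->; rewrite w0.
  rewrite neq_ltn => /orP[] lt; [exists (v, w)|exists (w, v)];
    rewrite /= !eqxx ?orbT !inE /inS /= lt vV wV vS wS ?Gvw //.
  by rewrite mgraphC Gvw.
set A := non_isolated G S.
have AP v : v \in A -> v \in S /\ exists2 w, w \in S & (0 < G v w)%N.
  by rewrite inE => /andP[-> /exists_inP].
have mkA v w : v \in S -> w \in S -> (0 < G v w)%N -> v \in A.
  by move=> vS wS Gvw; rewrite inE vS; apply/exists_inP; exists w.
rewrite kE; set k := #|ES|.
have half_lt (x : 'I_k.*2) : (x./2 < k)%N by rewrite ltn_half_double.
pose ed (x : 'I_k.*2) : 'I_n * 'I_n := enum_val (Ordinal (half_lt x)).
have edES x : ed x \in ES by exact: enum_valP.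
pose phi (x : 'I_k.*2) : 'I_n := if odd x then (ed x).2 else (ed x).1.
have phi_ed x : (phi x == (ed x).1) || (phi x == (ed x).2).
  by rewrite /phi; case: odd; rewrite eqxx ?orbT.
have ed_half x y : ed x = ed y -> x./2 = y./2 :> nat.
  by move=> /enum_val_inj /(congr1 val).
have half_ed (x y : 'I_k.*2) : x./2 = y./2 -> ed x = ed y.
  by move=> h; congr enum_val; apply: val_inj.
have touchingP v e f : (v == e.1) || (v == e.2) -> (v == f.1) || (v == f.2) -> touching e f.
  by rewrite /touching => /orP[]/eqP <- /orP[] ->; rewrite ?orbT.
have phi_inj : injective phi.
  move=> x y pxy; have exy : ed x = ed y.
    by apply: ESmeet => //; apply: (touchingP (phi x)) => //; rewrite pxy.
  have [lt _ _ _] := ESP _ (edES x).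
  have hxy := ed_half _ _ exy; apply: val_inj => /=.
  rewrite -[LHS]odd_double_half -[RHS]odd_double_half hxy.
  move: pxy; rewrite /phi -exy; case: odd; case: odd => // /(congr1 val) /= e;
    by move: lt; rewrite e ltnn.
have phiS x : phi x \in S.
  by rewrite /phi; have [_ ? ? _] := ESP _ (edES x); case: odd.
have phiA x : phi x \in A.
  have [_ s1 s2 G1] := ESP _ (edES x); rewrite /phi; case: odd.
    by apply: (mkA _ (ed x).1) => //; rewrite mgraphC G1.
  by apply: (mkA _ (ed x).2) => //; rewrite G1.
have phi_onto v : v \in A -> exists x, v = phi x.
  move=> /AP[vS [w wS Gvw]]; have [e [eES ve _]] := edge _ _ vS wS Gvw.
  pose i := enum_rank_in eES e; have ei : enum_val i = e by rewrite enum_rankK_in.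
  have lt0 : (i.*2 < k.*2)%N by rewrite ltn_double.
  have lt1 : (i.*2.+1 < k.*2)%N by rewrite ltn_Sdouble.
  have e0 : ed (Ordinal lt0) = e.
    by rewrite -ei; congr enum_val; apply: val_inj; rewrite /= doubleK.
  have e1 : ed (Ordinal lt1) = e.
    by rewrite -ei; congr enum_val; apply: val_inj; rewrite /= uphalf_double.
  case/orP: ve => /eqP ->; [exists (Ordinal lt0)|exists (Ordinal lt1)].
    by rewrite /phi e0 /= odd_double.
  by rewrite /phi e1 /= odd_double.
have Gphi x y : G (phi x) (phi y) = ((x != y) && (x./2 == y./2)) :> nat.
  have [->|xy] := eqVneq x y; first by have [_ ->] := SV _ (phiS y).
  have [hxy|hxy] /= := eqVneq x./2 y./2.
    have exy := half_ed _ _ hxy; have [_ _ _ G1] := ESP _ (edES x).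
    have : odd x != odd y.
      apply: contraNneq xy => oxy; apply/eqP/val_inj => /=.
      by rewrite -[LHS]odd_double_half -[RHS]odd_double_half hxy oxy.
    by rewrite /phi -exy; case: odd; case: odd => // _; rewrite // mgraphC.
  apply/eqP; rewrite -leqn0 leqNgt; apply/negP => Gxy.
  have [g [gES xg yg]] := edge _ _ (phiS x) (phiS y) Gxy.
  have gx : ed x = g by apply: ESmeet => //; exact: touchingP (phi_ed x) xg.
  have gy : ed y = g by apply: ESmeet => //; exact: touchingP (phi_ed y) yg.
  by move/eqP: hxy; apply; apply: ed_half; rewrite gx gy.
pose psi x : 'I_#|A| := enum_rank_in (phiA x) (phi x).
have psiK x : enum_val (psi x) = phi x by rewrite /psi enum_rankK_in.
rewrite /sampled -/A; apply/esym; apply: (@eq_unlabel _ _ _ _ psi).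
  apply: inj_card_bij.
    by move=> x y /(congr1 enum_val); rewrite !psiK; exact: phi_inj.
  rewrite !card_ord -[X in (_ <= X)%N]card_ord.
  apply: (@leq_trans #|[set phi x | x in 'I_k.*2]%SET|); last exact: leq_imset_card.
  apply/subset_leq_card/fintype.subsetP => v /phi_onto[x ->]; exact: imset_f.
by move=> i j; rewrite !mxE !psiK Gphi.
Qed.

Section bound.
Context {R : realType}.
Implicit Types (p t I M : R) (h : umgraph -> R).

Lemma umgraph_bound_ge0 M h : (forall H, `|h H| <= M) -> 0 <= M.
Proof. by move/(_ (disjoint_edges 0)); exact: le_trans. Qed.

(** The first line of the bound is a union bound on the probability that the
    sample is not a matching, the second the distance from the number of its
    edges to a Poisson variable. *)
Lemma Smpl_poisson_bound p t I M h : 0 <= p -> p <= 1 -> 0 <= I ->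
  (forall H, `|h H| <= M) ->
  `|Smpl G p h - GP_isolated I t h| <=
  2 * M * (p * #|badV|%:R + p ^+ 2 * #|doubleE|%:R + p ^+ 3 * #|cherries simpleE|%:R) +
  2 * M * expR (t ^+ 2 * I) * (`|t ^+ 2 * I - p ^+ 2 * #|simpleE|%:R| +
     2 * (p ^+ 3 * #|cherries simpleE|%:R +
          p ^+ 4 * (#|cherries simpleE| + #|simpleE|)%:R)).
Proof.
move=> p0 p1 I0 hM; have M0 := umgraph_bound_ge0 hM.
pose k k' := h (disjoint_edges k'); have kM k' : `|k k'| <= M by exact: hM.
have l0 : 0 <= t ^+ 2 * I by rewrite mulr_ge0 ?sqr_ge0.
have := poisson_approx p0 p1 l0 (@simple_edges_lt n G V) kM; move=> app.
have -> : Smpl G p h - GP_isolated I t h =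
   bern p (fun S => h (sampled G S) - k (nb_in simpleE S)) +
   (bern p (fun S => k (nb_in simpleE S)) - GP_isolated I t h).
  by rewrite bernB addrA subrK.
apply: le_trans (ler_normD _ _) _; apply: lerD; last exact: app.
apply: le_trans (ler_norm_bern _ p0 p1) _.
apply: (@le_trans _ _ (bern p (fun S => 2 * M *
   (\sum_(v in badV) (v \in S)%:R +
    \sum_(e in doubleE) (inS S e)%:R +
    \sum_(ef in cherries simpleE) (inS S ef.1)%:R * (inS S ef.2)%:R)))).
  apply: ler_bern => // S; have [mS|mS] := boolP (matching_sample S).
    rewrite sampled_matching // subrr normr0 mulr_ge0 ?mulr_ge0 //.
    by rewrite !addr_ge0 // sumr_ge0 // => *; rewrite mulr_ge0.
  apply: (@le_trans _ _ (2 * M * 1)).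
    rewrite mulr1 mulr_natl mulr2n; apply: le_trans (ler_normB _ _) _.
    by rewrite lerD.
  rewrite ler_wpM2l ?mulr_ge0 // -!natr_sum.
  under [X in _ + X]eq_bigr do rewrite -natrM.
  rewrite -natr_sum -!natrD ler1n; move: mS; rewrite !negb_and => /or3P[].
  - rewrite -setI_eq0 => /set0Pn[v /setIP[vB vS]].
    by rewrite (bigD1 v) //= vS.
  - move=> /forall_inPn[e eD]; rewrite negbK => eS.
    by rewrite addn_gt0 addn_gt0 [X in _ || (0 < X)%N || _](bigD1 e) //= eS orbT.
  - move=> /forall_inPn[ef efC]; rewrite negbK => /andP[e1 e2].
    by rewrite addn_gt0 [X in _ || (0 < X)%N](bigD1 ef) //= e1 e2 orbT.
rewrite bernZ ler_wpM2l ?mulr_ge0 // !bernD !bern_sum; apply: lerD; first apply: lerD.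
- rewrite mulr_natr -sumr_const; apply: ler_sum => v _.
  by rewrite bern_in.
- rewrite mulr_natr -sumr_const; apply: ler_sum => e /setIdP[/(@simple_edges_lt n G V) lt _].
  have ne : e.1 != e.2 by rewrite neq_ltn lt.
  have := bern_mem2 p (fun=> 1) ne; rewrite bern_cst mulr1 => <-.
  by rewrite le_eqVlt; apply/orP; left; apply/eqP; apply: eq_bern => S;
    rewrite mulr1 /inS -mulnb natrM.
- rewrite mulr_natr -sumr_const; apply: ler_sum => -[e f] ef.
  exact: bern_cherry p0 p1 (@simple_edges_lt n G V) ef.
Qed.

End bound.

(** A cherry consists of two of the at most [D v] edges at a common vertex
    [v]. *)
Lemma card_cherries (D : 'I_n -> nat) :
  (forall v, (#|[set w | (w != v) && (0 < G v w)%N]%SET| <= D v)%N) ->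
  (#|cherries simpleE| <= \sum_(v in V) D v ^ 2)%N.
Proof.
move=> degD; pose inc v := [set e in simpleE | (v == e.1) || (v == e.2)]%SET.
have incD v : (#|inc v| <= D v)%N.
  apply: leq_trans (degD v); pose other (e : 'I_n * 'I_n) := if v == e.1 then e.2 else e.1.
  rewrite -(@card_in_imset _ _ other (inc v)).
    apply/subset_leq_card/fintype.subsetP => w /imsetP[e + ->]; rewrite !inE => /andP[/and4P[lt _ _ Ge] ve].
    rewrite /other; move: ve; case: (eqVneq v e.1) => [-> _|_ /= /eqP ->].
      by rewrite Ge neq_ltn lt orbT.
    by rewrite mgraphC Ge neq_ltn lt.
  move=> [a b] [c d]; rewrite !inE /other /= => /andP[/and4P[ab _ _ _] +] /andP[/and4P[cd _ _ _] +].
  case: (eqVneq v a) => [va _|_ /= /eqP vb]; case: (eqVneq v c) => [vc _|_ /= /eqP vd] e; subst => //.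
    by have := ltn_trans ab cd; rewrite ltnn.
  by have := ltn_trans ab cd; rewrite ltnn.
apply: (@leq_trans (\sum_(v in V) #|finset.setX (inc v) (inc v)|)%N); last first.
  by apply: leq_sum => v _; rewrite finset.cardsX leq_mul.
apply: (@leq_trans #|\bigcup_(v in V) finset.setX (inc v) (inc v)|%SET); last first.
  elim/big_rec2: _ => [|v s U _ IH]; first by rewrite cards0.
  apply: leq_trans (leq_card_setU _ _) _; by rewrite leq_add2l.
apply/subset_leq_card/fintype.subsetP => -[e f]; rewrite inE /= => /and4P[eE fE _ mef].
have : exists v, [/\ v \in V, (v == e.1) || (v == e.2) & (v == f.1) || (v == f.2)].
  move: (eE); rewrite inE => /and4P[_ e1 e2 _].
  by case/or4P: mef => /eqP h; [exists e.1|exists e.1|exists e.2|exists e.2];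
    rewrite ?e1 ?e2 ?h ?eqxx ?orbT.
move=> [v [vV ve vf]]; apply/finset.bigcupP; exists v => //.
by rewrite finset.in_setX !inE in eE fE *; rewrite eE fE ve vf.
Qed.

End sparse.

(** * Sampling a typical graph *)

Section typical_event.
Context {R : realType} (n : nat) (d : nat -> nat).
Local Notation N := ((ell n d)%:R : R).
Implicit Types (eps : R).

(** The counts that determine the law of a sample up to O(eps). Double edges are
    counted twice in [typ_double], so together with [typ_simple] it says both that
    there are O(eps N) of them and that the number of adjacent pairs of small
    vertices is known up to O(eps N). *)
Record typical eps (G : mgraph n) : Prop := Typical {
  typ_edges : N - 2 * (nb_edges G)%:R <= eps * N ;
  typ_edges_le : 2 * (nb_edges G)%:R <= N ;
  typ_loops : #|(small_vertices n d eps :&: loopy G)%SET|%:R <=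
    4 * eps * Num.sqrt N ;
  typ_simple : (((degsum d (small_vertices n d eps))%:R / N) ^+ 2 / 2 - 4 * eps) * N <=
    #|simple_edges G (small_vertices n d eps)|%:R ;
  typ_double : #|simple_edges G (small_vertices n d eps)|%:R +
      #|double_edges G (small_vertices n d eps)|%:R <=
    (((degsum d (small_vertices n d eps))%:R / N) ^+ 2 / 2 + eps) * N ;
  typ_degree : forall v,
    (#|[set w | (w != v) && (0 < G v w)%N]%SET| <= d v)%N }.

Definition atypical eps : set (mgraph n) := fun G => ~ typical eps G.

Lemma expR_le_inv_sqr (x : R) : 0 < x -> expR (- x) <= 2 / x ^+ 2.
Proof.
move=> x0; have x2 : 0 < x ^+ 2 by rewrite exprn_gt0.
rewrite expRN -[leRHS]invf_div lef_pV2 ?posrE ?expR_gt0 ?divr_gt0 //.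
have := @expR_ge1Dxn R x 1 (ltW x0); apply: le_trans.
by rewrite lerDr.
Qed.

(** Union bound. Only summability in [n] matters later, so the exponential tails
    are weakened to the order N^-2 of [small_loops_tail]. *)
Lemma CM_law_atypical eps D : 0 < eps -> eps <= 1 ->
  1 <= eps * Num.sqrt N -> 8 <= Num.sqrt N ->
  (forall i : 'I_n, (d i <= D)%N) -> 4 * D%:R <= eps * N ->
  CM_law d (atypical eps) <=
    (256 / eps ^+ 4 + 6 / ((eps / 4) ^+ 2 / 32) ^+ 2) / N ^+ 2.
Proof.
move=> e0 e1 eN N8 dD De; set c := (eps / 4) ^+ 2 / 32.
have c0 : 0 < c by rewrite divr_gt0 // exprn_gt0 // divr_gt0.
have cE : c <= eps ^+ 2 / 32 by rewrite /c; have := sqr_ge0 eps; lra.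
have e40 : 0 < eps ^+ 4 by rewrite exprn_gt0.
set V := small_vertices n d eps.
have sqN : Num.sqrt N * Num.sqrt N = N by rewrite -expr2 sqr_sqrtr.
have N64 : 64 <= N by rewrite -sqN; nra.
have N0 : 0 < N by lra.
have N8' : (8 <= ell n d)%N by rewrite -(ler_nat R); lra.
have N1 : (1 < ell n d)%N by lia.
have eN' : 1 <= eps * N by rewrite -sqN; nra.
set pm := perfect_matchings n d.
have [pm0|pm0] := posnP #|pm|.
  rewrite /CM_law -/pm pm0 invr0 mulr0; apply: divr_ge0; last exact: sqr_ge0.
  apply: addr_ge0; apply: divr_ge0; first exact: ler0n.
  - exact: ltW.
  - exact: ler0n.
  - exact: sqr_ge0.
have pm1 : 0 < #|pm|%:R :> R by rewrite ltr0n.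
rewrite /CM_law -/pm ler_pdivrMr // mulrC.
have ta := many_loops_tail e0 e1 N1 dD De.
have tb := small_loops_tail e0 e1 eN N8.
have tc := simple_edges_tail e0 e1 N8' eN'.
have td := edge_pairs_tail V e0 e1 N1.
rewrite -/pm -/V in ta tb tc td.
set A1 := [set M in pm | _]%SET in ta; set A2 := [set M in pm | _]%SET in tb.
set A3 := [set M in pm | _]%SET in tc; set A4 := [set M in pm | _]%SET in td.
have sub : (#|[set M in pm | `[< atypical eps (cm_graph M) >]]%SET| <=
    #|A1| + #|A2| + #|A3| + #|A4|)%N.
  apply: (@leq_trans #|(A1 :|: A2 :|: A3 :|: A4)%SET|); last first.
    by do 3!(apply: leq_trans (leq_card_setU _ _) _; rewrite leq_add2r).
  apply/subset_leq_card/fintype.subsetP => M; rewrite inE => /andP[Mpm /asboolP nt].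
  have memA (Q : pred {set {set half_edge n d}}) :
      (M \in [set M' in pm | Q M']%SET) = Q M by rewrite inE Mpm.
  rewrite !finset.in_setU /A1 /A2 /A3 /A4 !memA.
  apply: contra_notT nt; rewrite !negb_or -!leNgt -!ltNge.
  move=> /andP[/andP[/andP[h1 h2] h3] h4]; split => //.
  - by rewrite -natrM ler_nat -(nb_edges_cm Mpm) leq_addr.
  - exact: ltW.
  - apply: le_trans (ltW h4); rewrite -natrD ler_nat; exact: card_simple_double.
  - by move=> v; exact: simple_degree_cm.
apply: le_trans (_ : (#|A1| + #|A2| + #|A3| + #|A4|)%:R <= _).
  by rewrite ler_nat.
have N20 : 0 < N ^+ 2 by rewrite exprn_gt0.
pose E : R := 2 / c ^+ 2 / N ^+ 2.
have expE : expR (- c * N) <= E.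
  rewrite mulNr; apply: le_trans (expR_le_inv_sqr (mulr_gt0 c0 N0)) _.
  by rewrite /E exprMn invfM mulrA.
have expE' : expR (- (eps ^+ 2 / 32) * N) <= E.
  by apply: le_trans expE; rewrite ler_expR !mulNr lerN2 ler_wpM2r ?(ltW N0).
have pE := ler_wpM2l (ltW pm1) expE; have pE' := ler_wpM2l (ltW pm1) expE'.
rewrite !natrD mulrDl mulrDr.
have -> : 6 / c ^+ 2 / N ^+ 2 = 3 * E by rewrite /E; field; rewrite !gt_eqF.
move: tb; rewrite invfM mulrA => tb.
rewrite -/c in ta; lra.
Qed.

(** All error terms of [Smpl_poisson_bound] are of order delta, because p is of
    order t / sqrt N: there are O(delta sqrt N) bad vertices, O(delta N) double
    edges and at most delta sqrt N * N cherries, the latter since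
    d_v^2 <= delta sqrt N d_v at a small vertex. *)
Lemma typical_sampling (G : mgraph n) (delta b t M : R) (h : umgraph -> R)
    (V := small_vertices n d delta) :
  0 < t -> 0 < delta -> delta <= 2^-1 -> typical delta G ->
  (forall H, `|h H| <= M) ->
  0 <= b -> b <= 1 -> `|b - (degsum d V)%:R / N| <= delta ->
  #|(~: V)%SET|%:R <= delta * Num.sqrt N -> 1 <= delta * N -> 2 * t ^+ 2 <= N ->
  `|Smpl G (Num.min 1 (t / Num.sqrt (2 * (nb_edges G)%:R))) h
     - GP_isolated (b ^+ 2 / 2) t h| <=
  (2 * M * (10 * t + 10 * t ^+ 2 + 8 * t ^+ 3) +
   2 * M * expR (t ^+ 2) * (7 * t ^+ 2 + 32 * t ^+ 3 + 8 * t ^+ 4)) * delta.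
Proof.
move=> t0 de0 de2 [Te Te' Tl Ts Td Tg] hM b0 b1 bV cV dN tN.
rewrite -/V in Tl Ts Td.
set e := (nb_edges G)%:R in Te Te' *.
set s := Num.sqrt N in cV Tl.
have M0 := umgraph_bound_ge0 hM.
have ss : s * s = N by rewrite -expr2 sqr_sqrtr.
have N0 : 0 < N by nra.
have s0 : 0 < s by rewrite sqrtr_gt0.
have e0 : 0 < e by nra.
have e2N : N / 2 <= 2 * e by nra.
set q := Num.sqrt (2 * e).
have qq : q ^+ 2 = 2 * e by rewrite sqr_sqrtr // mulr_ge0 // ltW.
have q0 : 0 < q by rewrite sqrtr_gt0; lra.
have tq1 : t / q <= 1.
  rewrite ler_pdivrMr // mul1r -(ler_pXn2r (n:=2)) ?nnegrE ?(ltW t0) ?(ltW q0) //.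
  by rewrite qq; lra.
have -> : Num.min 1 (t / q) = t / q by exact/min_idPr.
set p := t / q.
have p0 : 0 < p by rewrite divr_gt0.
have p2 : p ^+ 2 * (2 * e) = t ^+ 2 by rewrite /p expr_div_n -qq divfK // sqrf_eq0 gt_eqF.
rewrite -/p in tq1; clearbody p.
have I0 : 0 <= b ^+ 2 / 2 by rewrite divr_ge0 // sqr_ge0.
apply: le_trans (Smpl_poisson_bound G V t (ltW p0) tq1 I0 hM) _.
have p2N : p ^+ 2 * N <= 2 * t ^+ 2.
  by rewrite -p2; have := ler_wpM2l (sqr_ge0 p) e2N; lra.
have t2 := sqr_ge0 t.
have ps : p * s <= 2 * t.
  rewrite -(ler_pXn2r (n:=2)) ?nnegrE ?mulr_ge0 ?(ltW p0) ?(ltW s0) ?(ltW t0) //.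
  by rewrite (_ : (p * s) ^+ 2 = p ^+ 2 * N); [lra|rewrite -ss; ring].
set kap : R := #|bad_vertices G V|%:R; set Dn : R := #|double_edges G V|%:R in Td *.
set m : R := #|simple_edges G V|%:R in Ts Td *.
set C : R := #|cherries (simple_edges G V)|%:R; rewrite natrD -/m -/C.
set be := (degsum d V)%:R / N in bV Ts Td.
have sN : (degsum d V)%:R <= N by rewrite ler_nat degsum_le.
have be0 : 0 <= be by rewrite divr_ge0.
have be1 : be <= 1 by rewrite ler_pdivrMr // mul1r.
have T1 : p * kap <= 10 * t * delta.
  have : kap <= delta * s + 4 * delta * s.
    apply: le_trans (lerD cV Tl); rewrite -natrD ler_nat /bad_vertices.
    rewrite (_ : (~: V :|: loopy G = ~: V :|: (V :&: loopy G))%SET) ?leq_card_setU //.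
    by apply/finset.setP => v; rewrite !inE; case: (_ <= _).
  move=> k5; apply: (@le_trans _ _ (p * (5 * delta * s))).
    by rewrite ler_wpM2l ?(ltW p0) //; lra.
  by rewrite (_ : p * _ = 5 * delta * (p * s)); [nra|ring].
have ps0 : 0 <= p * s by rewrite mulr_ge0 ?ltW.
have p2Nt : `|t ^+ 2 - p ^+ 2 * N| <= 2 * t ^+ 2 * delta.
  rewrite -p2 ler0_norm; last by rewrite -mulrBr mulr_ge0_le0 ?sqr_ge0 //; lra.
  have h1 := ler_wpM2l (sqr_ge0 p) Te; have h2 := ler_wpM2r (ltW de0) p2N.
  have h3 := ler_wpM2r (ltW de0) (ler_wpM2l (sqr_ge0 p) e2N).
  lra.
have T2 : p ^+ 2 * Dn <= 10 * t ^+ 2 * delta.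
  have Dn5 : Dn <= 5 * delta * N by lra.
  have h1 := ler_wpM2l (sqr_ge0 p) Dn5; have h2 := ler_wpM2r (ltW de0) p2N.
  lra.
have C_le : C <= delta * s * N.
  have := card_cherries V Tg; rewrite -(ler_nat R) -/C => /le_trans; apply.
  rewrite natr_sum; apply: (@le_trans _ _ (\sum_(v in V) delta * s * (d v)%:R)).
    apply: ler_sum => v; rewrite inE => vV; rewrite natrX expr2 ler_wpM2r //.
  by rewrite -mulr_sumr -natr_sum ler_wpM2l // mulr_ge0 ?ltW.
have T3 : p ^+ 3 * C <= 8 * t ^+ 3 * delta.
  have h1 : p ^+ 3 * C <= p ^+ 3 * (delta * s * N).
    by rewrite ler_wpM2l // exprn_ge0 // ltW.
  have h2 : (p * s) ^+ 3 <= (2 * t) ^+ 3.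
    by rewrite lerXn2r ?nnegrE // mulr_ge0 // ltW.
  have -> : 8 * t ^+ 3 * delta = (2 * t) ^+ 3 * delta by ring.
  apply: le_trans h1 _; rewrite -ss (_ : p ^+ 3 * _ = (p * s) ^+ 3 * delta); last by ring.
  by rewrite ler_wpM2r // ltW.
have C0 : 0 <= C by []. have m0 : 0 <= m by []. have Dn0 : 0 <= Dn by [].
have mN : m <= N.
  have : be ^+ 2 <= 1 by rewrite expr_le1.
  move=> be2; have : (be ^+ 2 / 2 + delta) * N <= 1 * N by rewrite ler_wpM2r ?(ltW N0) //; lra.
  lra.
have T4 : p ^+ 4 * (C + m) <= 8 * t ^+ 3 * delta + 4 * t ^+ 4 * delta.
  rewrite mulrDr lerD //.
    apply: le_trans T3; rewrite exprS -mulrA ler_piMl //; apply: mulr_ge0 => //; apply: exprn_ge0; exact: ltW.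
  have h1 : (p ^+ 2 * N) ^+ 2 <= (2 * t ^+ 2) ^+ 2.
    by rewrite lerXn2r // nnegrE; apply: mulr_ge0 => //; exact: sqr_ge0.
  have p40 : 0 <= p ^+ 4 by rewrite exprn_ge0 // ltW.
  apply: (@le_trans _ _ ((p ^+ 2 * N) ^+ 2 * delta)).
    rewrite (_ : (p ^+ 2 * N) ^+ 2 * delta = p ^+ 4 * (N * (delta * N))); last by ring.
    rewrite ler_wpM2l //; apply: le_trans mN _; by rewrite ler_peMr // ltW.
  have -> : 4 * t ^+ 4 * delta = (2 * t ^+ 2) ^+ 2 * delta by ring.
  by rewrite ler_wpM2r // ltW.
have T5 : `|t ^+ 2 * (b ^+ 2 / 2) - p ^+ 2 * m| <= 7 * t ^+ 2 * delta.
  pose mu := m / N; have mE : m = mu * N by rewrite /mu divfK // gt_eqF.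
  have mu0 : 0 <= mu by rewrite divr_ge0.
  have mu1 : mu <= 1 by rewrite ler_pdivrMr // mul1r.
  have bb : `|b ^+ 2 - be ^+ 2| <= 2 * delta.
    rewrite subr_sqr normrM mulrC; apply: ler_pM => //.
    by rewrite ger0_norm ?addr_ge0 //; lra.
  have bemu : `|be ^+ 2 / 2 - mu| <= 4 * delta.
    move: Ts Td; rewrite mE => Ts Td; rewrite ler_norml.
    rewrite -(ler_pM2r N0 (- _)) -(ler_pM2r N0 (_ - _)).
    by apply/andP; split; lra.
  rewrite (_ : _ - _ = t ^+ 2 * ((b ^+ 2 - be ^+ 2) / 2) + t ^+ 2 * (be ^+ 2 / 2 - mu) +
     (t ^+ 2 - p ^+ 2 * N) * mu); last by rewrite mE; field.
  apply: le_trans (ler_normD _ _) _; apply: (@le_trans _ _ (5 * t ^+ 2 * delta + 2 * t ^+ 2 * delta)); last by lra.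
  apply: lerD.
    apply: le_trans (ler_normD _ _) _; rewrite !normrM !(gtr0_norm t0).
    have -> : `|2^-1| = 2^-1 :> R by rewrite ger0_norm // invr_ge0.
    have h1 := ler_wpM2l t2 bb; have h2 := ler_wpM2l t2 bemu; lra.
  rewrite normrM (ger0_norm mu0); apply: le_trans (_ : `|t ^+ 2 - p ^+ 2 * N| * 1 <= _).
    by rewrite ler_wpM2l.
  by rewrite mulr1.
have expb : expR (t ^+ 2 * (b ^+ 2 / 2)) <= expR (t ^+ 2).
  rewrite ler_expR ler_piMr //; have : b ^+ 2 <= 1 by rewrite expr_le1.
  by lra.
rewrite [leRHS]mulrDl; apply: lerD.
  rewrite -[leRHS]mulrA ler_wpM2l ?mulr_ge0 //; lra.
rewrite -[leLHS]mulrA -[leRHS]mulrA -[leRHS]mulrA ler_wpM2l ?mulr_ge0 //.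
apply: ler_pM; rewrite ?expR_ge0 //.
  have p30 : 0 <= p ^+ 3 * C by rewrite mulr_ge0 // exprn_ge0 // ltW.
  have p40 : 0 <= p ^+ 4 * (C + m).
    by rewrite mulr_ge0 ?addr_ge0 // exprn_ge0 // ltW.
  by apply: addr_ge0; [exact: normr_ge0|lra].
lra.
Qed.

End typical_event.

(** * Almost sure statements for independent configuration models *)

Section product_law.
Context {R : realType} (d : nat -> nat -> nat) (P : probability mgraph_seq R).
Hypothesis P_CM : is_P_CM d P.
Implicit Types (A : forall n, set (mgraph n)).

Lemma measurable_coord n (B : set (mgraph n)) :
  measurable [set G : mgraph_seq | B (G n)].
Proof. by apply: sub_sigma_algebra; exists n, B. Qed.

(** The product measure has total mass 1, which forces every factor to have mass
    1; so perfect matchings exist. *)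
Lemma CM_law_setT m : CM_law (d m) [set: mgraph m] = 1 :> R.
Proof.
have prod1 k : \prod_(i < k) CM_law (d i) [set: mgraph i] = 1 :> R.
  apply: EFin_inj; rewrite -(P_CM k (fun=> setT)) -[RHS](probability_setT P).
  by congr (P _); apply/seteqP; split.
by have := prod1 m.+1; rewrite big_ord_recr /= prod1 mul1r.
Qed.

Lemma P_coord n (B : set (mgraph n)) :
  P [set G : mgraph_seq | B (G n)] = (CM_law (d n) B)%:E.
Proof.
(* The event [B] at coordinate [n] and the full space at all others; the cast
   along [m = n] lets one family of sets say both. *)
pose B' m : set (mgraph m) := [set G | forall e : m = n, B (ecast k (mgraph k) e G)].
have B'n : B' n = B.
  by apply/seteqP; split => G BG; [exact: (BG erefl)|move=> e; rewrite eq_axiomK].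
transitivity (P [set G : mgraph_seq | forall m, (m < n.+1)%N -> B' m (G m)]).
  congr (P _); apply/seteqP; split => G /= BG.
    by move=> m _ e; subst m.
  by have := BG n (ltnSn n) erefl.
rewrite P_CM big_ord_recr /= B'n big1 ?mul1r // => m _.
rewrite -[RHS](CM_law_setT m); congr (CM_law _ _); apply/seteqP; split => // G _ e.
by exfalso; have : (n < n)%N; [rewrite -{1}e ltn_ord|rewrite ltnn].
Qed.

Lemma CM_law_ge0 n (B : set (mgraph n)) : 0 <= CM_law (d n) B :> R.
Proof. by rewrite -lee_fin -P_coord. Qed.

Lemma not_eventuallyE A : ~` [set G : mgraph_seq | \forall n \near \oo, ~ A n (G n)] =
  lim_sup_set (fun n => [set G : mgraph_seq | A n (G n)]).
Proof.
apply/seteqP; split => G /= h.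
  move=> n _; apply: contrapT => nex; apply: h; exists n => // m /= nm Am.
  by apply: nex; exists m.
move=> [n _ hn]; have [m nm Am] := h n I.
exact: (hn m nm Am).
Qed.

(** The sum of 1 / ((n + 1) (n + 2)) telescopes to 1. *)
Lemma borel_cantelli_CM A (C : R) :
  (\forall n \near \oo, CM_law (d n) (A n) <= C / (n.+1%:R * n.+2%:R)) ->
  {ae P, forall G : mgraph_seq, \forall n \near \oo, ~ A n (G n)}.
Proof.
move=> [n0 _ hn0]; pose A' n : set (mgraph n) := if (n0 <= n)%N then A n else set0.
have C0 : 0 <= C.
  have := le_trans (CM_law_ge0 _) (hn0 n0 (leqnn _)).
  by rewrite pmulr_lge0 // invr_gt0 mulr_gt0.
have law_le n : CM_law (d n) (A' n) <= C / (n.+1%:R * n.+2%:R) :> R.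
  rewrite /A'; case: ifP => [|_]; first exact: hn0.
  rewrite /CM_law (_ : #|_| = 0%N) ?mul0r ?divr_ge0 ?mulr_ge0 //.
  by apply: eq_card0 => M; rewrite inE; apply/negP => /andP[_ /asboolP].
pose F n := [set G : mgraph_seq | A' n (G n)].
have mF n : measurable (F n) by exact: measurable_coord.
have F0 : P (lim_sup_set F) = 0%E.
  apply: lim_sup_set_cvg0 => //; apply: (@le_lt_trans _ _ C%:E); last exact: ltry.
  apply: lime_le; first by apply: is_cvg_nneseries.
  apply: nearW => K; rewrite (eq_bigr (fun n => (CM_law (d n) (A' n))%:E)); last first.
    by move=> n _; rewrite -P_coord.
  rewrite sumEFin lee_fin; apply: (@le_trans _ _ (C * (1 - K.+1%:R^-1))); last first.
    by rewrite ler_piMr // lerBlDr lerDl invr_ge0.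
  elim: K => [|K IH]; first by rewrite big_nil invr1 subrr mulr0.
  rewrite big_nat_recr //=; apply: le_trans (lerD IH (law_le K)) _.
  rewrite -mulrDr ler_wpM2l //.
  rewrite (_ : (K.+1%:R * K.+2%:R)^-1 = K.+1%:R^-1 - K.+2%:R^-1 :> R); first by rewrite addrA subrK.
  rewrite -[K.+2%:R]natr1; move: (ltr0Sn R K); set x := K.+1%:R => x0.
  by field; rewrite !gt_eqF //; lra.
suff : P.-negligible (~` [set G : mgraph_seq | \forall n \near \oo, ~ A n (G n)]) by [].
rewrite (not_eventuallyE A).
apply: negligibleS (_ : P.-negligible (lim_sup_set F)).
  move=> G h n _; have [m /= nm Am] := h (maxn n n0) I.
  exists m; first by rewrite /= (leq_trans (leq_maxl _ _) nm).
  by rewrite /F /= /A' (leq_trans (leq_maxr _ _) nm).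
apply/negligibleP => //; apply: bigcapT_measurable => n.
by apply: bigcup_measurable => m _.
Qed.

(** By continuity from above, the event that infinitely many [A n] occur has
    probability at least [c]. *)
Lemma not_eventually_CM A (c : R) : 0 < c ->
  (forall n0, exists2 n, (n0 <= n)%N & c <= CM_law (d n) (A n)) ->
  ~ {ae P, forall G : mgraph_seq, \forall n \near \oo, ~ A n (G n)}.
Proof.
move=> c0 often; pose F n := [set G : mgraph_seq | A n (G n)].
have mF n : measurable (F n) by exact: measurable_coord.
have mU n : measurable (\bigcup_(k >= n) F k) by exact: bigcup_measurable.
move=> ae; have neg : P.-negligible
    (~` [set G : mgraph_seq | \forall n \near \oo, ~ A n (G n)]) := ae.
rewrite (not_eventuallyE A) in neg.
have F0 : P (lim_sup_set F) = 0%E.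
  by apply/negligibleP => //; exact: bigcapT_measurable.
have Uoo : (P (\bigcup_(k >= 0) F k) < +oo)%E.
  by apply: le_lt_trans (probability_le1 _ (mU 0%N)) _; exact: ltry.
have cv := lim_sup_set_cvg P F mF Uoo.
have : (c%:E <= P (lim_sup_set F))%E.
  rewrite -(cvg_lim _ cv) //; apply: lime_ge; first by apply/cvg_ex; eexists; exact: cv.
  apply: nearW => n0; have [n n0n cn] := often n0.
  apply: (@le_trans _ _ (P (F n))); first by rewrite /F P_coord lee_fin.
  apply: le_measure; rewrite ?inE //.
  by move=> G FG; exists n.
by rewrite F0 lee_fin leNgt c0.
Qed.

End product_law.

(** * The degree measures *)

Section one_degree_measure.
Context {R : realType} (n : nat) (d : nat -> nat).
Hypothesis d_gt0 : forall i, (i < n)%N -> (0 < d i)%N.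
Local Notation N := ((ell n d)%:R : R).
Local Notation s := (Num.sqrt N).

Lemma ell_ge : (n <= ell n d)%N.
Proof.
rewrite -{1}(card_ord n) -sum1_card /ell; apply: leq_sum => i _; exact: d_gt0.
Qed.

Lemma integral_rho (f : R -> R) :
  measurable_fun (`]0, +oo[ : set R) f -> (forall x, 0 <= f x) ->
  (\int[rho_ n d]_(x in `]0%R, +oo[) (f x)%:E =
     ((\sum_(i < n) f ((d i)%:R / s)) / s)%:E)%E.
Proof.
move=> /measurable_EFinP mf f0.
have mD : measurable (`]0%R, +oo[ : set R) by exact: measurable_itv.
rewrite /rho_ ge0_integral_mscale //; last by move=> x _; rewrite lee_fin.
rewrite ge0_integral_measure_sum //; last by move=> x _; rewrite lee_fin.
rewrite (eq_bigr (fun i : 'I_n => (f ((d i)%:R / s))%:E)).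
  by rewrite sumEFin -EFinM mulrC.
move=> i _; rewrite integral_dirac // diracE mem_set ?mul1e //=.
rewrite in_itv /= andbT divr_gt0 // ?ltr0n ?d_gt0 // sqrtr_gt0 ltr0n.
exact: leq_ltn_trans (leq0n i) (leq_trans (ltn_ord i) ell_ge).
Qed.

Lemma int_min1E :
  int_min1 (rho_ n d) = (\sum_(i < n) Num.min ((d i)%:R / s) 1) / s :> R.
Proof.
rewrite /int_min1 /Rintegral.
(* The positive part makes the integrand nonnegative on the whole line. *)
transitivity (fine (\int[rho_ n d]_(x in `]0%R, +oo[) (Num.max 0 (Num.min x 1) : R)%:E)).
  congr fine; apply: eq_integral => x; rewrite inE /= in_itv /= andbT => x0.
  congr EFin; apply/esym/max_idPr; rewrite le_min ltW //= ler01.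
rewrite integral_rho /=.
- congr (_ / _); apply: eq_bigr => i _; apply/max_idPr.
  by rewrite le_min divr_ge0 //= ?sqrtr_ge0 // ler01.
- by apply: measurable_maxr => //; exact: measurable_minr.
- by move=> x; rewrite le_max lexx.
Qed.

Lemma int_min1_ge0 : 0 <= int_min1 (rho_ n d) :> R.
Proof.
by rewrite int_min1E divr_ge0 ?sqrtr_ge0 // sumr_ge0.
Qed.

Lemma int_min1_le1 : int_min1 (rho_ n d) <= 1 :> R.
Proof.
rewrite int_min1E; have [N0|N0] := eqVneq (ell n d) 0%N.
  by rewrite N0 sqrtr0 invr0 mulr0 ler01.
have s0 : 0 < s by rewrite sqrtr_gt0 ltr0n lt0n.
rewrite ler_pdivrMr // mul1r; apply: (@le_trans _ _ (\sum_(i < n) (d i)%:R / s)).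
  by apply: ler_sum => i _; rewrite ge_min lexx.
by rewrite -mulr_suml -natr_sum ler_pdivrMr // -expr2 sqr_sqrtr.
Qed.

(** At a small vertex min(x, 1) = x, so these vertices contribute [degsum] / N; a
    large one contributes at most 1 / sqrt N. *)
Lemma int_min1_small (delta : R) : 0 < delta -> delta <= 1 ->
  `|int_min1 (rho_ n d) - (degsum d (small_vertices n d delta))%:R / N| <=
  #|(~: small_vertices n d delta)%SET|%:R / s :> R.
Proof.
move=> de0 de1; set V := small_vertices n d delta.
have [N0|N0] := eqVneq (ell n d) 0%N.
  by rewrite int_min1E N0 sqrtr0 invr0 !mulr0 subrr normr0.
have s0 : 0 < s by rewrite sqrtr_gt0 ltr0n lt0n.
have sN : s * s = N by rewrite -expr2 sqr_sqrtr.
have NE : N^-1 = s^-1 * s^-1 by rewrite -invfM sN.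
have -> : int_min1 (rho_ n d) - (degsum d V)%:R / N =
    (\sum_(i in (~: V)%SET) Num.min ((d i)%:R / s) 1) / s.
  rewrite int_min1E (bigID (mem V)) /= mulrDl addrAC.
  rewrite (eq_bigr (fun i : 'I_n => (d i)%:R / s)); last first.
    move=> i; rewrite inE => iV; apply/min_idPl; rewrite ler_pdivrMr // mul1r.
    by apply: (le_trans iV); rewrite ler_piMl // ltW.
  rewrite -mulr_suml -natr_sum -/(degsum d V) NE mulrA subrr add0r.
  by congr (_ / _); apply: eq_bigl => i; rewrite !inE.
rewrite normrM normfV (gtr0_norm s0) ler_pM2r ?invr_gt0 // ger0_norm; last first.
  by apply: sumr_ge0 => i _; rewrite le_min divr_ge0 ?(ltW s0) //= ler01.
rewrite -sum1_card natr_sum; apply: ler_sum => i _.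
by rewrite ge_min lexx orbT.
Qed.

End one_degree_measure.

Section degree_measures.
Context {R : realType} (d : nat -> nat -> nat).
Hypothesis d_gt0 : forall n i, (i < n)%N -> (0 < d n i)%N.
Local Notation N n := ((ell n (d n))%:R : R).
Local Notation s n := (Num.sqrt (N n)).

(** The mass that [rho_ n] gives to (eps, +oo). *)
Definition large_density (eps : R) (n : nat) : R :=
  #|(~: small_vertices n (d n) eps)%SET|%:R / s n.

Lemma large_density_ge0 (eps : R) n : 0 <= large_density eps n.
Proof. by rewrite divr_ge0 ?sqrtr_ge0. Qed.

Lemma mem_large (eps : R) n (i : 'I_n) :
  (i \in (~: small_vertices n (d n) eps)%SET) = (eps < (d n i)%:R / s n).
Proof.
have s0 : 0 < s n.
  by rewrite sqrtr_gt0 ltr0n (leq_trans _ (ell_ge (@d_gt0 n))) // (leq_ltn_trans _ (ltn_ord i)).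
by rewrite !inE -ltNge ltr_pdivlMr.
Qed.

(** Test functions of compact support see [rho_ n] between eps and any [M] only.
    No mass escapes beyond: [rho_ n] has first moment 1, hence mass at most
    1 / [M] above [M]. *)
Lemma vague_cvg0_large_density (rho : {measure set R -> \bar R}) :
  vague_cvg (fun n => rho_ n (d n)) rho ->
  (forall A : set R, measurable A -> A `<=` `]0, +oo[ -> rho A = 0%E) ->
  forall eps, 0 < eps -> large_density eps n @[n --> \oo] --> (0 : R).
Proof.
move=> vc rho0 eps e0; apply/cvgrPdist_le => eta eta0.
have eta2 : 0 < 2 / eta by rewrite divr_gt0.
(* Chosen so that 1 / M <= eta / 2 and eps <= M. *)
pose M := 2 / eta + eps; have M0 : 0 < M by rewrite addr_gt0.
have epsM : eps <= M by rewrite /M lerDr ltW.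
(* A bump that is at least eps / 2 on [eps, M] and lives on [eps / 2, M + 1]. *)
pose f (x : R) := Num.max 0 ((x - eps / 2) * (M + 1 - x)).
have cf : continuous f.
  move=> x; apply: (@continuous_max _ _ (fun=> 0) (fun x => (x - eps / 2) * (M + 1 - x))); first exact: cst_continuous.
  apply: continuousM; first by apply: continuousB => //; exact: cst_continuous.
  by apply: continuousB => //; exact: cst_continuous.
have f0 x : 0 <= f x by rewrite le_max lexx.
have mf : measurable_fun (`]0, +oo[ : set R) f.
  by apply: measurable_funTS; exact: continuous_measurable_fun.
have mfe : measurable_fun (`]0, +oo[ : set R) (EFin \o f) by exact/measurable_EFinP.
have mD : measurable (`]0%R, +oo[ : set R) by exact: measurable_itv.
have supp : exists K : set R, [/\ compact K, K `<=` `]0, +oo[ & forall x, ~ K x -> f x = 0].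
  exists (`[eps / 2, M + 1]%classic : set R); split; first exact: segment_compact.
    move=> x /=; rewrite !in_itv /= andbT => /andP[xe _].
    by apply: lt_le_trans xe; rewrite divr_gt0.
  move=> x /= /negP; rewrite in_itv /= negb_and -!ltNge => h; apply/max_idPl.
  by case/orP: h => h; [apply: mulr_le0_ge0|apply: mulr_ge0_le0]; lra.
have := vc f cf supp; rewrite (null_set_integral mD mfe (rho0 _ mD (fun _ h => h))).
under eq_fun do rewrite (integral_rho (@d_gt0 _) mf f0).
move=> /fine_cvg /cvgrPdist_le /= fc.
have e4 : 0 < eps * eta / 4 by rewrite divr_gt0 // mulr_gt0.
have [n1 _ hn1] := fc _ e4; exists (maxn n1 1) => // n /= nn1.
rewrite sub0r normrN ger0_norm ?large_density_ge0 //.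
have := hn1 n (leq_trans (leq_maxl _ _) nn1).
rewrite sub0r normrN ger0_norm; last by rewrite divr_ge0 ?sqrtr_ge0 // sumr_ge0.
have n0 := leq_trans (leq_maxr n1 1) nn1.
have N0 : (0 < ell n (d n))%N := leq_trans n0 (ell_ge (@d_gt0 n)).
have s0 : 0 < s n by rewrite sqrtr_gt0 ltr0n.
have sN : s n * s n = N n by rewrite -expr2 sqr_sqrtr.
rewrite ler_pdivrMr // => sumf.
have tail : \sum_(i < n) (d n i)%:R / s n = s n.
  by rewrite -mulr_suml -natr_sum -/(ell n (d n)) -[X in X / _]sN mulfK // gt_eqF.
rewrite /large_density ler_pdivrMr //.
rewrite -sum1_card natr_sum.
apply: (@le_trans _ _ (\sum_(i < n) (2 / eps * f ((d n i)%:R / s n) + ((d n i)%:R / s n) / M))).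
  rewrite big_mkcond /=; apply: ler_sum => i _; rewrite mem_large.
  set x := (d n i)%:R / s n; have x0 : 0 <= x by rewrite divr_ge0 // ltW.
  have fx0 : 0 <= 2 / eps * f x by rewrite mulr_ge0 // divr_ge0 // ltW.
  have xM : 0 <= x / M by rewrite divr_ge0 // ltW.
  case: ifPn => [xe|_]; last by rewrite addr_ge0.
  have [xlM|xgM] := leP x M; last first.
    by rewrite ler_wpDl // ler_pdivlMr // mul1r ltW.
  rewrite ler_wpDr // mulrAC ler_pdivlMr // mul1r.
  have : eps / 2 * 1 <= f x.
    by rewrite le_max; apply/orP; right; apply: ler_pM; lra.
  lra.
rewrite big_split /= -mulr_sumr -mulr_suml tail.
have h1 : 2 / eps * (\sum_(i < n) f ((d n i)%:R / s n)) <= 2 / eps * (eps * eta / 4 * s n).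
  by rewrite ler_wpM2l // divr_ge0 // ltW.
have h2 : 2 / eps * (eps * eta / 4 * s n) = eta / 2 * s n by field; rewrite gt_eqF.
have h3 : s n / M <= eta / 2 * s n.
  rewrite ler_pdivrMr // (_ : eta / 2 * s n * M = s n + eta / 2 * s n * eps).
    by rewrite lerDl !mulr_ge0 ?invr_ge0 // ltW.
  by rewrite /M; field; rewrite gt_eqF.
lra.
Qed.

(** A continuous function with compact support in (0, +oo) is bounded and
    vanishes near 0, so its integral is at most a multiple of a
    [large_density]. *)
Lemma large_density_vague_cvg0 :
  (forall eps, 0 < eps -> large_density eps n @[n --> \oo] --> (0 : R)) ->
  vague_cvg (fun n => rho_ n (d n)) (mzero : {measure set R -> \bar R}).
Proof.
move=> ld f cf [K [cK K0 fK]]; rewrite integral_measure_zero.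
have mD : measurable (`]0%R, +oo[ : set R) by exact: measurable_itv.
have mf : measurable_fun (`]0, +oo[ : set R) f.
  by apply: measurable_funTS; exact: continuous_measurable_fun.
have mfe : measurable_fun (`]0, +oo[ : set R) (EFin \o f) by exact/measurable_EFinP.
have [eps e0 Ke] : exists2 eps, 0 < eps & forall x, K x -> eps <= x.
  have clK : closed K by apply: compact_closed => //; exact: norm_hausdorff.
  have : nbhs (0 : R) (~` K).
    apply: open_nbhs_nbhs; split; first exact: closed_openC.
    by move=> /K0 /=; rewrite in_itv /= ltxx.
  move=> /nbhs_ballP[eps /= e0 be]; exists eps => // x Kx; rewrite leNgt.
  apply/negP => xe; apply: (be x) => //; rewrite /ball /= sub0r normrN.
  by have := K0 x Kx; rewrite /= in_itv /= andbT => x0; rewrite gtr0_norm.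
have [C [C0 fC]] : exists C, 0 <= C /\ forall x, `|f x| <= C.
  have : bounded_set (f @` K).
    by apply: compact_bounded; apply: continuous_compact => //; exact: continuous_subspaceT.
  move=> [M [_ hM]]; exists (`|M| + 1); split; first by rewrite addr_ge0.
  move=> x; have [Kx|nK] := pselect (K x); last by rewrite fK // normr0 addr_ge0.
  by apply: (hM (`|M| + 1)); [rewrite (le_lt_trans (ler_norm _)) // ltrDl|exists x].
apply/cvg_abse0P.
have e2 : 0 < eps / 2 by rewrite divr_gt0.
have cv : (C * large_density (eps / 2) n)%:E @[n --> \oo] --> (0 : \bar R).
  by apply: cvg_EFin; [exact: nearW|rewrite -(mulr0 C); apply: cvgM; [exact: cvg_cst|exact: ld]].
apply: (squeeze_cvge _ (cvg_cst 0%E) cv).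
apply: nearW => n; rewrite /= abse_ge0 /=.
apply: le_trans (le_abse_integral _ mD mfe) _.
have mf' : measurable_fun (`]0, +oo[ : set R) (fun x => `|f x|).
  exact: measurableT_comp.
rewrite (integral_rho (@d_gt0 n) mf') // lee_fin /large_density mulrA.
rewrite ler_wpM2r ?invr_ge0 ?sqrtr_ge0 // -sum1_card natr_sum mulr_sumr.
rewrite [leRHS]big_mkcond /=; apply: ler_sum => i _; rewrite mem_large mulr1.
case: ifPn => [_|]; first exact: fC.
rewrite -leNgt => h; rewrite fK ?normr0 // => /Ke; lra.
Qed.

End degree_measures.

(** * Two test functions on unlabeled multigraphs *)

Section test_functions.
Context {R : realType}.

(** Read off the canonical representative of the class; by [has_loop_unlabel]
    any other one gives the same value. *)
Definition has_loop (H : umgraph) : R :=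
  [exists v, (0 < tagged (repr H) v v)%N]%:R.

Definition is_empty (H : umgraph) : R := (H == disjoint_edges 0)%:R.

Lemma has_loop_bounded H : `|has_loop H| <= 1.
Proof. by rewrite /has_loop; case: [exists _, _]; rewrite ?normr1 ?normr0 ?ler01. Qed.

Lemma is_empty_bounded H : `|is_empty H| <= 1.
Proof. by rewrite /is_empty; case: eqP; rewrite ?normr1 ?normr0 ?ler01. Qed.

Lemma has_loop_unlabel n (G : mgraph n) :
  has_loop (unlabel G) = [exists v, (0 < G v v)%N]%:R.
Proof.
have : mgraph_iso (repr (unlabel G)) (Tagged mgraph G).
  by apply/(@eqquotP _ _ umgraph); rewrite reprK.
rewrite /has_loop => /asboolP[f [g fK gK] fG]; congr ((nat_of_bool _)%:R).
apply/existsP/existsP => -[v]; rewrite /= => v0.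
  by exists (f v); rewrite -[G _ _]/(tagged (Tagged mgraph G) _ _) fG.
by exists (g v); rewrite -fG gK.
Qed.

(** A vertex with a loop is not isolated, so the loop is seen as soon as the
    vertex is kept. *)
Lemma Smpl_has_loop n (G : mgraph n) (p : R) :
  Smpl G p has_loop = 1 - (1 - p) ^+ #|loopy G|.
Proof.
rewrite -(bern_disjoint p (loopy G)) -[X in X - _](@bern_cst R 'I_n p 1) -bernB.
apply: eq_bern => S; rewrite /sampled has_loop_unlabel.
have -> : [exists v, (0 < Defs.induced G (non_isolated G S) v v)%N] =
    ~~ [disjoint loopy G & S].
  apply/existsP/idP => [[x]|].
    rewrite mxE => Gx; rewrite -setI_eq0; apply/set0Pn; exists (enum_val x).
    rewrite !inE Gx /=; have := enum_valP x; by rewrite inE => /andP[].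
  rewrite -setI_eq0 => /set0Pn[v]; rewrite !inE => /andP[Gv vS].
  have vA : v \in non_isolated G S.
    by rewrite inE vS; apply/exists_inP; exists v.
  by exists (enum_rank_in vA v); rewrite mxE enum_rankK_in.
by have [_|_] := boolP [disjoint loopy G & S]; rewrite ?subrr ?subr0.
Qed.

Lemma GP_has_loop (I t : R) : GP_isolated I t has_loop = 0.
Proof.
rewrite /GP_isolated (@eq_Rintegral _ _ _ _ _ (fun=> 0)).
  by rewrite Rintegral_cst // mul0r.
move=> k _; rewrite /disjoint_edges has_loop_unlabel.
by case: existsP => // -[v]; rewrite mxE eqxx.
Qed.

Lemma is_empty_disjoint k : is_empty (disjoint_edges k) = (k == 0%N)%:R.
Proof.
rewrite /is_empty; congr ((nat_of_bool _)%:R); apply/eqP/eqP => [|-> //].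
move=> /eqquotP/asboolP[f bf _]; have := bij_eq_card bf.
by rewrite !card_ord => /eqP; rewrite double_eq0 => /eqP.
Qed.

Lemma GP_is_empty (I t : R) : 0 <= I -> GP_isolated I t is_empty = expR (- (t ^+ 2 * I)).
Proof.
move=> I0; rewrite /GP_isolated; have l0 : 0 <= t ^+ 2 * I by rewrite mulr_ge0 ?sqr_ge0.
have hM k : `|is_empty (disjoint_edges k)| <= 1 by exact: is_empty_bounded.
have := cvg_poisson_sum l0 hM.
have -> : (fun K => (\sum_(j < K.+1) pweight (t ^+ 2 * I) j * is_empty (disjoint_edges j)) *
   expR (- (t ^+ 2 * I))) = (fun=> expR (- (t ^+ 2 * I))).
  apply/funext => K; rewrite big_ord_recl big1 => [|j _].
    by rewrite addr0 is_empty_disjoint eqxx mulr1 /pweight expr0 fact0 divr1 mul1r.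
  by rewrite is_empty_disjoint /= mulr0.
by move=> /(cvg_unique _ (cvg_cst _)) <-.
Qed.

End test_functions.

(** * Almost every sequence of configuration-model graphs *)

Section almost_sure.
Context {R : realType} (d : nat -> nat -> nat).
Hypothesis d_gt0 : forall n i, (i < n)%N -> (0 < d n i)%N.
Hypothesis max_d :
  (\max_(i < n) d n i)%:R / (ell n (d n))%:R @[n --> \oo] --> (0 : R).
Local Notation N n := ((ell n (d n))%:R : R).
Local Notation s n := (Num.sqrt (N n)).
Local Notation b_ n := (int_min1 (rho_ n (d n)) : R).
Local Notation sparse :=
  (forall eps : R, 0 < eps -> large_density d eps n @[n --> \oo] --> (0 : R)).

Lemma near_ell_ge (x : R) : \forall n \near \oo, x <= N n.
Proof.
near=> n; apply: (@le_trans _ _ n%:R); last by rewrite ler_nat ell_ge //; exact: d_gt0.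
by near: n; exact: nbhs_infty_ger.
Unshelve. all: by end_near. Qed.

Lemma near_sqrt_ell_ge (x : R) : \forall n \near \oo, x <= s n.
Proof.
near=> n; apply: le_trans (ler_norm x) _; rewrite -sqrtr_sqr ler_wsqrtr //.
by near: n; exact: near_ell_ge.
Unshelve. all: by end_near. Qed.

Lemma ae_nat (P : probability mgraph_seq R) (Q : nat -> mgraph_seq -> Prop) :
  (forall k, {ae P, forall G, Q k G}) -> {ae P, forall G, forall k, Q k G}.
Proof.
move=> aeQ; apply: negligibleS (negligible_bigcup aeQ).
move=> G /= /existsNP[k nQ]; by exists k.
Qed.

Lemma ae_typical (P : probability mgraph_seq R) (eps : R) :
  is_P_CM d P -> 0 < eps -> eps <= 1 ->
  {ae P, forall G : mgraph_seq, \forall n \near \oo, typical (d n) eps (G n)}.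
Proof.
move=> P_CM e0 e1.
pose X : R := 256 / eps ^+ 4 + 6 / ((eps / 4) ^+ 2 / 32) ^+ 2.
have X0 : 0 <= X.
  apply: addr_ge0; apply: divr_ge0; [exact: ler0n| |exact: ler0n|exact: sqr_ge0].
  by rewrite exprn_ge0 // ltW.
have e4 : 0 < eps / 4 by rewrite divr_gt0.
have := @borel_cantelli_CM R d P P_CM (fun n => @atypical R n (d n) eps) (6 * X).
suff H : \forall n \near \oo, CM_law (d n) (@atypical R n (d n) eps) <=
     6 * X / (n.+1%:R * n.+2%:R).
  move=> /(_ H); apply: filterS => G; apply: filterS => n; exact: contrapT.
near=> n.
have n1 : (1 <= n)%N by near: n; exists 1%N.
have nN : (n <= ell n (d n))%N by apply: ell_ge => i; exact: d_gt0.
have N0 : 0 < N n by rewrite ltr0n (leq_trans n1).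
have es : 1 <= eps * s n.
  by rewrite mulrC -ler_pdivrMr // mul1r; near: n; exact: near_sqrt_ell_ge.
have s8 : 8 <= s n by near: n; exact: near_sqrt_ell_ge.
have Dle (i : 'I_n) : (d n i <= \max_(i < n) d n i)%N by exact: leq_bigmax.
have De : 4 * (\max_(i < n) d n i)%:R <= eps * N n.
  have : `|0 - (\max_(i < n) d n i)%:R / N n| <= eps / 4.
    by near: n; move/cvgrPdist_le : max_d; apply.
  rewrite sub0r normrN ger0_norm ?divr_ge0 // ler_pdivrMr //; lra.
apply: le_trans (CM_law_atypical e0 e1 es s8 Dle De) _; rewrite -/X.
(* (n + 1) (n + 2) <= 6 n^2 <= 6 N^2. *)
rewrite [6 * X]mulrC -mulrA ler_wpM2l // ler_pdivlMr; last by rewrite mulr_gt0.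
rewrite mulrC ler_pdivrMr ?exprn_gt0 //.
rewrite -natrX -!natrM ler_nat.
apply: (@leq_trans (6 * (n * n))); first by nia.
by rewrite leq_mul // -mulnn leq_mul.
Unshelve. all: by end_near. Qed.

(** [c] is the limit of b_n when that limit is known to exist, and b_n itself when
    it has yet to be found. *)
Lemma typical_sampling_cvg (G : forall n, mgraph n) (c : nat -> R) (t M : R)
    (h : umgraph -> R) : sparse ->
  (forall k, \forall n \near \oo, typical (d n) (k.+2%:R^-1 : R) (G n)) ->
  (forall n, 0 <= c n <= 1) -> c n - b_ n @[n --> \oo] --> (0 : R) ->
  0 < t -> (forall H, `|h H| <= M) ->
  Smpl (G n) (Num.min 1 (t / Num.sqrt (2 * (nb_edges (G n))%:R))) h -
    GP_isolated (c n ^+ 2 / 2) t h @[n --> \oo] --> (0 : R).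
Proof.
move=> sp typ c01 cb t0 hM; apply/cvgrPdist_le => e e0.
pose A : R := 2 * M * (10 * t + 10 * t ^+ 2 + 8 * t ^+ 3) +
   2 * M * expR (t ^+ 2) * (7 * t ^+ 2 + 32 * t ^+ 3 + 8 * t ^+ 4).
pose k := Num.truncn (`|A| / e); pose de : R := k.+2%:R^-1.
have de0 : 0 < de by rewrite invr_gt0.
have de2 : de <= 2^-1 by rewrite lef_pV2 ?posrE // ler_nat.
have Ade : A * de <= e.
  rewrite ler_pdivrMr // mulrC -ler_pdivrMr //.
  apply: (@le_trans _ _ (`|A| / e)); first by rewrite ler_wpM2r ?invr_ge0 ?(ltW e0) // ler_norm.
  by apply: ltW; apply: lt_le_trans (truncnS_gt _) _; rewrite ler_nat.
have de2' : 0 < de / 2 by rewrite divr_gt0.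
near=> n; rewrite sub0r normrN; apply: le_trans Ade.
have ld : large_density d de n <= de / 2.
  have : `|0 - large_density d de n| <= de / 2.
    by near: n; have /cvgrPdist_le := sp de de0; apply.
  by rewrite sub0r normrN ger0_norm // large_density_ge0.
have n1 : (1 <= n)%N by near: n; exists 1%N.
have s0 : 0 < s n.
  by rewrite sqrtr_gt0 ltr0n (leq_trans n1) //; apply: ell_ge => i; exact: d_gt0.
have /andP[c0 c1] := c01 n.
apply: (@typical_sampling _ _ (d n)) => //.
- by near: n; exact: (typ k).
- have h1 : `|0 - (c n - b_ n)| <= de / 2.
    by near: n; move/cvgrPdist_le : cb; apply.
  have de1 : de <= 1 by lra.
  have h2 := int_min1_small (@d_gt0 n) de0 de1.
  rewrite -(subrK (b_ n) (c n)) -addrA; apply: le_trans (ler_normD _ _) _.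
  rewrite sub0r normrN in h1; have h3 := le_trans h2 ld; lra.
- by move: ld; rewrite /large_density ler_pdivrMr //; have := mulr_gt0 de0 s0; lra.
- by rewrite mulrC -ler_pdivrMr // mul1r; near: n; exact: near_ell_ge.
- by near: n; exact: near_ell_ge.
Unshelve. all: by end_near. Qed.

(** Countably many tolerances, all at most 1/2, so that the exceptional null sets
    can be collected into one. *)
Lemma ae_typical_all (P : probability mgraph_seq R) : is_P_CM d P ->
  {ae P, forall G : mgraph_seq, forall k,
     \forall n \near \oo, typical (d n) (k.+2%:R^-1 : R) (G n)}.
Proof.
move=> P_CM; apply: ae_nat => k; apply: ae_typical => //.
by rewrite invf_le1 // ler1n.
Qed.

Lemma ae_sampling_cvg (P : probability mgraph_seq R) (b : R) : is_P_CM d P ->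
  sparse -> b_ n @[n --> \oo] --> b ->
  {ae P, forall G : mgraph_seq, sampling_cvg G (GP_isolated (b ^+ 2 / 2))}.
Proof.
move=> P_CM sp bb; have b01 : 0 <= b <= 1.
  have cvb : cvgn (fun n => b_ n) by apply/cvg_ex; exists b.
  rewrite -(cvg_lim _ bb) //; apply/andP; split.
    by apply: limr_ge => //; apply: nearW => n; apply: int_min1_ge0; exact: d_gt0.
  by apply: limr_le => //; apply: nearW => n; apply: int_min1_le1; exact: d_gt0.
apply: filterS (ae_typical_all P_CM) => G typ t t0 h [M hM].
have cb : b - b_ n @[n --> \oo] --> (0 : R).
  by rewrite -(subrr b); apply: cvgB => //; exact: cvg_cst.
have cv := typical_sampling_cvg sp typ (fun=> b01) cb t0 hM.
rewrite -[GP_isolated _ _ _]add0r.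
rewrite (_ : (fun n => _) = (fun n =>
    (Smpl (G n) (Num.min 1 (t / Num.sqrt (2 * (nb_edges (G n))%:R))) h -
     GP_isolated (b ^+ 2 / 2) t h) + GP_isolated (b ^+ 2 / 2) t h)).
  by apply: cvgD => //; exact: cvg_cst.
by apply/funext => n; rewrite subrK.
Qed.

(** Otherwise, for infinitely many [n], with probability bounded below, at least
    c eta sqrt N vertices carry a loop; then the sample at t = 1 contains a loop
    with probability at least [kap] > 0, whereas this probability tends to 0
    almost surely. *)
Lemma ae_sampling_sparse (P : probability mgraph_seq R) (I : R) : is_P_CM d P ->
  {ae P, forall G : mgraph_seq, sampling_cvg G (GP_isolated I)} -> sparse.
Proof.
move=> P_CM aeI.
suff sp1 (eps : R) : 0 < eps -> eps <= 1 -> large_density d eps n @[n --> \oo] --> (0 : R).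
  move=> eps e0; have [e1|e1] := leP eps 1; first exact: sp1.
  apply: (@squeeze_cvgr _ _ _ _ (fun=> 0) (large_density d 1)).
  - apply: nearW => n; rewrite large_density_ge0 /=.
    rewrite ler_wpM2r ?invr_ge0 ?sqrtr_ge0 // ler_nat; apply/subset_leq_card.
    apply/fintype.subsetP => i; rewrite !(mem_large d_gt0) => h.
    exact: lt_trans e1 h.
  - exact: cvg_cst.
  - exact: sp1.
move=> e0 e1; apply: contrapT => ncv.
have [eta eta0 often] : exists2 eta : R, 0 < eta &
    forall n0, exists2 n, (n0 <= n)%N & eta < large_density d eps n.
  apply: contrapT => H; apply: ncv; apply/cvgrPdist_le => eta eta0.
  apply: contrapT => nn; apply: H; exists eta => // n0.
  apply: contrapT => H'; apply: nn; exists n0 => // n /= n0n.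
  rewrite sub0r normrN ger0_norm ?large_density_ge0 // leNgt; apply/negP => h.
  by apply: H'; exists n.
pose W n : {set 'I_n} := (~: small_vertices n (d n) eps)%SET.
pose c : R := eps ^+ 2 / 32.
have c0 : 0 < c by rewrite divr_gt0 // exprn_gt0.
pose A n : set (mgraph n) := fun G => eta < large_density d eps n /\
   c * #|W n|%:R <= #|(W n :&: loopy G)%SET|%:R.
apply: (@not_eventually_CM R d P P_CM A c c0).
  move=> n0; have [n1 _ hn1] := near_sqrt_ell_ge (4 / eps).
  have [n nn dn] := often (maxn n0 (maxn n1 1)).
  have n0n : (n0 <= n)%N := leq_trans (leq_maxl _ _) nn.
  have n1n : (n1 <= n)%N := leq_trans (leq_trans (leq_maxl _ _) (leq_maxr _ _)) nn.
  have n1' : (1 <= n)%N := leq_trans (leq_trans (leq_maxr _ _) (leq_maxr _ _)) nn.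
  exists n => //; have s4 : 4 <= eps * s n by rewrite mulrC -ler_pdivrMr //; exact: hn1.
  have s0 : 0 < s n.
    by rewrite sqrtr_gt0 ltr0n (leq_trans n1') //; apply: ell_ge => i; exact: d_gt0.
  have Wd i : i \in W n -> eps * s n < (d n i)%:R.
    by rewrite (mem_large d_gt0) ltr_pdivlMr.
  have W0 : (0 < #|W n|)%N.
    rewrite lt0n; apply/eqP => W0; move: dn; rewrite /large_density -/(W n) W0 mul0r.
    by rewrite ltNge ltW.
  have := many_loops_law e0 e1 s4 Wd W0.
  have pm0 : 0 < #|perfect_matchings n (d n)|%:R :> R.
    rewrite ltr0n lt0n; apply/eqP => pm0.
    have := CM_law_setT P_CM n; rewrite /CM_law pm0 invr0 mulr0 => /eqP.
    by rewrite eq_sym oner_eq0.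
  rewrite /CM_law ler_pdivlMr // => /le_trans; apply; rewrite ler_nat.
  apply/subset_leq_card/fintype.subsetP => M; rewrite !inE => /andP[-> h] /=.
  by apply/asboolP; split.
have typ := ae_typical_all P_CM.
apply: filterS2 aeI typ => G GI /(_ 0%N) typG.
have := GI 1 ltr01 has_loop (ex_intro _ 1 has_loop_bounded).
rewrite GP_has_loop => /cvgrPdist_lt.
pose kap : R := 1 - expR (- (c * eta)).
have kap0 : 0 < kap by rewrite subr_gt0 expR_lt1 oppr_lt0 mulr_gt0.
move=> /(_ _ kap0) small; near=> n => -[dn loops].
have : `|0 - Smpl (G n) (Num.min 1 (1 / Num.sqrt (2 * (nb_edges (G n))%:R))) has_loop| < kap.
  by near: n.
have [Te Te' _ _ _ _] : typical (d n) (2^-1 : R) (G n) by near: n.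
rewrite sub0r normrN Smpl_has_loop; set p := Num.min _ _.
have N1 : 1 <= N n by near: n; exact: near_ell_ge.
have N0 : 0 < N n by lra.
have e_gt0 : 0 < 2 * (nb_edges (G n))%:R :> R by lra.
have s0 : 0 < s n by rewrite sqrtr_gt0; lra.
have s1 : 1 <= s n by rewrite -[leLHS]sqrtr1 ler_wsqrtr.
have pge : (s n)^-1 <= p.
  rewrite le_min invf_le1 // s1 /= mul1r lef_pV2 ?posrE ?sqrtr_gt0 //.
  exact: ler_wsqrtr.
have p1 : p <= 1 by rewrite ge_min lexx.
have p0 : 0 < p by apply: lt_le_trans pge; rewrite invr_gt0.
have L_ge : c * eta * s n <= #|loopy (G n)|%:R.
  apply: (@le_trans _ _ #|(W n :&: loopy (G n))%SET|%:R); last first.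
    by rewrite ler_nat subset_leq_card // finset.subsetIr.
  apply: le_trans loops; rewrite -mulrA ler_wpM2l ?(ltW c0) //.
  by move: dn; rewrite /large_density ltr_pdivlMr // => /ltW.
have pow_le : (1 - p) ^+ #|loopy (G n)| <= expR (- (c * eta)).
  apply: (@le_trans _ _ (expR (- p) ^+ #|loopy (G n)|)).
    by rewrite lerXn2r ?nnegrE ?expR_ge0 ?subr_ge0 // expR_ge1Dx.
  rewrite -expRM_natl ler_expR mulrN lerN2.
  apply: (@le_trans _ _ (c * eta * s n * (s n)^-1)); first by rewrite mulfK // gt_eqF.
  by apply: ler_pM => //; rewrite ?invr_ge0 ?(ltW s0) // !mulr_ge0 // ltW.
rewrite ger0_norm; last first.
  by rewrite subr_ge0 exprn_ile1 ?subr_ge0 // lerBlDr lerDl ltW.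
rewrite /kap; lra.
Unshelve. all: by end_near. Qed.

Lemma ae_nonempty (P : probability mgraph_seq R) (Q : mgraph_seq -> Prop) :
  {ae P, forall G, Q G} -> exists G, Q G.
Proof.
move=> aeQ; apply: contrapT => nQ.
have : P setT = 0%E.
  have [B [mB PB sB]] := aeQ; apply/eqP; rewrite -measure_le0 -PB le_measure ?inE //.
  by move=> G _; apply: sB => /= QG; apply: nQ; exists G.
by rewrite probability_setT => /eqP; rewrite onee_eq0.
Qed.

(** The probability that the sample at t = 1 is empty is exp(- b_n^2 / 2) + o(1)
    and tends to exp(- I); one realization of the graphs is enough to compare
    these two. *)
Lemma ae_sampling_limit (P : probability mgraph_seq R) (I : R) : is_P_CM d P ->
  0 <= I -> {ae P, forall G : mgraph_seq, sampling_cvg G (GP_isolated I)} ->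
  b_ n @[n --> \oo] --> Num.sqrt (2 * I).
Proof.
move=> P_CM I0 aeI; have sp := ae_sampling_sparse P_CM aeI.
have [G [GI typ]] : exists G : mgraph_seq, sampling_cvg G (GP_isolated I) /\
    forall k, \forall n \near \oo, typical (d n) (k.+2%:R^-1 : R) (G n).
  by apply: (ae_nonempty (P := P)); apply: filterS2 aeI (ae_typical_all P_CM).
have b01 n : 0 <= b_ n <= 1.
  by rewrite int_min1_ge0 ?int_min1_le1 //; exact: d_gt0.
have bb : b_ n - b_ n @[n --> \oo] --> (0 : R).
  by under eq_fun do rewrite subrr; exact: cvg_cst.
have cv := typical_sampling_cvg sp typ b01 bb ltr01 is_empty_bounded.
have cI := GI 1 ltr01 is_empty (ex_intro _ 1 is_empty_bounded).
have cexp : expR (- (b_ n ^+ 2 / 2)) @[n --> \oo] --> expR (- I).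
  pose X n : R := Smpl (G n) (Num.min 1 (1 / Num.sqrt (2 * (nb_edges (G n))%:R))) is_empty.
  rewrite (_ : (fun n => _) =
      (fun n => X n - (X n - GP_isolated (b_ n ^+ 2 / 2) 1 is_empty))); last first.
    apply/funext => n; rewrite opprB addrC subrK.
    by rewrite GP_is_empty ?divr_ge0 ?sqr_ge0 // expr1n mul1r.
  rewrite (_ : expR (- I) = GP_isolated I 1 is_empty - 0); first exact: cvgB.
  by rewrite subr0 GP_is_empty // expr1n mul1r.
have cln : b_ n ^+ 2 / 2 @[n --> \oo] --> I.
  rewrite (_ : (fun n => _) = (fun n => - ln (expR (- (b_ n ^+ 2 / 2))))); last first.
    by apply/funext => n; rewrite expRK opprK.
  rewrite (_ : I = - ln (expR (- I))); last by rewrite expRK opprK.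
  apply: cvgN; apply: continuous_cvg => //.
  by apply: continuous_ln; exact: expR_gt0.
rewrite (_ : (fun n => _) = (fun n => Num.sqrt (2 * (b_ n ^+ 2 / 2)))).
  apply: continuous_cvg; first exact: sqrt_continuous.
  by apply: cvgM => //; exact: cvg_cst.
apply/funext => n /=; rewrite mulrC divfK ?pnatr_eq0 // sqrtr_sqr ger0_norm //.
by have /andP[] := b01 n.
Qed.

Lemma sampling_limit_unique (G : forall n, mgraph n) (I J : R) : 0 <= I -> 0 <= J ->
  sampling_cvg G (GP_isolated I) -> sampling_cvg G (GP_isolated J) -> I = J.
Proof.
move=> I0 J0 GI GJ.
have bnd := ex_intro (fun M : R => forall H, `|is_empty H| <= M) 1 is_empty_bounded.
have : GP_isolated I 1 is_empty = GP_isolated J 1 is_empty :> R.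
  exact: (cvg_unique _ (GI 1 ltr01 _ bnd) (GJ 1 ltr01 _ bnd)).
by rewrite !GP_is_empty // expr1n !mul1r => /expR_inj/eqP; rewrite eqr_opp => /eqP.
Qed.

End almost_sure.

(** * The characterization of sampling convergence *)

Lemma int_min1_null (R : realType) (rho : {measure set R -> \bar R}) :
  (forall A : set R, measurable A -> A `<=` `]0, +oo[ -> rho A = 0%E) ->
  int_min1 rho = 0.
Proof.
move=> rho0; have mD : measurable (`]0%R, +oo[ : set R) by exact: measurable_itv.
rewrite /int_min1 /Rintegral null_set_integral //; last exact: rho0.
by apply/measurable_EFinP; exact: measurable_minr.
Qed.

Theorem corollary1p5 (R : realType) (d : nat -> nat -> nat)
  (d_gt0 : forall n i, (i < n)%N -> (0 < d n i)%N)
  (ell_even : forall n, ~~ odd (ell n (d n)))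
  (max_d : (\max_(i < n) d n i)%:R / (ell n (d n))%:R @[n --> \oo] --> (0 : R))
  (ell_log : (ell n (d n))%:R / ln n%:R @[n --> \oo] --> (+oo : set_system R))
  (P : probability mgraph_seq R) (P_CM : is_P_CM d P) :
  ((exists2 I : R, 0 <= I &
      {ae P, forall G : mgraph_seq, sampling_cvg G (GP_isolated I)}) <->
   (exists (b : R) (rho : {measure set R -> \bar R}),
      [/\ int_min1 (rho_ n (d n)) @[n --> \oo] --> b,
          vague_cvg (fun n => rho_ n (d n)) rho &
          forall A : set R, measurable A -> A `<=` `]0, +oo[ -> rho A = 0%E])) /\
  (forall (b : R) (rho : {measure set R -> \bar R}),
     int_min1 (rho_ n (d n)) @[n --> \oo] --> b ->
     vague_cvg (fun n => rho_ n (d n)) rho ->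
     (forall A : set R, measurable A -> A `<=` `]0, +oo[ -> rho A = 0%E) ->
     forall I : R, 0 <= I ->
       ({ae P, forall G : mgraph_seq, sampling_cvg G (GP_isolated I)} <->
        I = (b - int_min1 rho) ^+ 2 / 2)).
Proof.
have conv (b : R) (rho : {measure set R -> \bar R}) : int_min1 (rho_ n (d n)) @[n --> \oo] --> b ->
    vague_cvg (fun n => rho_ n (d n)) rho ->
    (forall A : set R, measurable A -> A `<=` `]0, +oo[ -> rho A = 0%E) ->
    {ae P, forall G : mgraph_seq, sampling_cvg G (GP_isolated (b ^+ 2 / 2))}.
  move=> bb vc rho0; apply: (ae_sampling_cvg d_gt0 max_d P_CM _ bb).
  exact: vague_cvg0_large_density vc rho0.
split; first split.
- move=> [I I0 aeI]; exists (Num.sqrt (2 * I)), mzero; split => //.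
  + exact: (ae_sampling_limit d_gt0 max_d P_CM I0 aeI).
  + apply: (large_density_vague_cvg0 d_gt0).
    exact: (ae_sampling_sparse d_gt0 max_d P_CM aeI).
- move=> [b [rho [bb vc rho0]]]; exists (b ^+ 2 / 2); last exact: conv vc rho0.
  by rewrite divr_ge0 // sqr_ge0.
move=> b rho bb vc rho0 I I0; rewrite int_min1_null // subr0; split => [aeI|->].
  have [G [GI GJ]] : exists G : mgraph_seq, sampling_cvg G (GP_isolated I) /\
      sampling_cvg G (GP_isolated (b ^+ 2 / 2)).
    by apply: (ae_nonempty (P := P)); apply: filterS2 aeI (conv b rho bb vc rho0).
  by apply: (sampling_limit_unique I0 _ GI GJ); rewrite divr_ge0 // sqr_ge0.
exact: conv vc rho0.
Qed.
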